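(* Let the spatial discretization be one of the two monotone schemes described in the context, with $\beta>0$, $V_i\ge 0$ for all $i$, and $N\ge2$. Let $u^0\in\mathbb R^N$ satisfy $u^0>0$ entrywise and $\|u^0\|_2=1$, set $z^0=u^0$, let $0<\gamma\le\gamma_{\max}$ (defined in the context), and consider the iteration, for $k\ge0$, $$u^k=\frac{z^k}{\|z^k\|_2},\qquad \mathbf x^k=(\mathbb I-\gamma\Delta_h)^{-1}\bigl(2u^k-z^k-\gamma(\mathbb V u^k+\beta (u^k)^3)\bigr),\qquad z^{k+1}=z^k+\mathbf x^k-u^k .$$ Write $E_{\mathrm{GS}}:=E_h(u_{\mathrm{GS}})$, $\lambda_{\mathrm{GS}}:=\lambda(u_{\mathrm{GS}})$, $m_{\mathrm{GS}}:=\min_i(u_{\mathrm{GS}})_i>0$, let $$\mathcal H:=-\Delta_h+\mathbb V+3\beta\,\mathrm{diag}(u_{\mathrm{GS}}^2)-\lambda_{\mathrm{GS}}\mathbb I,$$ and let $\nu$ be the minimum of $\langle w,\mathcal Hw\rangle_h$ over all $w\in\mathcal M$ with $\langle u_{\mathrm{GS}},w\rangle_h=0$. Then $\nu\ge2\beta m_{\mathrm{GS}}^2>0$. Moreover, with $\mu_{\max}$ the largest eigenvalue of $-\Delta_h$ and $$\eta:=\min\Bigl\{\frac{\gamma\nu}{4(1+\gamma\mu_{\max})},\ \frac12\Bigr\}\in(0,1),$$ there is an index $K$ such that, for every $k\ge K$, $$\mathcal L^{k+1}-E_{\mathrm{GS}}\le(1-\eta)\bigl(\mathcal L^k-E_{\mathrm{GS}}\bigr)$$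 and $$E_h(u^k)-E_{\mathrm{GS}}+\frac{(R^k)^2}{\gamma}+\frac\nu4\|u^k-u_{\mathrm{GS}}\|_2^2\le2(1-\eta)^{k-K}\bigl(\mathcal L^K-E_{\mathrm{GS}}\bigr),$$ where $R^k=\|z^k\|_2-1+\gamma\lambda(u^k)$ and $\mathcal L^k=E_h(u^k)+(R^k)^2/\gamma$.
   Context: Discretization. Let $\Omega\subset\mathbb R^d$, $d\in\{1,2,3\}$, be a bounded polytope on which elliptic regularity holds (for the Dirichlet Poisson problem), discretized by a shape-regular mesh with interior nodes $\boldsymbol x_1,\dots,\boldsymbol x_N$. Let $\beta>0$ and let $V$ be a potential with $V_i:=V(\boldsymbol x_i)\ge0$ for every $i$. The scheme is one of the following, with homogeneous Dirichlet boundary condition and nodal basis functions $\phi_1,\dots,\phi_N$ at the interior nodes: (a) continuous piecewise multilinear ($Q^1$) finite elements on a uniform rectangular mesh, integrals evaluated by the two-point Gauss–Lobatto (trapezoidal) rule in each variable on each cell (this coincides with the classical second-order finite difference scheme); or (b) continuous piecewise linear ($P^1$) finite elements on a simplicial mesh, integrals evaluated by the vertex rule $\int_e f\approx\frac{|e|}{d+1}\sum_{\boldsymbol x_v\in e}f(\boldsymbol x_v)$, where (for $d\ge2$) the mesh satisfies $\sum_{T\supset E}\frac1{d(d-1)}|\kappa_E^T|\cot\theta_E^T\ge0$ for every interior edge $E$; here $T$ ranges over simplices containing $E$, $\kappa_E^T$ is the $(d-2)$-dimensional simplex opposite to $E$ in $T$, and $\theta_E^T$ is the dihedral angle between the two faces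 of $T$ containing $\kappa_E^T$ (for $d=2$, the angle opposite to $E$). Let $w_i>0$ be the quadrature weight at $\boldsymbol x_i$, $\mathbb M=\mathrm{diag}(w_1,\dots,w_N)$, $\mathbb V=\mathrm{diag}(V_1,\dots,V_N)$, $\mathbb S_{ij}$ the quadrature value of $\int\nabla\phi_i\cdot\nabla\phi_j$, and $\Delta_h:=-\mathbb M^{-1}\mathbb S$. The matrix $\mathbb S$ is assumed irreducible (connected adjacency graph). Notation. For $v\in\mathbb R^N$: $v^2,v^3$ are entrywise powers, $\|v\|_p^p=\sum_iw_i|v_i|^p$ for $1\le p<\infty$, $\|v\|_\infty=\max_i|v_i|$, $\langle u,v\rangle_h=u^\top\mathbb M v$ (so $\|v\|_2^2=\langle v,v\rangle_h$), and $\|V\|_\infty=\max_i|V_i|$. $\mathcal M=\{u\in\mathbb R^N:\|u\|_2=1\}$. The energy is $E_h(u)=\frac12\langle-\Delta_hu,u\rangle_h+\frac12\langle\mathbb Vu,u\rangle_h+\frac\beta4\|u\|_4^4$; its gradient with respect to $\langle\cdot,\cdot\rangle_h$ is $\nabla E_h(u)=-\Delta_hu+\mathbb Vu+\beta u^3$, and $\lambda(u):=\langle\nabla E_h(u),u\rangle_h$. It is known that, in this setting, the minimizer of $E_h$ on $\mathcal M$ is unique up to sign and has a strictly positive representative, denoted $u_{\mathrm{GS}}$. Constants. $C_S$ is a fixed constant (it can be chosen independently of the mesh size) with $\|v\|_6\le C_S\|v\|_{1,h}$ for all $v\in\mathbb R^N$, where $\|v\|_{1,h}^2:=\langle v,-\Delta_hv\rangle_h+\|v\|_2^2$.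 Let $w_{\min}=\min_iw_i$, $\Lambda_{\mathrm d}=\max_i\mathbb S_{ii}/w_i$, and $$E_0=E_h(u^0)+\frac{\lambda(u^0)^2}{\max\{1,128E_h(u^0)\}},\quad P_0=C_S^2(2E_0+1),\quad U_0=\min\Bigl\{\frac1{w_{\min}},\frac{P_0}{w_{\min}^{1/3}},2\sqrt{\frac{E_0}{\beta w_{\min}}}\Bigr\},$$ $$B_0=\|V\|_\infty+\beta\min\{P_0^{3/2},U_0\},\quad D=E_0+B_0,\quad B_1=\|V\|_\infty+\beta U_0,\quad C_0=3\beta C_SP_0,$$ $$L_0=\|V\|_\infty+\min\bigl\{3\beta U_0,\ C_0+2\max\{C_0-\tfrac14,0\}^2\bigr\},$$ $$\gamma_{\max}=\min\Bigl\{1,\ \frac1{128D},\ \frac1{8L_0},\ \frac{2}{B_1+\sqrt{B_1^2+12D\Lambda_{\mathrm d}}}\Bigr\}.$$ *)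

(* Defs.v *)
From HB Require Import structures.
From mathcomp Require Import all_boot all_order all_algebra.
From mathcomp Require Import all_classical all_reals all_analysis.

Set Implicit Arguments.
Unset Strict Implicit.
Unset Printing Implicit Defensive.

Import Order.TTheory GRing.Theory Num.Theory.
Import numFieldNormedType.Exports.

Local Open Scope classical_set_scope.
Local Open Scope ring_scope.

(** * Extrema *)

Definition is_minimum (R : realType) (A : set R) (m : R) : Prop :=
  A m /\ forall t, A t -> m <= t.

(* The seed of the iterated minimum is the first entry, so for 0 < N this is
   min_i f i; for N = 0 it is 0. *)
Definition vmin (R : realType) (N : nat) (f : 'I_N -> R) : R :=
  \big[Num.min/head 0 (codom f)]_(i < N) f i.

(* max_i f i for nonnegative f; it is only applied to such f. *)
Definition vmax (R : realType) (N : nat) (f : 'I_N -> R) : R :=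
  \big[Num.max/0]_(i < N) f i.

Definition is_largest_eigenvalue (R : realType) (N : nat)
    (A : 'M[R]_N) (mu : R) : Prop :=
  eigenvalue A mu /\ forall a, eigenvalue A a -> a <= mu.

(** * Euclidean geometry *)

Definition dot (R : realType) (d : nat) (x y : 'rV[R]_d) : R :=
  \sum_(k < d) x 0 k * y 0 k.

Definition enorm (R : realType) (d : nat) (x : 'rV[R]_d) : R :=
  Num.sqrt (dot x x).

Definition angle (R : realType) (d : nat) (x y : 'rV[R]_d) : R :=
  acos (dot x y / (enorm x * enorm y)).

Definition cot (R : realType) (t : R) : R := cos t / sin t.

Definition grad (R : realType) (d : nat) (f : 'rV[R]_d -> R) (x : 'rV[R]_d) :
    'rV[R]_d :=
  \row_(k < d) derive1 (fun t : R => f (x + t *: delta_mx 0 k)) 0.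

Definition edge_mx (R : realType) (d : nat) (s : seq 'rV[R]_d) :
    'M[R]_((size s).-1, d) :=
  \matrix_(i < (size s).-1) (s`_i.+1 - s`_0).

(* k-dimensional volume of the simplex with the k.+1 vertices s, by the Gram
   determinant; it is 1 for a single point. *)
Definition simplex_volume (R : realType) (d : nat) (s : seq 'rV[R]_d) : R :=
  Num.sqrt (\det (edge_mx s *m (edge_mx s)^T)) / ((size s).-1)`!%:R.

(* Component of x - s`_0 orthogonal to the affine hull of the affinely
   independent points s. *)
Definition orth_part (R : realType) (d : nat) (s : seq 'rV[R]_d)
    (x : 'rV[R]_d) : 'rV[R]_d :=
  let A := edge_mx s in
  let y := x - s`_0 in
  y - y *m A^T *m invmx (A *m A^T) *m A.

(* Angle between the two half-hyperplanes bounded by the affine hull of s that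
   contain x and y respectively. *)
Definition dihedral_angle (R : realType) (d : nat) (s : seq 'rV[R]_d)
    (x y : 'rV[R]_d) : R :=
  angle (orth_part s x) (orth_part s y).

Definition hull (R : realType) (d : nat) (T : finType) (pos : T -> 'rV[R]_d)
    (A : {set T}) : set 'rV[R]_d :=
  [set x | exists c : T -> R,
    [/\ forall v, 0 <= c v, forall v, v \notin A -> c v = 0,
        \sum_v c v = 1 & x = \sum_v c v *: pos v]].

(** * Nodal finite elements with vertex quadrature *)

(* On each closed cell [region e] the shape functions are indexed by the
   vertices of the cell; every vertex is a quadrature point, and all of them
   carry the same weight [volume e / #|local|]. This covers both the vertex rule
   |e|/(d+1) on a simplex and the tensor trapezoidal rule |e|/2^d on a box. *)
Record fe_space (R : realType) (d : nat) := FESpace {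
  node : finType;
  cell : finType;
  local : finType;
  pos : node -> 'rV[R]_d;
  vert : cell -> local -> node;
  region : cell -> set 'rV[R]_d;
  volume : cell -> R;
  shape : cell -> local -> 'rV[R]_d -> R
}.

Arguments pos {R d} f _.
Arguments vert {R d} f _ _.
Arguments region {R d} f _ _.
Arguments volume {R d} f _.
Arguments shape {R d} f _ _ _.

(* The open polytope triangulated by the mesh. *)
Definition domain (R : realType) (d : nat) (F : fe_space R d) :
    set 'rV[R]_d :=
  interior (\bigcup_(e in [set: cell F]) region F e).

(* Restriction to the cell e of the global nodal basis function at v; it is 0
   if v is not a vertex of e. *)
Definition basis (R : realType) (d : nat) (F : fe_space R d) (v : node F)
    (e : cell F) (x : 'rV[R]_d) : R :=
  \sum_(a : local F | vert F e a == v) shape F e a x.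

Definition quadrature (R : realType) (d : nat) (F : fe_space R d)
    (g : cell F -> 'rV[R]_d -> R) : R :=
  \sum_(e : cell F)
    volume F e / #|local F|%:R * \sum_(a : local F) g e (pos F (vert F e a)).

Definition node_weight (R : realType) (d : nat) (F : fe_space R d)
    (v : node F) : R :=
  \sum_(e : cell F) \sum_(a : local F | vert F e a == v)
    volume F e / #|local F|%:R.

Definition node_stiffness (R : realType) (d : nat) (F : fe_space R d)
    (v v' : node F) : R :=
  quadrature (fun (e : cell F) x => dot (grad (basis v e) x) (grad (basis v' e) x)).

(* The x_i are the interior nodes, listed without repetition. *)
Definition interior_numbering (R : realType) (d N : nat) (F : fe_space R d)
    (x : 'I_N -> node F) : Prop :=
  injective x /\ forall v : node F, domain F (pos F v) <-> exists i, x i = v.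

(** ** Q1 elements on a uniform rectangular mesh *)

(* A finite union of cells of a uniform grid: the box with multi-index c is
   the product of the [o_k + c_k h_k, o_k + (c_k + 1) h_k]. Any finite set of
   boxes of the grid is of this form for n large enough, up to a translation. *)
Record rect_mesh (R : realType) (d : nat) := RectMesh {
  rm_origin : 'I_d -> R;
  rm_step : 'I_d -> R;
  rm_size : nat;
  rm_cells : {set {ffun 'I_d -> 'I_rm_size}};
  rm_step_gt0 : forall k, 0 < rm_step k
}.

Definition q1_space (R : realType) (d : nat) (G : rect_mesh R d) :
    fe_space R d :=
  @FESpace R d
    {ffun 'I_d -> 'I_(rm_size G).+1}
    {c : {ffun 'I_d -> 'I_(rm_size G)} | c \in rm_cells G}
    {ffun 'I_d -> bool}
    (fun m => \row_k (rm_origin G k + (m k)%:R * rm_step G k))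
    (fun c a => [ffun k => inord (val c k + a k)%N])
    (fun c => [set x : 'rV[R]_d | forall k,
       rm_origin G k + (val c k)%:R * rm_step G k <= x 0 k
         <= rm_origin G k + (val c k).+1%:R * rm_step G k])
    (fun _ => \prod_k rm_step G k)
    (fun c a x => \prod_k
       let s := (x 0 k - (rm_origin G k + (val c k)%:R * rm_step G k))
                / rm_step G k in
       if a k then s else 1 - s).

(** ** P1 elements on a simplicial mesh *)

(* Rows (1, p_a): the a-th barycentric coordinate of x is the a-th entry of
   (1, x) times the inverse of this matrix, and the volume of the simplex is
   the absolute value of its determinant divided by d!. *)
Definition vertex_mx (R : realType) (d : nat) (p : 'I_d.+1 -> 'rV[R]_d) :
    'M[R]_(d.+1, 1 + d) :=
  \matrix_(a < d.+1) row_mx 1%:M (p a).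

Record simplicial_mesh (R : realType) (d : nat) := SimplicialMesh {
  sm_node : finType;
  sm_cell : finType;
  sm_pos : sm_node -> 'rV[R]_d;
  sm_vert : sm_cell -> 'I_d.+1 -> sm_node;
  sm_verts := fun e => [set sm_vert e a | a : 'I_d.+1]%SET;
  sm_pos_inj : injective sm_pos;
  sm_node_used : forall v, exists e a, sm_vert e a = v;
  sm_nondegenerate :
    forall e, vertex_mx (fun a => sm_pos (sm_vert e a)) \in unitmx;
  sm_verts_inj : injective sm_verts;
  sm_conforming : forall e e',
    hull sm_pos (sm_verts e) `&` hull sm_pos (sm_verts e')
    = hull sm_pos (sm_verts e :&: sm_verts e')%SET
}.

Arguments sm_pos {R d} s _.
Arguments sm_vert {R d} s _ _.
Arguments sm_verts {R d} s _.

Definition p1_space (R : realType) (d : nat) (T : simplicial_mesh R d) :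
    fe_space R d :=
  let VM e := vertex_mx (fun a => sm_pos T (sm_vert T e a)) in
  @FESpace R d (sm_node T) (sm_cell T) 'I_d.+1 (sm_pos T) (sm_vert T)
    (fun e => hull (sm_pos T) (sm_verts T e))
    (fun e => `|\det (VM e)| / d`!%:R)
    (fun e a x => ((row_mx 1%:M x : 'rV[R]_(1 + d)) *m invmx (VM e)) 0 a).

(* v and v' span an edge of the mesh that is not contained in the boundary. *)
Definition interior_edge (R : realType) (d : nat) (T : simplicial_mesh R d)
    (v v' : sm_node T) : Prop :=
  [/\ v != v',
      exists e, (v \in sm_verts T e) && (v' \in sm_verts T e)
    & exists2 t : R, 0 <= t <= 1 &
        domain (p1_space T) ((1 - t) *: sm_pos T v + t *: sm_pos T v')].

(* Vertices of the simplex opposite, in the cell e, to the edge joining the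
   local vertices a and b. *)
Definition opposite (R : realType) (d : nat) (T : simplicial_mesh R d)
    (e : sm_cell T) (a b : 'I_d.+1) : seq 'rV[R]_d :=
  [seq sm_pos T (sm_vert T e c) | c <- enum 'I_d.+1 & (c != a) && (c != b)].

Definition edge_condition (R : realType) (d : nat) (T : simplicial_mesh R d) :
    Prop :=
  forall v v' : sm_node T, interior_edge v v' ->
    0 <= \sum_(e : sm_cell T)
           \sum_(a : 'I_d.+1 | sm_vert T e a == v)
           \sum_(b : 'I_d.+1 | sm_vert T e b == v')
             1 / (d * d.-1)%N%:R * simplex_volume (opposite e a b)
             * cot (dihedral_angle (opposite e a b) (sm_pos T v) (sm_pos T v')).

Inductive monotone_scheme (R : realType) (d : nat) : fe_space R d -> Prop :=
| Q1_scheme (G : rect_mesh R d) : monotone_scheme (q1_space G)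
| P1_scheme (T : simplicial_mesh R d) :
    ((2 <= d)%N -> edge_condition T) -> monotone_scheme (p1_space T).

(** * The discrete Gross-Pitaevskii problem *)

Record gp_problem (R : realType) (N : nat) := GPProblem {
  weight : 'rV[R]_N;
  stiffness : 'M[R]_N;
  potential : 'rV[R]_N;
  interaction : R
}.

Definition fe_problem (R : realType) (d N : nat) (F : fe_space R d)
    (x : 'I_N -> node F) (V : 'rV[R]_d -> R) (beta : R) : gp_problem R N :=
  GPProblem (\row_i node_weight (x i))
            (\matrix_(i, j) node_stiffness (x i) (x j))
            (\row_i V (pos F (x i)))
            beta.

Definition irreducible_mx (R : realType) (N : nat) (A : 'M[R]_N) : Prop :=
  forall i j, connect (fun i' j' => A i' j' != 0) i j.

Definition epow (R : realType) (N : nat) (v : 'cV[R]_N) (n : nat) : 'cV[R]_N :=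
  map_mx (fun t => t ^+ n) v.

Definition sup_norm (R : realType) (N : nat) (v : 'cV[R]_N) : R :=
  vmax (fun i => `|v i 0|).

Section Problem.
Context (R : realType) (N : nat) (p : gp_problem R N).
Implicit Types u v : 'cV[R]_N.

Definition massM : 'M[R]_N := diag_mx (weight p).
Definition potM : 'M[R]_N := diag_mx (potential p).
Definition lapM : 'M[R]_N := - (invmx massM *m stiffness p).

Definition inner u v : R := (u^T *m massM *m v) 0 0.

Definition lpnorm (q : R) v : R :=
  (\sum_i weight p 0 i * `|v i 0| `^ q) `^ q^-1.

Definition sphere v : Prop := lpnorm 2 v = 1.

Definition norm1h v : R :=
  Num.sqrt (inner v (- lapM *m v) + lpnorm 2 v ^+ 2).

Definition energy u : R :=
  2^-1 * inner (- lapM *m u) u + 2^-1 * inner (potM *m u) u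
  + interaction p / 4 * lpnorm 4 u ^+ 4.

Definition gradE u : 'cV[R]_N :=
  - lapM *m u + potM *m u + interaction p *: epow u 3.

Definition lambda u : R := inner (gradE u) u.

Definition is_ground_state u : Prop :=
  [/\ sphere u, forall v, sphere v -> energy u <= energy v
    & forall i, 0 < u i 0].

Definition hessian u : 'M[R]_N :=
  - lapM + potM + (3 * interaction p) *: diag_mx (epow u 2)^T
  - (lambda u)%:M.

Definition hessian_values u : set R :=
  [set t | exists w, [/\ sphere w, inner u w = 0 & t = inner w (hessian u *m w)]].

Definition sobolev_constant (CS : R) : Prop :=
  forall v, lpnorm 6 v <= CS * norm1h v.

Definition w_min : R := vmin (fun i => weight p 0 i).
Definition Lambda_d : R := vmax (fun i => stiffness p i i / weight p 0 i).
Definition V_sup : R := sup_norm (potential p)^T.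

Section Constants.
Context (CS : R) (u0 : 'cV[R]_N).
Let beta := interaction p.

Definition E0 : R :=
  energy u0 + lambda u0 ^+ 2 / Num.max 1 (128 * energy u0).
Definition P0 : R := CS ^+ 2 * (2 * E0 + 1).
Definition U0 : R :=
  Num.min (1 / w_min)
    (Num.min (P0 / w_min `^ (1 / 3)) (2 * Num.sqrt (E0 / (beta * w_min)))).
Definition B0 : R := V_sup + beta * Num.min (P0 `^ (3 / 2)) U0.
Definition D0 : R := E0 + B0.
Definition B1 : R := V_sup + beta * U0.
Definition C0 : R := 3 * beta * CS * P0.
Definition L0 : R :=
  V_sup + Num.min (3 * beta * U0) (C0 + 2 * Num.max (C0 - 1 / 4) 0 ^+ 2).
Definition gamma_max : R :=
  Num.min 1
    (Num.min (1 / (128 * D0))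
      (Num.min (1 / (8 * L0))
        (2 / (B1 + Num.sqrt (B1 ^+ 2 + 12 * D0 * Lambda_d))))).

End Constants.

Definition residual (gamma : R) z u : R := lpnorm 2 z - 1 + gamma * lambda u.

Definition merit (gamma : R) z u : R :=
  energy u + residual gamma z u ^+ 2 / gamma.

End Problem.

(* Main.v *)
Require Import Defs.
From mathcomp Require Import all_boot all_order all_algebra perm.
From mathcomp Require Import all_classical all_reals all_analysis.
From mathcomp Require Import ring lra.

Set Implicit Arguments.
Unset Strict Implicit.
Unset Printing Implicit Defensive.

Import Order.TTheory GRing.Theory Num.Theory.
Import numFieldNormedType.Exports.

Local Open Scope classical_set_scope.
Local Open Scope ring_scope.


(** Write A = -Delta_h, r = ||z||, y = x - u. As z = r u, one step solves y + gamma A y = (1 - r) u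
    - gamma grad E(u) = -(R u + gamma P), where P = grad E(u) - lambda(u) u is the gradient on the
    sphere and R the residual. Since u and P are orthogonal, a small step means a small residual and
    a small gradient.

    Both schemes enter only through [admissible]: positive lumped mass, symmetric positive
    semidefinite irreducible stiffness with nonpositive off-diagonal entries
    ([monotone_scheme_admissible]). For Q1 the sign follows from the tensor structure; for P1 in
    dimensions 2 and 3 from the cotangent formulas, which turn a stiffness entry into minus the sum
    in the edge condition.

    Descent ([merit_descent]): for gamma <= gamma_max the merit function drops by at least (R^2/2 +
    (||y||^2 + gamma <A y, y>)/4) / gamma. The estimate is reduced to inequalities between a few
    scalars. The energy remainder is controlled as long as the energy stays below 2 E0, which a
    continuity argument along a path on the sphere guarantees ([endpoint_level]). The discrete
    maximum principle [weak_ge0] keeps the iterates nonnegative and the norms of z at most 1.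

    Global convergence: the merit is nonincreasing and bounded below, so P tends to 0. A nonnegative
    critical point is positive by irreducibility and equals the ground state by Picone's inequality
    and the exact identity [energy_gap]; compactness of the sphere then gives convergence of u^k
    ([iterate_close]).

    Rate: the Hessian form is a nonnegative form ([linearized_ge0]) plus 2 beta sum_i w_i u_i^2
    v_i^2 for a direction v, hence nu >= 2 beta m^2. Near the ground state, [local_rate] gives
    quadratic growth and gradient domination nu (E - E_GS) <= ||P||^2. With R^2 + gamma^2 ||P||^2 =
    ||y + gamma A y||^2 <= (1 + gamma mu)(||y||^2 + gamma <A y, y>), the guaranteed drop is at least
    eta times the merit gap. *)

(** * Bilinear forms given by matrices *)

Section BilinearForm.
Context (R : realFieldType) (N : nat).
Implicit Types (B : 'M[R]_N) (u v w : 'cV[R]_N).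

Definition form B u v : R := (u^T *m B *m v) 0 0.

Lemma formE B u v : form B u v = \sum_i \sum_j u i 0 * B i j * v j 0.
Proof.
rewrite /form mxE exchange_big /=; apply: eq_bigr => j _.
by rewrite mxE big_distrl /=; apply: eq_bigr => i _; rewrite mxE.
Qed.

Lemma formDl B u v w : form B (u + v) w = form B u w + form B v w.
Proof. by rewrite /form linearD /= !mulmxDl mxE. Qed.

Lemma form0l B u : form B 0 u = 0.
Proof. by rewrite /form trmx0 !mul0mx mxE. Qed.

Lemma formDr B u v w : form B u (v + w) = form B u v + form B u w.
Proof. by rewrite /form mulmxDr mxE. Qed.

Lemma formZl B c u v : form B (c *: u) v = c * form B u v.
Proof. by rewrite /form linearZ /= -!scalemxAl mxE. Qed.

Lemma formZr B c u v : form B u (c *: v) = c * form B u v.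
Proof. by rewrite /form -!scalemxAr mxE. Qed.

Lemma formNl B u v : form B (- u) v = - form B u v.
Proof. by rewrite -scaleN1r formZl mulN1r. Qed.

Lemma formNr B u v : form B u (- v) = - form B u v.
Proof. by rewrite -scaleN1r formZr mulN1r. Qed.

Definition formL := (formDl, formDr, formZl, formZr, formNl, formNr).

Lemma formC B u v : B^T = B -> form B u v = form B v u.
Proof.
move=> symB; rewrite !formE exchange_big /=.
apply: eq_bigr => i _; apply: eq_bigr => j _.
by rewrite -{1}symB mxE; ring.
Qed.

(* The discriminant of t |-> form (u + t v) (u + t v) is nonpositive. *)
Lemma form_CauchySchwarz B u v : B^T = B -> (forall w, 0 <= form B w w) ->
  form B u v ^+ 2 <= form B u u * form B v v.
Proof.
move=> symB psdB; have vu : form B v u = form B u v by exact: formC.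
have key c t : 0 <= c ^+ 2 * form B u u + 2 * (c * t) * form B u v
    + t ^+ 2 * form B v v.
  have := psdB (c *: u + t *: v); rewrite !formL vu; lra.
have uu := psdB u; have vv := psdB v.
have [vv0|vv_neq0] := eqVneq (form B v v) 0.
  (* With [form B v v = 0] this choice leaves [- 4 b ^+ 2 >= 0] for b = [form B u v], hence b =
     0. *)
  have := key (2 * form B u v) (- (form B u u + 1)); rewrite vv0.
  move: (form B u v) (form B u u) => b a; lra.
have vv_gt0 : 0 < form B v v by rewrite lt_def vv_neq0.
rewrite -(ler_pM2l vv_gt0); have := key (form B v v) (- form B u v); lra.
Qed.

End BilinearForm.

(** All that the analysis of the iteration takes from the discretization. The sign of the
    off-diagonal entries is the monotonicity of the scheme. *)
Record admissible (R : realType) (N : nat) (p : gp_problem R N) : Prop :=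
  Admissible {
    weight_gt0 : forall i, 0 < weight p 0 i;
    stiffness_sym : (stiffness p)^T = stiffness p;
    stiffness_psd : forall v, 0 <= form (stiffness p) v v;
    stiffness_off : forall i j, i != j -> stiffness p i j <= 0;
    potential_ge0 : forall i, 0 <= potential p 0 i;
    interaction_gt0 : 0 < interaction p;
    stiffness_irr : irreducible_mx (stiffness p)
  }.

(** * Quadrature sums, energy, gradient and the multiplier lambda *)

Section WeightedSum.
Context (R : realType) (N : nat) (p : gp_problem R N).

Definition wsum (f : 'I_N -> R) : R := \sum_i weight p 0 i * f i.

Lemma eq_wsum f g : f =1 g -> wsum f = wsum g.
Proof. by move=> fg; apply: eq_bigr => i _; rewrite fg. Qed.

Lemma wsumD f g : wsum (fun i => f i + g i) = wsum f + wsum g.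
Proof. by rewrite -big_split; apply: eq_bigr => i _; rewrite mulrDr. Qed.

Lemma wsumZ c f : wsum (fun i => c * f i) = c * wsum f.
Proof. by rewrite /wsum mulr_sumr; apply: eq_bigr => i _; rewrite mulrCA. Qed.

Lemma wsumN f : wsum (fun i => - f i) = - wsum f.
Proof. by rewrite -mulN1r -wsumZ; apply: eq_wsum => i; rewrite mulN1r. Qed.

Context (hp : admissible p).

Lemma le_wsum f g : (forall i, f i <= g i) -> wsum f <= wsum g.
Proof.
by move=> fg; apply: ler_sum => i _; rewrite ler_pM2l ?(weight_gt0 hp).
Qed.

Lemma wsum_ge0 f : (forall i, 0 <= f i) -> 0 <= wsum f.
Proof.
by move=> f0; apply: sumr_ge0 => i _; rewrite mulr_ge0 ?(ltW (weight_gt0 hp i)).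
Qed.

Lemma wsum_term f i : (forall j, 0 <= f j) -> weight p 0 i * f i <= wsum f.
Proof.
move=> f0; rewrite /wsum (bigD1 i) //= lerDl; apply: sumr_ge0 => j _.
by rewrite mulr_ge0 ?(ltW (weight_gt0 hp j)).
Qed.

Lemma wsum_eq0 f : (forall i, 0 <= f i) -> wsum f = 0 -> forall i, f i = 0.
Proof.
move=> f0 sf0 i; apply/le_anti; rewrite f0 andbT.
by have := @wsum_term f i f0; rewrite sf0 pmulr_rle0 ?(weight_gt0 hp).
Qed.

End WeightedSum.

Section Energy.
Context (R : realType) (N : nat) (p : gp_problem R N) (hp : admissible p).
Implicit Types (u v w : 'cV[R]_N).

Local Notation W := (wsum p).
Local Notation S := (stiffness p).
Local Notation A := (- lapM p).
Local Notation beta := (interaction p).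
Local Notation Vi i := (potential p 0 i).

Lemma inner_form u v : inner p u v = form (massM p) u v.
Proof. by []. Qed.

Lemma massM_sym : (massM p)^T = massM p.
Proof. exact: tr_diag_mx. Qed.

Lemma innerE u v : inner p u v = W (fun i => u i 0 * v i 0).
Proof.
rewrite inner_form formE; apply: eq_bigr => i _.
rewrite (bigD1 i) //= big1 => [|j ji]; rewrite !mxE.
  by rewrite eqxx mulr1n; ring.
by rewrite eq_sym (negbTE ji) mulr0n mulr0 mul0r.
Qed.

Lemma innerC u v : inner p u v = inner p v u.
Proof. by rewrite !inner_form (formC _ _ massM_sym). Qed.

Lemma inner_sub_sqr u v :
  inner p (v - u) (v - u) = inner p v v - 2 * inner p u v + inner p u u.
Proof.
by rewrite inner_form !formL -!inner_form (innerC v u); ring.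
Qed.

Lemma inner_ge0 v : 0 <= inner p v v.
Proof. by rewrite innerE; apply: wsum_ge0 => // i; rewrite -expr2 sqr_ge0. Qed.

Lemma inner_eq0 v : inner p v v = 0 -> v = 0.
Proof.
rewrite innerE => /(wsum_eq0 hp) v0; apply/colP => i; rewrite mxE.
by apply/eqP; rewrite -sqrf_eq0 expr2 v0// => j; rewrite -expr2 sqr_ge0.
Qed.

Lemma inner_gt0 v : v != 0 -> 0 < inner p v v.
Proof.
by move=> v0; rewrite lt_def inner_ge0 andbT; apply: contra_neq v0 => /inner_eq0.
Qed.

Lemma inner_CauchySchwarz u v : inner p u v ^+ 2 <= inner p u u * inner p v v.
Proof.
by rewrite !inner_form; apply: form_CauchySchwarz massM_sym _ => w; exact: inner_ge0.
Qed.

Lemma inner_inj u v : (forall w, inner p w u = inner p w v) -> u = v.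
Proof.
move=> uv; apply/subr0_eq/inner_eq0.
by rewrite inner_form formDr formNr -!inner_form uv subrr.
Qed.

Lemma massM_unit : massM p \in unitmx.
Proof.
rewrite unitmxE det_diag unitfE; apply/prodf_neq0 => i _.
by rewrite gt_eqF ?(weight_gt0 hp).
Qed.

Lemma massM_lap v : massM p *m (A *m v) = S *m v.
Proof. by rewrite /lapM opprK !mulmxA mulmxV ?mul1mx ?massM_unit. Qed.

Lemma inner_lap u v : inner p u (A *m v) = form S u v.
Proof. by rewrite /inner /form -mulmxA massM_lap mulmxA. Qed.

Lemma inner_lapl u v : inner p (A *m u) v = form S u v.
Proof. by rewrite innerC inner_lap (formC _ _ (stiffness_sym hp)). Qed.

Lemma stiffC u v : form S u v = form S v u.
Proof. exact: formC (stiffness_sym hp). Qed.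

Lemma stiff_CauchySchwarz u v : form S u v ^+ 2 <= form S u u * form S v v.
Proof. exact: form_CauchySchwarz (stiffness_sym hp) (stiffness_psd hp). Qed.

Lemma potM_entry u i : (potM p *m u) i 0 = Vi i * u i 0.
Proof. by rewrite mul_diag_mx mxE. Qed.

Lemma epow_entry u n i : epow u n i 0 = u i 0 ^+ n.
Proof. by rewrite mxE. Qed.

Lemma lpnorm_nat n v : (0 < n)%N ->
  lpnorm p n%:R v ^+ n = W (fun i => `|v i 0| ^+ n).
Proof.
move=> n0; rewrite /lpnorm -powR_mulrn ?powR_ge0// -powRrM mulVf ?pnatr_eq0 -?lt0n//.
rewrite powRr1; first by apply: eq_bigr => i _; rewrite powR_mulrn.
by apply: sumr_ge0 => i _; rewrite mulr_ge0 ?powR_ge0// ltW// (weight_gt0 hp).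
Qed.

Lemma lpnorm_ge0 q v : 0 <= lpnorm p q v.
Proof. exact: powR_ge0. Qed.

Lemma l2_sqr v : lpnorm p 2 v ^+ 2 = inner p v v.
Proof.
rewrite (@lpnorm_nat 2) // innerE; apply: eq_wsum => i.
by rewrite real_normK ?num_real// expr2.
Qed.

Lemma l2_sqrt v : lpnorm p 2 v = Num.sqrt (inner p v v).
Proof. by rewrite -l2_sqr sqrtr_sqr ger0_norm ?lpnorm_ge0. Qed.

Lemma sphereE v : sphere p v <-> inner p v v = 1.
Proof.
rewrite /sphere -l2_sqr; split=> [->|/eqP]; first by rewrite expr1n.
by rewrite sqrp_eq1 ?lpnorm_ge0// => /eqP.
Qed.

Lemma l4_pow v : lpnorm p 4 v ^+ 4 = W (fun i => v i 0 ^+ 4).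
Proof.
rewrite (@lpnorm_nat 4)//; apply: eq_wsum => i.
by rewrite -normrX ger0_norm// (exprM _ 2 2) sqr_ge0.
Qed.

Lemma l6_pow v : lpnorm p 6 v ^+ 6 = W (fun i => v i 0 ^+ 6).
Proof.
rewrite (@lpnorm_nat 6)//; apply: eq_wsum => i.
by rewrite -normrX ger0_norm// (exprM _ 3 2) sqr_ge0.
Qed.

Lemma norm1h_sqr v : norm1h p v ^+ 2 = form S v v + inner p v v.
Proof.
by rewrite /norm1h sqr_sqrtr l2_sqr inner_lap// addr_ge0 ?inner_ge0 ?stiffness_psd.
Qed.

Lemma energyE u : energy p u = 2^-1 * form S u u
  + W (fun i => 2^-1 * (Vi i * u i 0 ^+ 2) + beta / 4 * u i 0 ^+ 4).
Proof.
rewrite /energy inner_lapl l4_pow -addrA; congr (_ + _).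
rewrite wsumD !wsumZ innerE; congr (2^-1 * _ + _).
by apply: eq_wsum => i; rewrite potM_entry expr2 mulrA.
Qed.

Lemma inner_gradE u v : inner p (gradE p u) v = form S u v
  + W (fun i => (Vi i * u i 0 + beta * u i 0 ^+ 3) * v i 0).
Proof.
rewrite /gradE inner_form !formDl -!inner_form inner_lapl -addrA; congr (_ + _).
rewrite !innerE -wsumD; apply: eq_wsum => i.
by rewrite potM_entry !mxE; ring.
Qed.

Lemma lambdaE u : lambda p u = form S u u
  + W (fun i => Vi i * u i 0 ^+ 2 + beta * u i 0 ^+ 4).
Proof.
by rewrite /lambda inner_gradE; congr (_ + _); apply: eq_wsum => i; ring.
Qed.

(** Exact Taylor expansion. The quartic remainder 6 u^2 + 4 u w + w^2 is written in terms of [u] and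
    [u + w], because bounds will be available for both of these points through their energies. *)
Lemma energyD u w : energy p (u + w) = energy p u + inner p (gradE p u) w
  + 2^-1 * form S w w
  + W (fun i => 2^-1 * (Vi i * w i 0 ^+ 2) + beta / 4 * (w i 0 ^+ 2
      * (3 * u i 0 ^+ 2 + 2 * (u i 0 * (u i 0 + w i 0)) + (u i 0 + w i 0) ^+ 2))).
Proof.
rewrite !energyE inner_gradE !formL (stiffC w u).
set a := W _; set b := W _; set c := W _; set d := W _.
suff -> : a = b + c + d by field.
rewrite /a /b /c /d -!wsumD; by apply: eq_wsum => i; rewrite mxE; field.
Qed.

End Energy.

(** * Scalar inequalities behind one step *)

Section StepEstimates.
Context (R : realFieldType).
Implicit Types (r t s h k a b c res tau sg rho xi nl : R).

Lemma ler_of_sqr (x y : R) : 0 <= y -> x ^+ 2 <= y ^+ 2 -> x <= y.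
Proof.
by move=> y0 xy; apply: le_trans (ler_norm x) _; rewrite -(ger0_norm y0) -ler_sqr
  ?nnegrE ?normr_ge0// !real_normK ?num_real.
Qed.

Lemma ler_sqr_norm (x y : R) : `|x| <= y -> x ^+ 2 <= y ^+ 2.
Proof.
by rewrite ler_norml => /andP[xy1 xy2]; rewrite -subr_ge0 subr_sqr mulr_ge0; lra.
Qed.

Lemma norm_ler_of_sqr (x y : R) : 0 <= y -> x ^+ 2 <= y ^+ 2 -> `|x| <= y.
Proof.
by move=> y0 xy; apply: ler_of_sqr => //; rewrite real_normK ?num_real.
Qed.

Lemma min_between (x y z t : R) : x <= z -> z < y -> z < t ->
  Num.min x y <= Num.min y t <= Num.max x y.
Proof.
move=> xz zy zt; rewrite ge_min le_min (ltW (le_lt_trans xz zy)).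
by rewrite (ltW (le_lt_trans xz zt)) /= ge_min le_max lexx orbT.
Qed.

Lemma ler_add_drop (v u d x y n : R) : v - u <= d ->
  d + x <= 1 / 2 * y - 1 / 4 * n -> v + x <= u + 1 / 2 * y - 1 / 4 * n.
Proof. lra. Qed.

Lemma half_quarter_ge0 (x y : R) : 0 <= x -> 0 <= y -> 0 <= 1 / 2 * x + 1 / 4 * y.
Proof. lra. Qed.

Lemma ltr_sub_dist (l x y e : R) : `|l - x| < e / 2 -> `|l - y| < e / 2 -> x - y < e.
Proof. rewrite !ltr_norml => /andP[? ?] /andP[? ?]; lra. Qed.

Lemma grad_decrease (q M st r2 P m m' : R) : 0 < q -> 0 <= M -> 0 <= r2 ->
  r2 + q ^+ 2 * P <= M * st -> m' <= m - (1 / 2 * r2 + 1 / 4 * st) / q ->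
  q ^+ 2 * P <= (m - m') * (M * (4 * q)).
Proof.
move=> q0 M0 r0 h1 h2.
have h3 : (1 / 2 * r2 + 1 / 4 * st) <= (m - m') * q.
  by rewrite -ler_pdivrMr//; lra.
have h4 : M * st <= M * (4 * ((m - m') * q)) by apply: ler_wpM2l => //; lra.
lra.
Qed.

Lemma rate_total (E r w cK : R) : w <= E -> 0 <= r -> E + r <= cK ->
  E + r + w <= 2 * cK.
Proof. lra. Qed.

Lemma subr_half_ge0 (x : R) : x <= 1 / 2 -> 0 <= 1 - x.
Proof. lra. Qed.

Lemma ler_sub_shift (m' E r q c : R) : m' <= E + r - q -> m' - c <= E - c + r - q.
Proof. lra. Qed.

(** The cubic part is x^3 - x^2 y - x y^2 + y^3 = (x - y)^2 (x + y) >= 0. *)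
Lemma cubic_sum_le (V b x y : R) : 0 <= V -> 0 <= b -> 0 <= x -> 0 <= y ->
  V * (x + y) + b * (x ^+ 3 + x ^+ 2 * y + x * y ^+ 2 + y ^+ 3)
  <= 2 * ((V * x + b * x ^+ 3) + (V * y + b * y ^+ 3)).
Proof.
move=> V0 b0 x0 y0.
have xy : 0 <= (x - y) ^+ 2 * (x + y) by rewrite mulr_ge0 ?sqr_ge0 ?addr_ge0.
have := mulr_ge0 b0 xy; have := mulr_ge0 V0 (addr_ge0 x0 y0); lra.
Qed.

(** Geometry of v = (r u + t y) / rho on the unit sphere, with s and h the radial and tangential
    parts of y: [sg] is <u, v> - 1, so [- 2 * sg] is ||v - u||^2. With q = r + t s, the last bound
    amounts to rho <= 13/12 q. *)
Lemma path_geometry r t s h rho : 40 / 41 <= r <= 1 -> 0 <= t <= 1 ->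
  `|s| <= 1 / 25 -> s ^+ 2 + h ^+ 2 <= 1 / 60 ->
  0 < rho -> rho ^+ 2 = (r + t * s) ^+ 2 + t ^+ 2 * h ^+ 2 ->
  let tau := t / rho in let sg := (r + t * s) / rho - 1 in
  [/\ 0 <= tau <= 15 / 14, sg <= 0 & - 2 * sg <= 26 / 25 * (tau ^+ 2 * h ^+ 2)].
Proof.
move=> /andP[r1 r2] /andP[t0 t1]; rewrite ler_norml => /andP[s1 s2] Q rho0 rhoE.
have ts : - (1 / 25) <= t * s.
  by clear - t0 t1 s1; have := ler_wpM2l t0 s1; lra.
have q0 : 14 / 15 <= r + t * s by clear - r1 ts; lra.
have q_rho : r + t * s <= rho.
  apply: ler_of_sqr; first exact: ltW.
  by rewrite rhoE lerDl; apply: mulr_ge0; apply: sqr_ge0.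
have rho1 : rho <= 13 / 12 * (r + t * s).
  apply: ler_of_sqr; first by clear - q0; lra.
  have th : t ^+ 2 * h ^+ 2 <= h ^+ 2 by rewrite ler_piMl ?sqr_ge0 ?expr_le1.
  have s0 := sqr_ge0 s; rewrite rhoE; clear - q0 th s0 Q; nra.
have rho_neq0 : rho != 0 by rewrite gt_eqF.
split.
- rewrite divr_ge0 ?(ltW rho0)//= ler_pdivrMr//; clear - t1 q0 q_rho; lra.
- by rewrite subr_le0 ler_pdivrMr// mul1r.
have -> : - 2 * ((r + t * s) / rho - 1)
    = 2 * rho * (rho - (r + t * s)) / rho ^+ 2 by field.
have -> : 26 / 25 * ((t / rho) ^+ 2 * h ^+ 2)
    = 26 / 25 * (t ^+ 2 * h ^+ 2) / rho ^+ 2 by field.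
rewrite ler_pM2r ?invr_gt0 ?exprn_gt0//.
have -> : t ^+ 2 * h ^+ 2 = (rho - (r + t * s)) * (rho + (r + t * s)).
  by rewrite -subr_sqr rhoE addrAC subrr add0r.
move: q_rho rho1; rewrite -subr_ge0; clear; move: (r + t * s) => q q1 q2.
have : 0 <= (rho - q) * (13 / 12 * q - rho) by apply: mulr_ge0; lra.
nra.
Qed.

(** The quantity [sg - tau * s] is the coefficient of u in v - u, whose coefficient on y is
    [tau]. *)
Lemma drift_bound s h tau sg : 0 <= tau <= 15 / 14 -> 0 <= h <= 13 / 100 ->
  sg <= 0 -> - 2 * sg <= 26 / 25 * (tau ^+ 2 * h ^+ 2) ->
  `|sg - tau * s| <= tau * (`|s| + h / 13).
Proof.
move=> /andP[tau0 tau1] /andP[h0 h1] sg0 sg1.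
have sg2 : - sg <= tau * (h / 13).
  have th0 : 0 <= tau * h by exact: mulr_ge0.
  have th : tau * h <= 15 / 14 * (13 / 100) by exact: ler_pM.
  clear - sg1 th0 th; nra.
have st : tau * `|s| = `|tau * s| by rewrite normrM ger0_norm.
have := ler_normB sg (tau * s); rewrite (ler0_norm sg0); clear - sg2 st; lra.
Qed.

(** The left side is gamma <A w, w> for the increment w = tau y + c u. *)
Lemma increment_bound a k b s h tau c : 0 <= a <= 1 / 8 -> 0 <= k ->
  `|b| <= a * k -> 0 <= h -> 0 <= tau -> `|c| <= tau * (`|s| + h / 13) ->
  tau ^+ 2 * k ^+ 2 + 2 * (tau * c) * b + c ^+ 2 * a ^+ 2
  <= tau ^+ 2 * (9 / 8 * k ^+ 2 + 1 / 7 * (s ^+ 2 + h ^+ 2)).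
Proof.
move=> /andP[a0 a1] k0 bk h0 tau0 cb.
have a2 : a ^+ 2 <= 1 / 64 by clear - a0 a1; nra.
have c2 : c ^+ 2 <= tau ^+ 2 * (170 / 169 * (s ^+ 2 + h ^+ 2)).
  apply: le_trans (ler_sqr_norm cb) _.
  rewrite exprMn; apply: ler_wpM2l; first exact: sqr_ge0.
  rewrite -(real_normK (num_real s)); have := sqr_ge0 (`|s| / 13 - h).
  have := sqr_ge0 `|s|; have := sqr_ge0 h; clear; lra.
have cbb : 2 * (tau * c) * b <= 8^-1 * (tau ^+ 2 * k ^+ 2) + 8 * (c ^+ 2 * a ^+ 2).
  have tcb : tau * c * b <= tau * k * (`|c| * a).
    apply: le_trans (ler_norm _) _; rewrite !normrM (ger0_norm tau0).
    have := ler_wpM2l (mulr_ge0 tau0 (normr_ge0 c)) bk; clear; lra.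
  have := sqr_ge0 (tau * k - 8 * (`|c| * a)).
  rewrite -[c ^+ 2](real_normK (num_real c)); clear - tcb; lra.
have ca : c ^+ 2 * a ^+ 2 <= tau ^+ 2 * (170 / 169 * (s ^+ 2 + h ^+ 2)) * (1 / 64).
  by apply: ler_pM => //; apply: sqr_ge0.
have n0 : 0 <= tau ^+ 2 * (s ^+ 2 + h ^+ 2).
  by rewrite mulr_ge0 ?addr_ge0 ?sqr_ge0.
clear - n0 ca cbb; lra.
Qed.

(* Upper bound for gamma times the change of energy along the path. *)
Definition energy_drop res s h k tau : R :=
  tau * (- (s ^+ 2 + h ^+ 2 + k ^+ 2) - res * s)
  + tau ^+ 2 * (21 / 32 * k ^+ 2 + 1 / 12 * (s ^+ 2 + h ^+ 2) + 13 / 150 * h ^+ 2).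

(** No decrease is claimed along the whole path; this bound suffices there, because res^2 <= gamma
    (E0 - E(u)) then keeps the energy below E0. *)
Lemma energy_drop_path res s h k tau : 0 <= tau <= 15 / 14 ->
  energy_drop res s h k tau <= res ^+ 2.
Proof.
move=> /andP[tau0 tau1]; rewrite /energy_drop.
have tt : tau ^+ 2 <= 15 / 14 * tau by rewrite expr2; exact: ler_wpM2r.
have := ler_wpM2r (sqr_ge0 s) tt; have := ler_wpM2r (sqr_ge0 h) tt.
have := ler_wpM2r (sqr_ge0 k) tt.
have := mulr_ge0 tau0 (sqr_ge0 s); have := mulr_ge0 tau0 (sqr_ge0 h).
have := mulr_ge0 tau0 (sqr_ge0 k).
have := mulr_ge0 tau0 (sqr_ge0 (res + 9 / 5 * s)).
have := ler_wpM2r (sqr_ge0 res) tau1; have := sqr_ge0 res.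
clear; lra.
Qed.

(** At the endpoint tau is close to 1. The cross term in [res * s] costs half of [res ^+ 2] and part
    of [s ^+ 2]; what remains of the negative terms absorbs the new residual. *)
Lemma energy_drop_step res res' s h k tau : 1 <= tau <= 41 / 40 ->
  0 <= h -> 0 <= k -> `|res'| <= 4 / 25 * k + `|s| / 30 + h / 9 ->
  energy_drop res s h k tau + res' ^+ 2
  <= 1 / 2 * res ^+ 2 - 1 / 4 * (s ^+ 2 + h ^+ 2 + k ^+ 2).
Proof.
move=> /andP[tau1 tau2] h0 k0 res1; rewrite /energy_drop.
have r2 : res' ^+ 2 <= 4 / 100 * k ^+ 2 + s ^+ 2 / 100 + 8 / 100 * h ^+ 2.
  apply: le_trans (ler_sqr_norm res1) _; rewrite -(real_normK (num_real s)).
  have := sqr_ge0 (4 / 25 * k - 2 * (`|s| / 30 + h / 9)).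
  have := sqr_ge0 (`|s| / 30 - h / 9).
  have := sqr_ge0 k; have := sqr_ge0 h; have := sqr_ge0 `|s|; clear; lra.
have tt : tau ^+ 2 <= 20 / 19 by clear - tau1 tau2; nra.
have rs : - (tau * (res * s)) <= 1 / 2 * res ^+ 2 + 10 / 19 * s ^+ 2.
  have := sqr_ge0 (res + tau * s); have := ler_wpM2r (sqr_ge0 s) tt; clear; lra.
have := ler_wpM2r (sqr_ge0 s) tt; have := ler_wpM2r (sqr_ge0 h) tt.
have := ler_wpM2r (sqr_ge0 k) tt.
have := ler_wpM2r (sqr_ge0 s) tau1; have := ler_wpM2r (sqr_ge0 h) tau1.
have := ler_wpM2r (sqr_ge0 k) tau1; have := sqr_ge0 s; have := sqr_ge0 h.
have := sqr_ge0 k; clear - r2 rs; lra.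
Qed.

(* The linear part b + k^2 = gamma <A x, y> of the new residual is a product
   with the small quantity xi = sqrt (gamma <A x, x>). *)
Lemma residual_bound a k b s h tau c sg rho xi nl :
  0 <= a <= 1 / 8 -> 0 <= k <= 13 / 100 -> `|b| <= a * k -> 0 <= h <= 13 / 100 ->
  `|s| <= 1 / 25 -> 1 <= tau <= 41 / 40 -> 0 < rho <= 1 -> sg <= 0 ->
  - 2 * sg <= 26 / 25 * (tau ^+ 2 * h ^+ 2) -> `|c| <= tau * (`|s| + h / 13) ->
  0 <= xi <= 13 / 100 -> `|b + k ^+ 2| <= xi * k ->
  `|nl| <= 1 / 32 * (51 / 50 * (tau * h)) ->
  `|- (sg * rho) - b + 2 * (tau * b + c * a ^+ 2)
    + (tau ^+ 2 * k ^+ 2 + 2 * (tau * c) * b + c ^+ 2 * a ^+ 2) + nl|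
  <= 4 / 25 * k + `|s| / 30 + h / 9.
Proof.
move=> /andP[a0 a1] /andP[k0 k1] bk /andP[h0 h1] s1 /andP[t1 t2] /andP[rho0 rho1].
move=> sg0 sg1 cb /andP[xi0 xi1] bk2 nlb.
have a2 : a ^+ 2 <= 1 / 64 by clear - a0 a1; nra.
have as0 := normr_ge0 s.
have tt : tau ^+ 2 <= 20 / 19 by clear - t1 t2; nra.
have c1 : `|c| <= 41 / 40 * (`|s| + h / 13).
  have sh : 0 <= `|s| + h / 13 by clear - as0 h0; lra.
  have := ler_wpM2r sh t2; clear - cb; lra.
have c3 : `|c| <= 1 / 19 by clear - c1 s1 h1; lra.
(* Regrouping around tau = 1: adding and subtracting k^2 isolates b + k^2, and every other term
   carries a small factor. *)
have -> : - (sg * rho) - b + 2 * (tau * b + c * a ^+ 2)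
    + (tau ^+ 2 * k ^+ 2 + 2 * (tau * c) * b + c ^+ 2 * a ^+ 2) + nl
  = - (sg * rho) + (b + k ^+ 2) + (2 * tau - 2 + 2 * (tau * c)) * b
    + (tau ^+ 2 - 1) * k ^+ 2 + (2 + c) * c * a ^+ 2 + nl by ring.
have T1 : `|- (sg * rho)| <= h / 14.
  have sg2 : - sg <= h / 14.
    have hh : h ^+ 2 <= 13 / 100 * h by rewrite expr2; exact: ler_wpM2r.
    have := ler_wpM2r (sqr_ge0 h) tt; clear - sg1 hh h0; lra.
  rewrite normrN normrM (ler0_norm sg0) (gtr0_norm rho0).
  by apply: le_trans sg2; rewrite ler_piMr// oppr_ge0.
have T2 : `|b + k ^+ 2| <= 13 / 100 * k.
  have := ler_wpM2r k0 xi1; clear - bk2; lra.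
have T3 : `|(2 * tau - 2 + 2 * (tau * c)) * b| <= k / 50.
  have bk' : `|b| <= 1 / 8 * k by have := ler_wpM2r k0 a1; clear - bk; lra.
  have e : `|2 * tau - 2 + 2 * (tau * c)| <= 4 / 25.
    have tc : `|tau * c| <= 41 / 40 * (1 / 19).
      rewrite normrM ger0_norm; last by clear - t1; lra.
      by apply: ler_pM => //; clear - t1; lra.
    apply: le_trans (ler_normD _ _) _; rewrite [`|2 * (tau * c)|]normrM.
    rewrite [`|2|]gtr0_norm; last by clear; lra.
    rewrite [`|2 * tau - 2|]ger0_norm; clear - tc t1 t2; lra.
  rewrite normrM; have := ler_pM (normr_ge0 _) (normr_ge0 _) e bk'; clear; lra.
have T4 : `|(tau ^+ 2 - 1) * k ^+ 2| <= k / 140.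
  have t3 : tau ^+ 2 - 1 <= 1 / 19 by clear - tt; lra.
  have t4 : 0 <= tau ^+ 2 - 1 by clear - t1; nra.
  rewrite ger0_norm; last by apply: mulr_ge0 t4 (sqr_ge0 k).
  have kk2 : k ^+ 2 <= 13 / 100 * k by rewrite expr2; exact: ler_wpM2r.
  have := ler_pM t4 (sqr_ge0 k) t3 kk2; clear - k0; lra.
have T5 : `|(2 + c) * c * a ^+ 2| <= `|s| / 30 + h / 380.
  have c6 : `|2 + c| <= 39 / 19.
    apply: le_trans (ler_normD _ _) _.
    rewrite [`|2|]gtr0_norm; last by clear; lra.
    clear - c3; lra.
  rewrite normrM [X in X * _]normrM (ger0_norm (sqr_ge0 a)).
  have c61 := ler_pM (normr_ge0 _) (normr_ge0 _) c6 c1.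
  have := ler_pM (mulr_ge0 (normr_ge0 _) (normr_ge0 _)) (sqr_ge0 a) c61 a2.
  clear - as0 h0; lra.
have T6 : `|nl| <= h / 30.
  have := ler_wpM2r h0 t2; clear - nlb h0; lra.
move: T1 T2 T3 T4 T5 T6; rewrite !ler_norml.
move: (- (sg * rho)) (b + k ^+ 2) (_ * b) (_ * k ^+ 2) (_ * a ^+ 2) (`|s|) as0 k0 h0.
clear => x1 x2 x3 x4 x5 y y0 k0 h0.
move=> /andP[? ?] /andP[? ?] /andP[? ?] /andP[? ?] /andP[? ?] /andP[? ?].
apply/andP; split; lra.
Qed.

(* |x|_A is controlled by testing the resolvent equation with A x. *)
Lemma resolvent_seminorm a b xi c : 0 <= a -> 0 <= b -> 0 <= xi -> 0 <= c ->
  xi ^+ 2 <= c * a * xi + b ^+ 2 / 4 -> xi <= c * a + b / 2.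
Proof.
move=> a0 b0 xi0 c0 xi1; have [//|] := leP xi (c * a + b / 2).
have ca := mulr_ge0 c0 a0; move: xi1 ca; move: (c * a) => e; clear - b0 xi0; nra.
Qed.

(* In the next lemmas e = gamma E0, c = gamma B0, d = 1 - r and
   res = gamma lambda - d is the residual. *)
Lemma step_size_bound a k b s h d c g : 0 <= a <= 1 / 8 -> 0 <= k ->
  `|b| <= a * k -> 0 <= d <= 3 / 128 -> 0 <= c <= 1 / 128 ->
  g ^+ 2 <= c ^+ 2 * (s ^+ 2 + h ^+ 2) ->
  s ^+ 2 + h ^+ 2 + k ^+ 2 = d * s - b - g -> s ^+ 2 + h ^+ 2 + k ^+ 2 <= 1 / 60.
Proof.
move=> /andP[a0 a1] k0; rewrite ler_norml => /andP[b1 b2] /andP[d0 d1] /andP[c0 c1].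
move=> gc QE.
have g2 : - 2 * g <= 4 * c ^+ 2 + (s ^+ 2 + h ^+ 2) / 4.
  have := sqr_ge0 (4 * c ^+ 2 - (s ^+ 2 + h ^+ 2) / 4).
  have n0 := addr_ge0 (sqr_ge0 s) (sqr_ge0 h); have cc := sqr_ge0 c.
  move: gc n0 cc; clear; move: (s ^+ 2 + h ^+ 2) (c ^+ 2) => n c2 gc n0 c0 H.
  apply: ler_of_sqr; first lra.
  have : (- 2 * g) ^+ 2 <= 4 * (c2 * n) by lra.
  lra.
have ak := sqr_ge0 (a - k); have ds := sqr_ge0 (4 * d - 3 * s).
have aa : a ^+ 2 <= 1 / 64 by clear - a0 a1; nra.
have dd : d ^+ 2 <= 9 / 16384 by clear - d0 d1; nra.
have cc : c ^+ 2 <= 1 / 16384 by clear - c0 c1; nra.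
clear - b1 g2 QE ak ds aa dd cc.
have : 2 * (s ^+ 2 + h ^+ 2 + k ^+ 2) = 2 * (d * s) - 2 * b - 2 * g by rewrite QE; ring.
have := sqr_ge0 h; lra.
Qed.

Lemma radial_bound a k b s h res : 0 <= a <= 1 / 8 -> 0 <= k ->
  `|b| <= a * k -> s ^+ 2 + h ^+ 2 + k ^+ 2 <= 1 / 60 ->
  - (3 / 128) <= res <= 2 / 128 -> s = - res - b -> `|s| <= 1 / 25.
Proof.
move=> /andP[a0 a1] k0 bk Q /andP[r1 r2] sE.
have k1 : k <= 13 / 100.
  apply: ler_of_sqr; first by clear; lra.
  have := sqr_ge0 s; have := sqr_ge0 h; clear - Q; lra.
have ak : a * k <= 1 / 8 * (13 / 100) by exact: ler_pM.
move: bk; rewrite sE !ler_norml => /andP[b1 b2]; apply/andP; clear - ak b1 b2 r1 r2.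
by split; lra.
Qed.

(** The equation is the resolvent equation for x tested with gamma A x, where m = gamma^2 ||A x||^2.
    Absorbing m bounds xi, and the second conclusion is what propagates the lower bound on ||z||. *)
Lemma resolvent_bound a xi e c d g m f : 0 <= a -> 0 <= xi -> 0 <= e -> 0 <= c ->
  a ^+ 2 <= 2 * e -> e + c <= 1 / 128 -> 0 <= d <= 3 / 128 ->
  0 <= m -> g ^+ 2 <= c ^+ 2 * m -> `|f| <= a * xi ->
  xi ^+ 2 + m = (1 + d) * f - g ->
  xi <= 13 / 100 /\ a * xi + c <= 3 * (e + c).
Proof.
move=> a0 xi0 e0 c0 ae ec /andP[d0 d1] m0 gm; rewrite ler_norml => /andP[_ f1] xiE.
have g1 : - g <= m + c ^+ 2 / 4.
  apply: ler_of_sqr; first by have := sqr_ge0 c; move: m0; clear; lra.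
  rewrite sqrrN; apply: le_trans gm _; have := sqr_ge0 (m - c ^+ 2 / 4); clear; lra.
have xi2 : xi ^+ 2 <= (1 + d) * a * xi + c ^+ 2 / 4.
  have := ler_wpM2l (addr_ge0 ler01 d0) f1; move: g1 xiE; clear; lra.
have xi3 : xi <= (1 + d) * a + c / 2.
  by apply: resolvent_seminorm => //; exact: addr_ge0.
have a1 : a <= 1 / 8 - 8 * c.
  apply: ler_of_sqr; first by clear - ec e0; lra.
  have := sqr_ge0 c; clear - ae ec; lra.
have da : (1 + d) * a <= 131 / 128 * a by clear - a0 d1; nra.
split; first by clear - xi3 da a1 c0; lra.
have := ler_wpM2l a0 xi3.
have a2 : a * ((1 + d) * a) <= 131 / 128 * a ^+ 2 by clear - a0 da; nra.
have ac : a * c <= 1 / 8 * c by apply: ler_wpM2r => //; clear - a1 c0; lra.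
clear - a2 ac ae e0 c0; lra.
Qed.

End StepEstimates.

(** * Extrema of finite families *)

Section Extrema.
Context (R : realType) (N : nat) (f : 'I_N -> R).

Lemma vmin_le i : vmin f <= f i.
Proof. exact: bigmin_le_cond. Qed.

Lemma vmin_gt0 : (0 < N)%N -> (forall i, 0 < f i) -> 0 < vmin f.
Proof.
move=> N0 f0; apply/lt_bigmin => //.
have : head 0 (codom f) \in codom f.
  case E: (codom f) => [|a s]; last by rewrite mem_head.
  by have := size_codom f; rewrite E card_ord /= => N1; rewrite -N1 in N0.
by case/codomP => i ->.
Qed.

Lemma vmax_ge i : f i <= vmax f.
Proof. exact: le_bigmax_cond. Qed.

Lemma vmax_ge0 : 0 <= vmax f.
Proof. exact: bigmax_ge_id. Qed.

End Extrema.

(** * A priori bounds on energy sublevel sets, and the constants of gamma_max *)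

Section EnergyBounds.
Context (R : realType) (N : nat) (p : gp_problem R N) (hp : admissible p).
Implicit Types (u v w : 'cV[R]_N).

Local Notation W := (wsum p).
Local Notation S := (stiffness p).
Local Notation beta := (interaction p).
Local Notation Vi i := (potential p 0 i).

Lemma wsum_CauchySchwarz (f g : 'I_N -> R) :
  W (fun i => f i * g i) ^+ 2 <= W (fun i => f i ^+ 2) * W (fun i => g i ^+ 2).
Proof.
have := inner_CauchySchwarz hp (\col_i f i) (\col_i g i).
rewrite !innerE; set a := W _; set b := W _; set c := W _.
set a' := W _; set b' := W _; set c' := W _.
have -> : a = a' by apply: eq_wsum => i; rewrite !mxE.
have -> : b = b' by apply: eq_wsum => i; rewrite !mxE expr2.
by have -> : c = c' by apply: eq_wsum => i; rewrite !mxE expr2.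
Qed.

(* Hoelder with exponents 3/2 and 3, as a pointwise Young inequality
   3 x^2 y <= 2 x^3 + y^3 for x = v^2/a and y = w^2/b. *)
Lemma wsum_holder v w (a b : R) : 0 < a -> 0 < b ->
  W (fun i => v i 0 ^+ 6) <= a ^+ 3 -> W (fun i => w i 0 ^+ 6) <= b ^+ 3 ->
  W (fun i => v i 0 ^+ 4 * w i 0 ^+ 2) <= a ^+ 2 * b.
Proof.
move=> a0 b0 va wb.
have a_neq0 : a != 0 by rewrite gt_eqF.
have b_neq0 : b != 0 by rewrite gt_eqF.
have step : W (fun i => v i 0 ^+ 4 * w i 0 ^+ 2)
    <= W (fun i => 2 / 3 * (b / a) * v i 0 ^+ 6
                   + 3^-1 * (a ^+ 2 / b ^+ 2) * w i 0 ^+ 6).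
  apply: le_wsum => // i; set x := v i 0; set y := w i 0.
  have x0 : 0 <= x ^+ 2 / a by rewrite divr_ge0 ?sqr_ge0 ?ltW.
  have y0 : 0 <= y ^+ 2 / b by rewrite divr_ge0 ?sqr_ge0 ?ltW.
  have young (s t : R) : 0 <= s -> 0 <= t -> s ^+ 2 * t
      <= 2 / 3 * s ^+ 3 + 3^-1 * t ^+ 3.
    move=> s0 t0; have : 0 <= (s - t) ^+ 2 * (2 * s + t).
      by rewrite mulr_ge0 ?sqr_ge0 // addr_ge0 ?mulr_ge0.
    lra.
  have ab0 : 0 <= a ^+ 2 * b by rewrite mulr_ge0 ?sqr_ge0 ?ltW.
  have := ler_wpM2l ab0 (young _ _ x0 y0).
  have -> : a ^+ 2 * b * ((x ^+ 2 / a) ^+ 2 * (y ^+ 2 / b)) = x ^+ 4 * y ^+ 2.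
    by field; rewrite ?a_neq0 ?b_neq0.
  suff -> : a ^+ 2 * b * (2 / 3 * (x ^+ 2 / a) ^+ 3 + 3^-1 * (y ^+ 2 / b) ^+ 3)
    = 2 / 3 * (b / a) * x ^+ 6 + 3^-1 * (a ^+ 2 / b ^+ 2) * y ^+ 6 by [].
  by field; rewrite ?a_neq0 ?b_neq0.
apply: (le_trans step); rewrite wsumD !wsumZ.
have -> : a ^+ 2 * b = 2 / 3 * (b / a) * a ^+ 3
    + 3^-1 * (a ^+ 2 / b ^+ 2) * b ^+ 3.
  by field; rewrite ?a_neq0 ?b_neq0.
have ba : 0 <= b / a by rewrite divr_ge0 ?ltW.
have ab : 0 <= a ^+ 2 / b ^+ 2 by rewrite divr_ge0 ?sqr_ge0.
by apply: lerD; apply: ler_wpM2l => //; apply: mulr_ge0 => //; lra.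
Qed.

Lemma wsum_pot_ge0 u : 0 <= W (fun i => Vi i * u i 0 ^+ 2).
Proof.
by apply: wsum_ge0 => // i; rewrite mulr_ge0 ?sqr_ge0 ?(potential_ge0 hp).
Qed.

Lemma wsum4_ge0 u : 0 <= W (fun i => u i 0 ^+ 4).
Proof. by apply: wsum_ge0 => // i; rewrite (exprM _ 2 2) sqr_ge0. Qed.

Lemma energy_split u : energy p u = 2^-1 * form S u u
  + 2^-1 * W (fun i => Vi i * u i 0 ^+ 2) + beta / 4 * W (fun i => u i 0 ^+ 4).
Proof. by rewrite energyE// wsumD !wsumZ addrA. Qed.

Lemma lambda_split u : lambda p u = form S u u
  + W (fun i => Vi i * u i 0 ^+ 2) + beta * W (fun i => u i 0 ^+ 4).
Proof. by rewrite lambdaE// wsumD !wsumZ addrA. Qed.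

Lemma wsum4_le_energy u : beta * W (fun i => u i 0 ^+ 4) <= 4 * energy p u.
Proof.
have := stiffness_psd hp u; have := wsum_pot_ge0 u; rewrite energy_split; lra.
Qed.

Lemma stiff_le_energy u : form S u u <= 2 * energy p u.
Proof.
have := mulr_ge0 (ltW (interaction_gt0 hp)) (wsum4_ge0 u).
have := wsum_pot_ge0 u; rewrite energy_split; lra.
Qed.

Lemma energy_ge0 u : 0 <= energy p u.
Proof. have := stiff_le_energy u; have := stiffness_psd hp u; lra. Qed.

Lemma lambda_ge0 u : 0 <= lambda p u.
Proof.
have := mulr_ge0 (ltW (interaction_gt0 hp)) (wsum4_ge0 u).
have := stiffness_psd hp u; have := wsum_pot_ge0 u; rewrite lambda_split; lra.
Qed.

Lemma lambda_le_energy u : lambda p u <= 4 * energy p u.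
Proof.
have := mulr_ge0 (ltW (interaction_gt0 hp)) (wsum4_ge0 u).
have := stiffness_psd hp u; have := wsum_pot_ge0 u.
rewrite lambda_split energy_split; lra.
Qed.

Lemma potential_le i : Vi i <= V_sup p.
Proof.
rewrite (le_trans (ler_norm _))//.
by have := vmax_ge (fun i => `|(potential p)^T i 0|) i; rewrite mxE.
Qed.

Lemma V_sup_ge0 : 0 <= V_sup p.
Proof. exact: vmax_ge0. Qed.

Section Initial.
Context (CS : R) (u0 : 'cV[R]_N).
Context (N_gt0 : (0 < N)%N) (sobolev : sobolev_constant p CS)
  (u0_norm : lpnorm p 2 u0 = 1).

Lemma w_min_gt0 : 0 < w_min p.
Proof. by apply: vmin_gt0 => // i; apply: weight_gt0. Qed.

Lemma w_min_le i : w_min p <= weight p 0 i.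
Proof. exact: vmin_le. Qed.

Lemma inner_u0 : inner p u0 u0 = 1.
Proof. by rewrite -l2_sqr// u0_norm expr1n. Qed.

Lemma sphere_pow_gt0 v n : inner p v v = 1 -> 0 < W (fun i => v i 0 ^+ (2 * n)).
Proof.
move=> v1; have pos i : 0 <= v i 0 ^+ (2 * n) by rewrite exprM exprn_ge0 ?sqr_ge0.
rewrite lt_def wsum_ge0 ?andbT//; apply/eqP => /(wsum_eq0 hp pos) v0.
have /eqP := v1; suff -> : v = 0 by rewrite inner_form form0l eq_sym oner_eq0.
apply/colP => i; rewrite mxE; apply/eqP.
by have /eqP := v0 i; rewrite expf_eq0 => /andP[].
Qed.

Lemma wsum6_sobolev v :
  W (fun i => v i 0 ^+ 6) <= (CS ^+ 2 * (form S v v + inner p v v)) ^+ 3.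
Proof.
rewrite -l6_pow// -norm1h_sqr// -exprMn -exprM.
have l6 : 0 <= lpnorm p 6 v by exact: lpnorm_ge0.
by apply: lerXn2r; rewrite ?nnegrE// (le_trans l6).
Qed.

Lemma sobolev_gt0 : 0 < CS.
Proof.
have n_gt0 : 0 < norm1h p u0.
  rewrite /norm1h sqrtr_gt0 inner_lap// l2_sqr// inner_u0.
  by have := stiffness_psd hp u0; lra.
have CS_ge0 : 0 <= CS.
  by rewrite -(pmulr_lge0 _ n_gt0) (le_trans _ (sobolev u0))// lpnorm_ge0.
rewrite lt_def CS_ge0 andbT; apply/eqP => CS0.
have := wsum6_sobolev u0; rewrite CS0 expr0n mul0r expr0n /= leNgt.
by rewrite (sphere_pow_gt0 3 inner_u0).
Qed.

Lemma energy_u0_gt0 : 0 < energy p u0.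
Proof.
have := mulr_gt0 (interaction_gt0 hp) (sphere_pow_gt0 2 inner_u0).
have := wsum4_le_energy u0; lra.
Qed.

Local Notation E0 := (E0 p u0).
Local Notation P0 := (P0 p CS u0).
Local Notation U0 := (U0 p CS u0).
Local Notation B0 := (B0 p CS u0).
Local Notation B1 := (B1 p CS u0).
Local Notation D0 := (D0 p CS u0).
Local Notation L0 := (L0 p CS u0).
Local Notation C0 := (C0 p CS u0).

Lemma energy_le_E0 : energy p u0 <= E0.
Proof.
by rewrite /E0 lerDl divr_ge0 ?sqr_ge0// le_max ler01.
Qed.

Lemma E0_gt0 : 0 < E0.
Proof. exact: lt_le_trans energy_u0_gt0 energy_le_E0. Qed.

Lemma P0_gt0 : 0 < P0.
Proof.
have := E0_gt0; have := exprn_gt0 2 sobolev_gt0.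
by rewrite /P0 => c e; rewrite mulr_gt0//; lra.
Qed.

Section Level.
Context (k : R) (v : 'cV[R]_N) (k_ge1 : 1 <= k).
Context (v_norm : inner p v v = 1) (v_energy : energy p v <= k * E0).

Let k_gt0 : 0 < k. Proof. exact: lt_le_trans k_ge1. Qed.

(** The level factor k is needed because the step analysis applies these bounds at energy E0 and,
    before the energy of the new point is known, at 2 E0. *)
Lemma wsum6_level : W (fun i => v i 0 ^+ 6) <= (k * P0) ^+ 3.
Proof.
have CS0 := exprn_gt0 2 sobolev_gt0.
apply: le_trans (wsum6_sobolev v) _; apply: lerXn2r; rewrite ?nnegrE.
- by rewrite mulr_ge0 ?(ltW CS0)// addr_ge0 ?inner_ge0 ?(stiffness_psd hp).
- by rewrite mulr_ge0 ?(ltW k_gt0) ?(ltW P0_gt0).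
rewrite /P0 mulrCA ler_pM2l// v_norm.
have := stiff_le_energy v; move: v_energy k_ge1; lra.
Qed.

(** A single term of a weighted sum is bounded by the sum; the three entries of U0 come from the
    sums of squares, sixth powers (Sobolev) and fourth powers (energy). *)
Lemma entry_level i : v i 0 ^+ 2 <= k * U0.
Proof.
have w0 := w_min_gt0; have wi := w_min_le i; have b0 := interaction_gt0 hp.
have vi0 := sqr_ge0 (v i 0).
have termn n : w_min p * v i 0 ^+ (2 * n) <= W (fun i => v i 0 ^+ (2 * n)).
  apply: le_trans (wsum_term hp i _).
    by rewrite ler_wpM2r// exprM exprn_ge0.
  by move=> j; rewrite exprM exprn_ge0 ?sqr_ge0.
rewrite /U0 -ler_pdivrMl// !le_min !ler_pdivrMl//; apply/and3P; split.
- rewrite mulrA mulr1 ler_pdivlMr// mulrC; apply: le_trans k_ge1.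
  by have := termn 1%N; rewrite muln1 -v_norm innerE; under eq_wsum do rewrite expr2.
- have t0 : 0 < w_min p `^ (1 / 3) by rewrite powR_gt0.
  have t3 : (w_min p `^ (1 / 3)) ^+ 3 = w_min p.
    rewrite -powR_mulrn ?powR_ge0// -powRrM.
    have -> : 1 / 3 * 3%:R = 1 :> R by field.
    by rewrite powRr1 ?ltW.
  rewrite mulrA ler_pdivlMr//; rewrite -(@ler_pXn2r _ 3) ?nnegrE//; last 2 first.
  - by rewrite mulr_ge0// ltW.
  - by rewrite mulr_ge0 ?(ltW k_gt0) ?(ltW P0_gt0).
  by rewrite exprMn t3 mulrC -exprM; apply: le_trans (termn 3%N) wsum6_level.
- have bw : 0 < beta * w_min p by rewrite mulr_gt0.
  rewrite -(@ler_pXn2r _ 2) ?nnegrE//; last first.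
    by rewrite !mulr_ge0 ?sqrtr_ge0 ?ltW.
  rewrite !exprMn sqr_sqrtr ?divr_ge0 ?(ltW E0_gt0) ?(ltW bw)//.
  rewrite !mulrA ler_pdivlMr//.
  have -> : v i 0 ^+ 2 * v i 0 * v i 0 = v i 0 ^+ (2 * 2) by ring.
  have := termn 2%N; rewrite -(ler_pM2l b0) => /le_trans /(_ (wsum4_le_energy v)).
  have kk : k * E0 <= k ^+ 2 * E0 by rewrite ler_pM2r ?E0_gt0// expr2 ler_peMl// ltW.
  by move: v_energy kk; lra.
Qed.

(** The two alternatives are those of the minimum in L0: [H1] uses the entrywise bound on v, [H2]
    Cauchy-Schwarz, Hoelder and the Sobolev inequality, giving C0 ||w||_{1,h} ||w||_2 up to the
    factor k. *)
Lemma curvature_level w : 3 * beta * W (fun i => v i 0 ^+ 2 * w i 0 ^+ 2)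
  <= k * ((L0 - V_sup p) * inner p w w + 8^-1 * form S w w).
Proof.
have b0 := interaction_gt0 hp; have ww := inner_ge0 hp w.
have sw := stiffness_psd hp w.
have H1 : 3 * beta * W (fun i => v i 0 ^+ 2 * w i 0 ^+ 2)
    <= k * (3 * beta * U0 * inner p w w + 8^-1 * form S w w).
  have : W (fun i => v i 0 ^+ 2 * w i 0 ^+ 2) <= k * U0 * inner p w w.
    rewrite innerE -wsumZ; apply: le_wsum => // i.
    by rewrite -expr2 ler_wpM2r ?sqr_ge0 ?entry_level.
  by move: k_gt0; nra.
have H2 : 3 * beta * W (fun i => v i 0 ^+ 2 * w i 0 ^+ 2)
    <= k * ((C0 + 2 * Num.max (C0 - 1 / 4) 0 ^+ 2) * inner p w w
            + 8^-1 * form S w w).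
  have [w0|w_neq0] := eqVneq w 0.
    rewrite (_ : W _ = 0) ?mulr0; last first.
      by rewrite /wsum big1// => i _; rewrite w0 mxE expr0n !mulr0.
    by rewrite w0 inner_form !form0l !mulr0 addr0 mulr0.
  have n0_gt0 := inner_gt0 hp w_neq0.
  set n0 := Num.sqrt (inner p w w).
  set n1 := Num.sqrt (form S w w + inner p w w).
  have n0E : n0 ^+ 2 = inner p w w by rewrite sqr_sqrtr.
  have n1E : n1 ^+ 2 = form S w w + inner p w w by rewrite sqr_sqrtr ?addr_ge0.
  have n0p : 0 < n0 by rewrite sqrtr_gt0.
  have n01 : n0 <= n1 by rewrite ler_wsqrtr// lerDr.
  have n1p : 0 < n1 by exact: lt_le_trans n01.
  have CS0 := sobolev_gt0; have p0 := P0_gt0.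
  have Wb : W (fun i => v i 0 ^+ 2 * w i 0 ^+ 2) <= k * P0 * CS * n1 * n0.
    rewrite -(@ler_pXn2r _ 2) ?nnegrE//; last 2 first.
    - by apply: wsum_ge0 => // i; rewrite mulr_ge0 ?sqr_ge0.
    - exact: mulr_ge0 (mulr_ge0 (mulr_ge0 (mulr_ge0 (ltW k_gt0) (ltW p0)) (ltW CS0)) (ltW n1p)) (ltW n0p).
    have := wsum_CauchySchwarz (fun i => v i 0 ^+ 2 * w i 0) (fun i => w i 0).
    under eq_wsum do rewrite -mulrA -expr2.
    move=> /le_trans; apply.
    have -> : W (fun i => w i 0 ^+ 2) = n0 ^+ 2.
      by rewrite n0E innerE; apply: eq_wsum => i; rewrite expr2.
    rewrite [X in _ <= X]exprMn ler_wpM2r ?sqr_ge0//.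
    under eq_wsum do rewrite exprMn -exprM.
    have := @wsum_holder v w (k * P0) (CS ^+ 2 * n1 ^+ 2).
    have -> : (k * P0) ^+ 2 * (CS ^+ 2 * n1 ^+ 2) = (k * P0 * CS * n1) ^+ 2.
      by rewrite !exprMn !mulrA.
    apply; [exact: mulr_gt0 | by rewrite mulr_gt0 ?exprn_gt0 | |].
    - exact: wsum6_level.
    - by rewrite n1E; exact: wsum6_sobolev.
  have kc : 3 * beta * W (fun i => v i 0 ^+ 2 * w i 0 ^+ 2) <= k * (C0 * n1 * n0).
    rewrite /C0; move: Wb; rewrite -(ler_pM2l (mulr_gt0 (ltr0n R 3) b0)); lra.
  apply: le_trans kc _; rewrite ler_pM2l//.
  have -> : form S w w = n1 ^+ 2 - n0 ^+ 2 by rewrite n1E n0E; ring.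
  (* For C0 > 1/4 the claim is exactly (n1 - 4 C0 n0)^2 >= 0, since C0 + 2 (C0 - 1/4)^2 - 1/8 = 2
     C0^2; for C0 <= 1/4, n0 <= n1 is enough. *)
  rewrite -n0E; have [c|c] := leP (C0 - 1 / 4) 0.
    rewrite expr0n mulr0 addr0.
    have : 0 <= (n1 - n0) * (8^-1 * (n1 + n0) - C0 * n0).
      by apply: mulr_ge0; [lra | nra].
    lra.
  have := sqr_ge0 (n1 - 4 * C0 * n0); lra.
rewrite /L0 [V_sup p + _]addrC addrK; rewrite minEle; case: ifP => _; [exact: H1 | exact: H2].
Qed.

End Level.

Section Initial_level.
Context (v : 'cV[R]_N) (v_norm : inner p v v = 1) (v_energy : energy p v <= E0).

Let v_energy1 : energy p v <= 1 * E0. Proof. by rewrite mul1r. Qed.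

Lemma cubic_level : beta ^+ 2 * W (fun i => v i 0 ^+ 6) <= (B0 - V_sup p) ^+ 2.
Proof.
have b0 := interaction_gt0 hp.
rewrite /B0 [V_sup p + _]addrC addrK exprMn ler_pM2l ?exprn_gt0//.
have W6 := wsum6_level (lexx 1) v_norm v_energy1.
rewrite minEle; case: ifP => _; last first.
  have U i : v i 0 ^+ 2 <= U0.
    by have := entry_level (lexx 1) v_norm v_energy1 i; rewrite mul1r.
  rewrite -[X in _ <= X]mulr1 -v_norm innerE -wsumZ; apply: le_wsum => // i.
  have := U i; have := sqr_ge0 (v i 0); set t := v i 0 ^+ 2 => t0 tU.
  rewrite (exprD _ 4 2) (exprM _ 2 2) -expr2 ler_wpM2r//.
  by rewrite lerXn2r ?nnegrE// (le_trans t0 tU).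
rewrite mul1r in W6; apply: (le_trans W6).
rewrite -[X in _ <= X]powR_mulrn ?powR_ge0// -powRrM.
have -> : 3 / 2 * 2%:R = 3%:R :> R by field.
by rewrite powR_mulrn// ltW// P0_gt0.
Qed.

Lemma reaction_level i : Vi i + beta * v i 0 ^+ 2 <= B1.
Proof.
rewrite /B1 lerD ?potential_le// ler_pM2l ?interaction_gt0//.
by have := entry_level (lexx 1) v_norm v_energy1 i; rewrite mul1r.
Qed.

End Initial_level.

Lemma U0_ge0 : 0 <= U0.
Proof.
have i : 'I_N by exact: Ordinal N_gt0.
have E : energy p u0 <= 1 * E0 by rewrite mul1r energy_le_E0.
have := entry_level (lexx 1) inner_u0 E i.
by rewrite mul1r; apply: le_trans; rewrite sqr_ge0.
Qed.

Lemma V_sup_le_B0 : V_sup p <= B0.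
Proof.
rewrite /B0 lerDl mulr_ge0 ?(ltW (interaction_gt0 hp))//.
by rewrite le_min powR_ge0 U0_ge0.
Qed.

Lemma D0_gt0 : 0 < D0.
Proof.
have := E0_gt0; have := V_sup_le_B0; have := V_sup_ge0; rewrite /D0; lra.
Qed.

Lemma V_sup_le_L0 : V_sup p <= L0.
Proof.
have b0 := ltW (interaction_gt0 hp).
have C00 : 0 <= C0.
  apply: mulr_ge0 (ltW P0_gt0); apply: mulr_ge0 (ltW sobolev_gt0).
  exact: mulr_ge0.
rewrite /L0 lerDl le_min !mulr_ge0 ?U0_ge0//=.
by rewrite addr_ge0// mulr_ge0 ?sqr_ge0.
Qed.

Section StepSize.
Context (gamma : R) (gamma_bd : 0 < gamma <= gamma_max p CS u0).

Lemma gamma_gt0 : 0 < gamma.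
Proof. by case/andP: gamma_bd. Qed.

Lemma gamma_D0 : gamma * D0 <= 1 / 128.
Proof.
case/andP: gamma_bd => g0; rewrite !le_min => /and4P[_ + _ _].
have d0 := D0_gt0; rewrite ler_pdivlMr ?mulr_gt0//; lra.
Qed.

Lemma gamma_L0 : gamma * L0 <= 1 / 8.
Proof.
case/andP: gamma_bd => g0; rewrite !le_min => /and4P[_ _ + _].
have [l0|] := ltP 0 L0.
  by rewrite ler_pdivlMr ?mulr_gt0//; lra.
by move=> l0 _; have := mulr_ge0_le0 (ltW g0) l0; lra.
Qed.

(** The last entry of gamma_max is the positive root of 3 D Lambda t^2 + B1 t = 1 in rationalized
    form. *)
Lemma gamma_Lambda : 3 * D0 * Lambda_d p * gamma ^+ 2 + B1 * gamma <= 1.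
Proof.
case/andP: gamma_bd => g0; rewrite !le_min => /and4P[_ _ _].
have b1 : 0 <= B1.
  by rewrite addr_ge0 ?V_sup_ge0// mulr_ge0 ?U0_ge0// ltW// interaction_gt0.
have d0 := D0_gt0; have l0 : 0 <= Lambda_d p by exact: vmax_ge0.
set s := Num.sqrt _ => gs.
have s0 : 0 <= s by exact: sqrtr_ge0.
have sE : s ^+ 2 = B1 ^+ 2 + 12 * D0 * Lambda_d p.
  by rewrite sqr_sqrtr// addr_ge0 ?sqr_ge0// !mulr_ge0// ltW.
have sB : 0 < B1 + s.
  (* If [B1 + s] were 0, the quotient in gamma_max would be 2 / 0 = 0, against gamma > 0. *)
  rewrite lt_def addr_ge0// andbT; apply/eqP => s00.
  by move: gs; rewrite s00 invr0 mulr0 leNgt g0.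
have Bs : B1 <= s by rewrite -(@ler_pXn2r _ 2) ?nnegrE// sE lerDl !mulr_ge0// ltW.
have gs2 : gamma * (B1 + s) <= 2 by rewrite -ler_pdivlMr.
have -> : 3 * D0 * Lambda_d p * gamma ^+ 2
    = 4^-1 * (gamma * (B1 + s)) * (gamma * (s - B1)).
  have -> : 3 * D0 * Lambda_d p = (s ^+ 2 - B1 ^+ 2) / 4 by rewrite sE; field.
  by field.
have : 0 <= gamma * (s - B1) by rewrite mulr_ge0 ?(ltW g0)// subr_ge0.
move: gs2; nra.
Qed.

End StepSize.

End Initial.
End EnergyBounds.

(** * Coordinatewise limits and minima on the compact sphere *)

Section Convergence.
Context (R : realType) (T : Type) (F : set_system T) (FF : Filter F).

Lemma cvg_sumr (I : Type) (r : seq I) (f : I -> T -> R) (l : I -> R) :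
  (forall i, f i x @[x --> F] --> l i) ->
  (\sum_(i <- r) f i x) @[x --> F] --> \sum_(i <- r) l i.
Proof.
move=> fl; elim: r => [|i r IH].
  under eq_fun do rewrite big_nil; rewrite big_nil; exact: cvg_cst.
under eq_fun do rewrite big_cons; rewrite big_cons; exact: cvgD.
Qed.

Lemma cvg_expr (f : T -> R) (l : R) n : f x @[x --> F] --> l ->
  (f x ^+ n) @[x --> F] --> l ^+ n.
Proof.
move=> fl; elim: n => [|n IH]; first exact: cvg_cst.
by under eq_fun do rewrite exprS; rewrite exprS; exact: cvgM.
Qed.

Section Vectors.
Context (N : nat) (p : gp_problem R N) (hp : admissible p).
Context (f : T -> 'cV[R]_N) (l : 'cV[R]_N).
Context (fl : forall i, f x i 0 @[x --> F] --> l i 0).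

Lemma cvg_wsum (g : 'I_N -> T -> R) (m : 'I_N -> R) :
  (forall i, g i x @[x --> F] --> m i) ->
  wsum p (fun i => g i x) @[x --> F] --> wsum p m.
Proof. by move=> gm; apply: cvg_sumr => i; apply: cvgMr; exact: gm. Qed.

Lemma cvg_form (B : 'M[R]_N) (g : T -> 'cV[R]_N) (m : 'cV[R]_N) :
  (forall i, g x i 0 @[x --> F] --> m i 0) ->
  form B (f x) (g x) @[x --> F] --> form B l m.
Proof.
move=> gm; under eq_fun do rewrite formE; rewrite formE.
apply: cvg_sumr => i; apply: cvg_sumr => j; apply: cvgM; last exact: gm.
by apply: cvgM; [exact: fl | exact: cvg_cst].
Qed.

Lemma cvg_energy : energy p (f x) @[x --> F] --> energy p l.
Proof.
under eq_fun do rewrite energyE//; rewrite energyE//; apply: cvgD.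
  by apply: cvgMr; exact: cvg_form.
apply: cvg_wsum => i; apply: cvgD.
  by apply: cvgMr; apply: cvgMr; exact: cvg_expr.
by apply: cvgMr; exact: cvg_expr.
Qed.

Lemma cvg_lambda : lambda p (f x) @[x --> F] --> lambda p l.
Proof.
under eq_fun do rewrite lambdaE//; rewrite lambdaE//; apply: cvgD.
  exact: cvg_form.
apply: cvg_wsum => i; apply: cvgD.
  by apply: cvgMr; exact: cvg_expr.
by apply: cvgMr; exact: cvg_expr.
Qed.

End Vectors.
End Convergence.

Section CompactSphere.
Context (R : realType) (N : nat) (p : gp_problem R N) (hp : admissible p).
Context (N_gt0 : (0 < N)%N).

(* Compactness is available for row vectors, hence the transposition. *)
Lemma sphere_minimum (C : set 'cV[R]_N) (f : 'cV[R]_N -> R) :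
  C !=set0 -> (forall v, C v -> inner p v v = 1) ->
  closed [set v : 'rV[R]_N | C v^T] -> continuous (fun v : 'rV[R]_N => f v^T) ->
  exists2 c, C c & forall v, C v -> f c <= f v.
Proof.
move=> [v0 Cv0] C1 Ccl fct.
(* On the sphere v_i^2 <= 1 / w_min, which is at most (1 + 1 / w_min)^2; this avoids a square
   root. *)
pose M := 1 + (w_min p)^-1; have w0 := w_min_gt0 hp N_gt0.
have box : compact [set v : 'rV[R]_N | forall i, v ord0 i \in `[- M, M]].
  by apply: (@rV_compact _ _ (fun=> `[- M, M]%classic)) => _; exact: segment_compact.
have Ccp : compact [set v : 'rV[R]_N | C v^T].
  apply: subclosed_compact Ccl box _ => v /C1 v1 i /=.
  have wi : weight p 0 i * (v 0 i * v 0 i) <= 1.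
    rewrite -v1 innerE.
    have := @wsum_term _ _ _ hp (fun i => v^T i 0 * v^T i 0) i.
    by rewrite mxE; apply => j; rewrite -expr2 sqr_ge0.
  rewrite in_itv /= -ler_norml; apply: norm_ler_of_sqr.
    by rewrite addr_ge0 ?ler01 ?invr_ge0 ?(ltW w0).
  have iw0 : 0 < (w_min p)^-1 by rewrite invr_gt0.
  apply: (@le_trans _ _ (w_min p)^-1); last by rewrite /M; clear - iw0; nra.
  rewrite -[leRHS]mulr1 ler_pdivlMl// expr2; apply: le_trans wi.
  by rewrite ler_wpM2r ?w_min_le// -expr2 sqr_ge0.
have Cne : [set v : 'rV[R]_N | C v^T] !=set0 by exists v0^T; rewrite /= trmxK.
have [c Cc cmin] := EVT_min_rV Cne Ccp (continuous_subspaceT fct).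
exists c^T => [|v Cv]; first by move: Cc; rewrite inE.
by have := cmin v^T; rewrite trmxK; apply; rewrite inE /= trmxK.
Qed.

End CompactSphere.

(** * The resolvent of the discrete Laplacian and the maximum principle *)

Section Resolvent.
Context (R : realType) (N : nat) (p : gp_problem R N) (hp : admissible p).
Context (gamma : R) (gamma_gt0 : 0 < gamma).
Implicit Types (u v w : 'cV[R]_N).

Local Notation W := (wsum p).
Local Notation S := (stiffness p).
Local Notation ip := (inner p).

(** Multiplied by the mass matrix it becomes M + gamma S, which is positive definite. *)
Lemma resolvent_unit : 1%:M - gamma *: lapM p \in unitmx.
Proof.
have e : massM p *m (1%:M - gamma *: lapM p) = massM p + gamma *: S.
  rewrite mulmxBr mulmx1 -scalemxAr /lapM mulmxN mulmxA mulmxV ?massM_unit//.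
  by rewrite mul1mx scalerN opprK.
suff u : massM p + gamma *: S \in unitmx.
  by move: u; rewrite -e unitmx_mul => /andP[].
rewrite -row_free_unit -kermx_eq0; apply/rowV0P => v /sub_kermxP v0.
apply: trmx_inj; rewrite trmx0; apply: (inner_eq0 hp); apply/le_anti.
rewrite (inner_ge0 hp) andbT.
have : (v *m (massM p + gamma *: S) *m v^T) 0 0 = 0 by rewrite v0 mul0mx mxE.
rewrite mulmxDr mulmxDl mxE -scalemxAr -scalemxAl [in X in _ + X]mxE.
have := mulr_ge0 (ltW gamma_gt0) (stiffness_psd hp v^T).
by rewrite /inner /form trmxK; clear; lra.
Qed.

Lemma resolvent_weak u v : v = invmx (1%:M - gamma *: lapM p) *m u ->
  forall w, ip w v + gamma * form S w v = ip w u.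
Proof.
move=> vE w; have -> : u = v + gamma *: (- lapM p *m v).
  rewrite -[LHS](mulKVmx resolvent_unit) -vE mulmxBl mul1mx -scalemxAl.
  by rewrite [in RHS]mulNmx scalerN.
by rewrite [RHS]inner_form formDr formZr -!inner_form inner_lap.
Qed.

(** Discrete maximum principle, tested with the negative part m of v. The positive part q has
    disjoint support, so <m, q> = 0, and S(m, q) <= 0 by the sign of the off-diagonal entries; what
    remains forces ||m||^2 <= 0. *)
Lemma weak_ge0 v : (forall w, (forall i, 0 <= w i 0) ->
    0 <= ip w v + gamma * form S w v) -> forall i, 0 <= v i 0.
Proof.
move=> vpos; pose m : 'cV[R]_N := \col_i Num.max (- v i 0) 0.
pose q : 'cV[R]_N := \col_i Num.max (v i 0) 0.
have m0 i : 0 <= m i 0 by rewrite mxE le_max lexx orbT.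
have q0 i : 0 <= q i 0 by rewrite mxE le_max lexx orbT.
have vqm : v = q - m.
  apply/colP => i; rewrite !mxE; have [v0|v0] := leP 0 (v i 0).
    by rewrite max_r ?oppr_le0// subr0.
  by rewrite max_l ?oppr_ge0 ?ltW// sub0r opprK.
have mq0 i : m i 0 * q i 0 = 0.
  rewrite !mxE; have [v0|v0] := leP 0 (v i 0); last by rewrite mulr0.
  by rewrite max_r ?oppr_le0// mul0r.
have ipmq : ip m q = 0 by rewrite innerE /wsum big1// => i _; rewrite mq0 mulr0.
have smq : form S m q <= 0.
  rewrite formE; apply: sumr_le0 => i _; apply: sumr_le0 => j _.
  have [<-|ij] := eqVneq i j; first by rewrite mulrAC mq0 mul0r.
  by rewrite mulrAC mulr_ge0_le0 ?mulr_ge0 ?(stiffness_off hp).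
have mm : ip m m = 0.
  apply/le_anti; rewrite (inner_ge0 hp) andbT.
  have := vpos m m0; rewrite vqm inner_form !formDr !formNr -!inner_form ipmq.
  have := mulr_ge0 (ltW gamma_gt0) (stiffness_psd hp m).
  have := mulr_ge0_le0 (ltW gamma_gt0) smq; clear; lra.
by move=> i; rewrite vqm (inner_eq0 hp mm) subr0.
Qed.

(* With h = (I + gamma A)^-1 v this is |h - c gamma A h| <= |h + gamma A h|. *)
Lemma resolvent_contraction v c : 0 <= c <= 1 ->
  let f := (1 + c) *: (invmx (1%:M - gamma *: lapM p) *m v) - c *: v in
  (forall w, ip w f + gamma * form S w f = ip w v - c * (gamma * form S w v))
  /\ ip f f <= ip v v.
Proof.
move=> /andP[c0 c1]; set h := invmx _ *m v; set f := _ - _ => /=.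
have hw := resolvent_weak (erefl h).
have vE : v = h + gamma *: (- lapM p *m h).
  apply: (inner_inj hp) => w.
  by rewrite -hw [in RHS]inner_form formDr formZr -!inner_form inner_lap.
split=> [w|].
  rewrite /f inner_form !formDr !formZr !formNr !formZr -!inner_form.
  by rewrite -(hw w); ring.
have fE : f = h - c *: (gamma *: (- lapM p *m h)).
  by rewrite /f vE scalerDl scale1r scalerDr opprD -addrA [c *: h + _]addrA subrr add0r.
rewrite fE vE; move: (- lapM p *m h) (inner_lap hp h h) => k hk.
rewrite !inner_form !formL -!inner_form (innerC p k h) hk.
have h0 := mulr_ge0 (ltW gamma_gt0) (stiffness_psd hp h).
have k0 : 0 <= gamma ^+ 2 * ip k k by rewrite mulr_ge0 ?sqr_ge0 ?(inner_ge0 hp).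
have c2 : c ^+ 2 <= 1 by rewrite expr_le1.
have := mulr_ge0 c0 h0; have : c ^+ 2 * (gamma ^+ 2 * ip k k) <= gamma ^+ 2 * ip k k.
  exact: ler_piMl.
move: h0; clear; lra.
Qed.

End Resolvent.

(** * The potential and interaction terms *)

Section Reaction.
Context (R : realType) (N : nat) (p : gp_problem R N) (hp : admissible p).
Implicit Types (u v w : 'cV[R]_N).

Local Notation W := (wsum p).
Local Notation S := (stiffness p).
Local Notation ip := (inner p).
Local Notation beta := (interaction p).
Local Notation Vi i := (potential p 0 i).

Definition reaction u : 'cV[R]_N := \col_i (Vi i * u i 0 + beta * u i 0 ^+ 3).

Lemma inner_gradE_reaction u w :
  ip (gradE p u) w = form S u w + ip (reaction u) w.
Proof.
rewrite inner_gradE//; congr (_ + _).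
by rewrite innerE; apply: eq_wsum => i; rewrite mxE.
Qed.

Lemma wsum_minkowski (f g : 'I_N -> R) (a b : R) : 0 <= a -> 0 <= b ->
  W (fun i => f i ^+ 2) <= a ^+ 2 -> W (fun i => g i ^+ 2) <= b ^+ 2 ->
  W (fun i => (f i + g i) ^+ 2) <= (a + b) ^+ 2.
Proof.
move=> a0 b0 fa gb.
have fg : W (fun i => f i * g i) <= a * b.
  apply: ler_of_sqr; first exact: mulr_ge0.
  apply: le_trans (wsum_CauchySchwarz hp f g) _; rewrite exprMn.
  by apply: ler_pM => //; apply: wsum_ge0 => // i; exact: sqr_ge0.
have -> : W (fun i => (f i + g i) ^+ 2)
    = W (fun i => f i ^+ 2) + 2 * W (fun i => f i * g i) + W (fun i => g i ^+ 2).
  by rewrite -wsumZ -!wsumD; apply: eq_wsum => i; ring.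
by move: fg fa gb; clear; lra.
Qed.

(* u^4 - v^4 = (u - v)(u^3 + u^2 v + u v^2 + v^3) turns the difference of the
   reaction energies into a pairing with u - v. *)
Definition reaction_sum u v : 'cV[R]_N := \col_i (Vi i * (u i 0 + v i 0)
  + beta * (u i 0 ^+ 3 + u i 0 ^+ 2 * v i 0 + u i 0 * v i 0 ^+ 2 + v i 0 ^+ 3)).

Lemma lambda_diff u w : lambda p (u + w) - lambda p u
  = 2 * form S u w + form S w w + ip w (reaction_sum (u + w) u).
Proof.
rewrite !lambdaE// !formL (stiffC hp w u) innerE.
set a := W _; set b := W _; set c := W _.
suff -> : a = b + c by ring.
by rewrite /a /b /c -wsumD; apply: eq_wsum => i; rewrite !mxE; ring.
Qed.

Section Bounds.
Context (CS : R) (u0 : 'cV[R]_N) (N_gt0 : (0 < N)%N).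
Context (sobolev : sobolev_constant p CS) (u0_norm : lpnorm p 2 u0 = 1).

Local Notation E0 := (E0 p u0).
Local Notation B0 := (B0 p CS u0).

(** Minkowski's inequality for V v and beta v^3, matching the two summands of B0. *)
Lemma reaction_norm v : ip v v = 1 -> energy p v <= E0 ->
  ip (reaction v) (reaction v) <= B0 ^+ 2.
Proof.
move=> v1 vE; rewrite innerE.
have V0 := V_sup_ge0 p.
have BV : 0 <= B0 - V_sup p.
  by rewrite subr_ge0 (V_sup_le_B0 hp N_gt0 sobolev u0_norm).
have -> : B0 = V_sup p + (B0 - V_sup p) by ring.
have := @wsum_minkowski (fun i => Vi i * v i 0) (fun i => beta * v i 0 ^+ 3) _ _ V0 BV.
set a := W _; set b := W _; set c := W _; set d := W _ => H.
have -> : d = c by apply: eq_wsum => i; rewrite mxE expr2.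
apply: H.
  rewrite -[leRHS]mulr1 -v1 innerE -wsumZ; apply: le_wsum => // i.
  rewrite exprMn -expr2 ler_wpM2r ?sqr_ge0//.
  apply: ler_sqr_norm; rewrite ger0_norm ?(potential_ge0 hp)//.
  exact: potential_le.
have -> : b = beta ^+ 2 * W (fun i => v i 0 ^+ 6).
  by rewrite -wsumZ; apply: eq_wsum => i; rewrite exprMn -exprM.
exact: cubic_level.
Qed.

Lemma reaction_pair v w : ip v v = 1 -> energy p v <= E0 ->
  ip (reaction v) w ^+ 2 <= B0 ^+ 2 * ip w w.
Proof.
move=> v1 vE; apply: le_trans (inner_CauchySchwarz hp _ _) _.
by apply: ler_wpM2r; [exact: inner_ge0 | exact: reaction_norm].
Qed.

(** By [cubic_sum_le] each entry is at most twice the sum of the two reactions; nonnegativity allows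
    squaring. *)
Lemma reaction_sum_norm u v : (forall i, 0 <= u i 0) -> (forall i, 0 <= v i 0) ->
  ip u u = 1 -> ip v v = 1 -> energy p u <= E0 -> energy p v <= E0 ->
  ip (reaction_sum u v) (reaction_sum u v) <= (4 * B0) ^+ 2.
Proof.
move=> up vp u1 v1 uE vE.
have b0 : 0 <= B0.
  exact: le_trans (V_sup_ge0 p) (V_sup_le_B0 hp N_gt0 sobolev u0_norm).
have sq w : ip w w = W (fun i => w i 0 ^+ 2).
  by rewrite innerE; apply: eq_wsum => i; rewrite expr2.
have uu := reaction_norm u1 uE; have vv := reaction_norm v1 vE.
rewrite sq in uu; rewrite sq in vv; rewrite sq.
have := wsum_minkowski b0 b0 uu vv; set e := W _; set f := W _ => eb.
have : f <= 4 * e.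
  rewrite -wsumZ; apply: le_wsum => // i.
  have -> : 4 * (reaction u i 0 + reaction v i 0) ^+ 2
      = (2 * (reaction u i 0 + reaction v i 0)) ^+ 2 by ring.
  apply: ler_sqr_norm; rewrite !mxE.
  have x0 := up i; have y0 := vp i; have Vp := potential_ge0 hp i.
  have bp := ltW (interaction_gt0 hp).
  rewrite ger0_norm; last first.
    by rewrite addr_ge0 ?mulr_ge0 ?addr_ge0 ?mulr_ge0 ?exprn_ge0.
  exact: cubic_sum_le.
move=> /le_trans; apply; rewrite (_ : (4 * B0) ^+ 2 = 4 * (B0 + B0) ^+ 2).
  by rewrite ler_pM2l.
by ring.
Qed.

End Bounds.
End Reaction.

(** Interface between the explicit constants and the step analysis, which then treats E0, B0, B1, L0
    as plain numbers with these properties. The Sobolev constant no longer appears. *)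
Record level_bounds (R : realType) (N : nat) (p : gp_problem R N)
    (gamma E0 B0 B1 L0 Vs Lam : R) : Prop := LevelBounds {
  level_gamma : 0 < gamma;
  level_E0 : 0 < E0;
  level_B0 : 0 <= B0;
  level_Vs : 0 <= Vs;
  level_Lam : 0 <= Lam;
  level_step : gamma * E0 + gamma * B0 <= 1 / 128;
  level_step_L0 : gamma * L0 <= 1 / 8;
  level_step_B1 : 3 * (E0 + B0) * Lam * gamma ^+ 2 + B1 * gamma <= 1;
  level_potential : forall i, potential p 0 i <= Vs;
  level_diag : forall i, stiffness p i i <= weight p 0 i * Lam;
  level_curvature : forall (k : R) (v w : 'cV_N), 1 <= k -> inner p v v = 1 ->
    energy p v <= k * E0 ->
    3 * interaction p * wsum p (fun i => v i 0 ^+ 2 * w i 0 ^+ 2)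
    <= k * ((L0 - Vs) * inner p w w + 8^-1 * form (stiffness p) w w);
  level_pair : forall v w : 'cV_N, inner p v v = 1 -> energy p v <= E0 ->
    inner p (reaction p v) w ^+ 2 <= B0 ^+ 2 * inner p w w;
  level_sum : forall u v : 'cV_N, (forall i, 0 <= u i 0) -> (forall i, 0 <= v i 0) ->
    inner p u u = 1 -> inner p v v = 1 -> energy p u <= E0 -> energy p v <= E0 ->
    inner p (reaction_sum p u v) (reaction_sum p u v) <= (4 * B0) ^+ 2;
  level_reaction : forall (v : 'cV_N) i, inner p v v = 1 -> energy p v <= E0 ->
    potential p 0 i + interaction p * v i 0 ^+ 2 <= B1
}.

(** * One step: positivity, norm bounds and descent of the merit function *)

Section Step.
Context (R : realType) (N : nat) (p : gp_problem R N) (hp : admissible p).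
Context (gamma E0 B0 B1 L0 Vs Lam : R).
Context (lb : level_bounds p gamma E0 B0 B1 L0 Vs Lam).

Local Notation W := (wsum p).
Local Notation S := (stiffness p).
Local Notation ip := (inner p).
Local Notation beta := (interaction p).
Local Notation Vi i := (potential p 0 i).

Context (u y : 'cV[R]_N) (r : R).
Context (u_ge0 : forall i, 0 <= u i 0) (u_norm : ip u u = 1).
Context (r_bd : 1 - 3 * (gamma * E0 + gamma * B0) <= r <= 1).
Context (merit_bd :
  energy p u + (r - 1 + gamma * lambda p u) ^+ 2 / gamma <= E0).
Context (weak_eq : forall w, ip w y + gamma * form S w y
  = (1 - r) * ip w u - gamma * ip (gradE p u) w).

Let g0 : 0 < gamma := level_gamma lb.
(** Scalars describing the step: [s] and [h] are the radial and tangential parts of [y], while [a],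
    [k], [xi] are the gamma-scaled energy seminorms of [u], [y] and [x = u + y]. Testing [weak_eq]
    with [y] and [u] gives [gradE_y] and [sE]. *)
Let res := r - 1 + gamma * lambda p u.
Let s := ip u y.
Let h := Num.sqrt (ip y y - s ^+ 2).
Let a := Num.sqrt (gamma * form S u u).
Let k := Num.sqrt (gamma * form S y y).
Let b := gamma * form S u y.
Let x := u + y.
Let xi := Num.sqrt (gamma * form S x x).
Let e := gamma * E0.
Let c := gamma * B0.

Let e0 : 0 <= e. Proof. by rewrite mulr_ge0 ?ltW ?(level_E0 lb). Qed.
Let c0 : 0 <= c. Proof. by rewrite mulr_ge0 ?(level_B0 lb)// ltW. Qed.
Let ec : e + c <= 1 / 128. Proof. exact: level_step lb. Qed.

Let gS v : 0 <= gamma * form S v v.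
Proof. by rewrite mulr_ge0 ?(stiffness_psd hp)// ltW. Qed.

Let hE : s ^+ 2 + h ^+ 2 = ip y y.
Proof.
rewrite sqr_sqrtr ?subrKC// subr_ge0.
by have := inner_CauchySchwarz hp u y; rewrite u_norm mul1r.
Qed.

Let aE : a ^+ 2 = gamma * form S u u. Proof. by rewrite sqr_sqrtr. Qed.
Let kE : k ^+ 2 = gamma * form S y y. Proof. by rewrite sqr_sqrtr. Qed.
Let xiE : xi ^+ 2 = gamma * form S x x. Proof. by rewrite sqr_sqrtr. Qed.
Let h0 : 0 <= h. Proof. exact: sqrtr_ge0. Qed.
Let a0 : 0 <= a. Proof. exact: sqrtr_ge0. Qed.
Let k0 : 0 <= k. Proof. exact: sqrtr_ge0. Qed.
Let xi0 : 0 <= xi. Proof. exact: sqrtr_ge0. Qed.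

Let gSb v w : `|gamma * form S v w|
  <= Num.sqrt (gamma * form S v v) * Num.sqrt (gamma * form S w w).
Proof.
apply: norm_ler_of_sqr; first by rewrite mulr_ge0 ?sqrtr_ge0.
rewrite exprMn [leRHS]exprMn !sqr_sqrtr//.
have := ler_wpM2l (sqr_ge0 gamma) (stiff_CauchySchwarz hp v w).
by rewrite (_ : gamma ^+ 2 * (form S v v * form S w w) =
  gamma * form S v v * (gamma * form S w w))//; ring.
Qed.

Let bk : `|b| <= a * k. Proof. exact: gSb. Qed.

Let energy_u : energy p u <= E0.
Proof. by apply: le_trans merit_bd; rewrite lerDl divr_ge0 ?sqr_ge0// ltW. Qed.

Let res_sqr : res ^+ 2 <= gamma * (E0 - energy p u).
Proof. by rewrite mulrC -ler_pdivrMr// lerBrDl. Qed.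

Let ae : a ^+ 2 <= 2 * e.
Proof.
rewrite aE /e mulrCA ler_pM2l//; apply: le_trans (stiff_le_energy hp u) _.
by rewrite ler_pM2l.
Qed.

Let a1 : 0 <= a <= 1 / 8.
Proof.
rewrite a0 /=; apply: ler_of_sqr; first lra.
by move: ae ec c0; lra.
Qed.

Let d1 : 0 <= 1 - r <= 3 / 128.
Proof. by case/andP: r_bd; rewrite -/e -/c; move: ec; lra. Qed.

Let c1 : 0 <= c <= 1 / 128.
Proof. by rewrite c0 /=; move: ec e0; lra. Qed.

Let react_pair w : (gamma * ip (reaction p u) w) ^+ 2 <= c ^+ 2 * ip w w.
Proof.
have := ler_wpM2l (sqr_ge0 gamma) (level_pair lb w u_norm energy_u).
by rewrite [in leRHS]mulrA -[in leRHS]exprMn -[in leLHS]exprMn.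
Qed.

Let gradE_y : gamma * ip (gradE p u) y = (1 - r) * s - (s ^+ 2 + h ^+ 2 + k ^+ 2).
Proof.
have := weak_eq y; rewrite (innerC p y u) -/s hE kE; lra.
Qed.

Let Q : s ^+ 2 + h ^+ 2 + k ^+ 2 <= 1 / 60.
Proof.
have yy := gradE_y; rewrite inner_gradE_reaction// mulrDr -/b in yy.
apply: (step_size_bound a1 k0 bk d1 c1 (g := gamma * ip (reaction p u) y)).
  by rewrite hE.
move: yy; lra.
Qed.

Let h1 : 0 <= h <= 13 / 100.
Proof.
rewrite h0 /=; apply: ler_of_sqr; first by lra.
by have := sqr_ge0 s; have := sqr_ge0 k; move: Q; lra.
Qed.

Let k1 : 0 <= k <= 13 / 100.
Proof.
rewrite k0 /=; apply: ler_of_sqr; first by lra.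
by have := sqr_ge0 s; have := sqr_ge0 h; move: Q; lra.
Qed.

Let sE : s = - res - b.
Proof.
have := weak_eq u; rewrite u_norm -/s -/(lambda p u) -/b /res.
by lra.
Qed.

Let lambda_bd : gamma * lambda p u <= 2 * (e + c).
Proof.
have <- : ip (gradE p u) u = lambda p u by [].
rewrite inner_gradE_reaction// mulrDr -aE.
have : gamma * ip (reaction p u) u <= c.
  apply: ler_of_sqr => //; have := react_pair u; rewrite u_norm mulr1.
  exact.
by move: ae c0; lra.
Qed.

Let s1 : `|s| <= 1 / 25.
Proof.
apply: (radial_bound a1 k0 bk Q _ sE); rewrite /res.
have := mulr_ge0 (ltW g0) (lambda_ge0 hp u).
case/andP: d1 => + +; move: lambda_bd ec => *; apply/andP; split; lra.
Qed.

Let r1 : 40 / 41 <= r <= 1.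
Proof. by case/andP: r_bd d1 => _ -> /andP[_]; rewrite andbT; lra. Qed.

Section Path.
Context (t rho : R) (t01 : 0 <= t <= 1) (rho0 : 0 < rho).
Context (rhoE : rho ^+ 2 = (r + t * s) ^+ 2 + t ^+ 2 * h ^+ 2).
(** Spherical path from [u] at t = 0 to the new iterate at t = 1; the increment [w] has coefficients
    [tau] on [y] and [cc] on [u]. *)
Let v := rho^-1 *: (r *: u + t *: y).
Let w := v - u.
Let tau := t / rho.
Let sg := (r + t * s) / rho - 1.
Let cc := sg - tau * s.

Let rho_neq0 : rho != 0. Proof. by rewrite gt_eqF. Qed.

Lemma path_norm : ip v v = 1.
Proof.
rewrite /v !inner_form !formL -!inner_form u_norm (innerC p y u) -/s -hE.
transitivity (rho^-1 * rho^-1 * ((r + t * s) ^+ 2 + t ^+ 2 * h ^+ 2)).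
  by ring.
by rewrite -rhoE; field.
Qed.

Lemma path_increment : w = tau *: y + cc *: u.
Proof.
by apply/colP => i; rewrite /w /v /cc /sg /tau !mxE; field.
Qed.

Let geometry : [/\ 0 <= tau <= 15 / 14, sg <= 0
  & - 2 * sg <= 26 / 25 * (tau ^+ 2 * h ^+ 2)].
Proof.
apply: path_geometry r1 t01 s1 _ rho0 rhoE.
by have := sqr_ge0 k; move: Q; lra.
Qed.

Lemma path_norm_increment : ip w w = - 2 * sg.
Proof.
have uv : ip u v = sg + 1.
  rewrite /v inner_form !formL -!inner_form u_norm -/s /sg subrK mulr1 mulrC.
  by [].
by rewrite /w inner_sub_sqr path_norm u_norm uv; ring.
Qed.

Lemma path_drift : `|cc| <= tau * (`|s| + h / 13).
Proof. by have [t1 sg0 sg1] := geometry; exact: drift_bound. Qed.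

Lemma path_stiff : gamma * form S u w = tau * b + cc * a ^+ 2.
Proof. by rewrite path_increment !formL aE /b; ring. Qed.

Lemma path_stiff2 : gamma * form S w w
  = tau ^+ 2 * k ^+ 2 + 2 * (tau * cc) * b + cc ^+ 2 * a ^+ 2.
Proof. by rewrite path_increment !formL aE kE (stiffC hp y u) /b; ring. Qed.

Lemma path_remainder : energy p v <= 2 * E0 ->
  gamma * W (fun i => 2^-1 * (Vi i * w i 0 ^+ 2) + beta / 4 * (w i 0 ^+ 2
      * (3 * u i 0 ^+ 2 + 2 * (u i 0 * (u i 0 + w i 0)) + (u i 0 + w i 0) ^+ 2)))
  <= 12^-1 * (ip w w + gamma * form S w w).
Proof.
move=> vE.
have ku : 3 * beta * W (fun i => u i 0 ^+ 2 * w i 0 ^+ 2)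
    <= (L0 - Vs) * ip w w + 8^-1 * form S w w.
  have uE : energy p u <= 1 * E0 by rewrite mul1r.
  by have := level_curvature lb w (lexx 1) u_norm uE; rewrite mul1r.
have kv := level_curvature lb w (ler1n R 2) path_norm vE.
have ww := inner_ge0 hp w; have sw := stiffness_psd hp w.
(* From 2 u v <= u^2 + v^2 the bracket is at most 4 u^2 + 2 v^2, so that only products controlled by
   [level_curvature] remain. *)
have rem : W (fun i => 2^-1 * (Vi i * w i 0 ^+ 2) + beta / 4 * (w i 0 ^+ 2
      * (3 * u i 0 ^+ 2 + 2 * (u i 0 * (u i 0 + w i 0)) + (u i 0 + w i 0) ^+ 2)))
  <= Vs / 2 * ip w w + 1 / 3 * (3 * beta * W (fun i => u i 0 ^+ 2 * w i 0 ^+ 2))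
     + 1 / 6 * (3 * beta * W (fun i => v i 0 ^+ 2 * w i 0 ^+ 2)).
  rewrite innerE -!wsumZ -!wsumD; apply: le_wsum => // i.
  have -> : v i 0 = u i 0 + w i 0 by rewrite !mxE subrKC.
  have := ler_wpM2r (sqr_ge0 (w i 0)) (level_potential lb i).
  have := mulr_ge0 (ltW (interaction_gt0 hp))
    (mulr_ge0 (sqr_ge0 (w i 0)) (sqr_ge0 (w i 0))).
  by move: (w i 0) (u i 0) (Vi i) beta Vs => *; lra.
have gL : gamma * (L0 * ip w w) <= 1 / 8 * ip w w.
  by rewrite mulrA; apply: ler_wpM2r => //; exact: (level_step_L0 lb).
have Vw := mulr_ge0 (level_Vs lb) ww.
(* The factor 2/3 is 1/3 from [u] at level 1 plus 1/6 from [v] at level 2; the share of [Vs] in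
   [L0 - Vs] compensates the potential term. *)
have rem2 : W (fun i => 2^-1 * (Vi i * w i 0 ^+ 2) + beta / 4 * (w i 0 ^+ 2
      * (3 * u i 0 ^+ 2 + 2 * (u i 0 * (u i 0 + w i 0)) + (u i 0 + w i 0) ^+ 2)))
    <= 2 / 3 * (L0 * ip w w + 8^-1 * form S w w).
  move: rem ku kv Vw; move: (W _) (W _) (W _) (ip w w) (form S w w).
  by move: Vs L0 beta => *; lra.
have := ler_wpM2l (ltW g0) rem2.
by move: (W _) (ip w w) (form S w w) gL; move: gamma L0 => *; lra.
Qed.

Lemma path_energy : energy p v <= 2 * E0 ->
  gamma * (energy p v - energy p u) <= energy_drop res s h k tau.
Proof.
move=> vE; have [/andP[tau0 _] sg0 sg1] := geometry.
have wb := increment_bound a1 k0 bk h0 tau0 path_drift.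
have rem := path_remainder vE.
have grad : gamma * ip (gradE p u) w
    <= tau * (- (s ^+ 2 + h ^+ 2 + k ^+ 2) - res * s).
  (* The leftover term is nonpositive because [sg <= 0] and lambda is nonnegative. *)
  have -> : gamma * ip (gradE p u) w = tau * (- (s ^+ 2 + h ^+ 2 + k ^+ 2) - res * s)
      + sg * (gamma * lambda p u).
    have gu : ip (gradE p u) u = lambda p u by [].
    rewrite path_increment inner_form formDr !formZr -!inner_form gu.
    have -> : gamma * (tau * ip (gradE p u) y + cc * lambda p u)
      = tau * (gamma * ip (gradE p u) y) + cc * (gamma * lambda p u) by ring.
    by rewrite gradE_y /res /cc; ring.
  rewrite gerDl mulr_le0_ge0 ?mulr_ge0 ?(lambda_ge0 hp)// ltW//.
have -> : energy p v = energy p (u + w) by rewrite /w subrKC.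
(* The quadratic part is (1/2 + 1/12) gamma <A w, w> + ||w||^2 / 12; inserting [wb] and [sg1] yields
   21/32, 1/12 and 13/150. *)
rewrite energyD// /energy_drop; move: rem grad; rewrite path_norm_increment.
move: wb; rewrite -path_stiff2 -mulrA.
set G := form S w w; set Rm := W _; set gr := ip _ w.
rewrite -!/(_ * G); move: (tau ^+ 2) (energy p u) sg1.
move: (s ^+ 2) (h ^+ 2) (k ^+ 2) (res * s) tau sg gamma.
move: G Rm gr => *; lra.
Qed.

Lemma path_level : energy p v <= 2 * E0 -> energy p v <= E0.
Proof.
move=> /path_energy vE; have [tau1 _ _] := geometry.
have := le_trans (le_trans vE (energy_drop_path res s h k tau1)) res_sqr.
by rewrite (ler_pM2l g0) lerD2r.
Qed.

End Path.

Let n t := (r + t * s) ^+ 2 + t ^+ 2 * h ^+ 2.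
Let path t := (Num.sqrt (n t))^-1 *: (r *: u + t *: y).

Let radius_ge t : 0 <= t <= 1 -> 14 / 15 <= r + t * s.
Proof.
move=> /andP[t0 t1]; case/andP: r1 => r2 _.
have ts : `|t * s| <= 1 * (1 / 25).
  by rewrite normrM ger0_norm//; apply: ler_pM.
by move: ts r2; rewrite ler_norml => /andP[]; move: (t * s) r => *; lra.
Qed.

Let n_gt0 t : 0 <= t <= 1 -> 0 < n t.
Proof.
move=> /radius_ge q0; rewrite /n; apply: ltr_wpDr.
  by apply: mulr_ge0; apply: sqr_ge0.
by apply: exprn_gt0; apply: lt_le_trans q0; lra.
Qed.

(* The bounds at the new iterate need an a priori bound of its energy: along
   the path from u the energy cannot cross (E0, 2 E0]. *)
Lemma endpoint_level : energy p (path 1) <= E0.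
Proof.
rewrite leNgt; apply/negP => gt; pose f t := energy p (path t).
have fc : {within `[0, 1], continuous f}.
  apply: continuous_in_subspaceT => t; rewrite inE /= in_itv /= => t01.
  apply: cvg_energy => // i.
  have -> : (fun t => path t i 0)
      = (fun t => (Num.sqrt (n t))^-1 * (r * u i 0 + t * y i 0)).
    by apply/funext => t'; rewrite !mxE.
  have -> : path t i 0 = (Num.sqrt (n t))^-1 * (r * u i 0 + t * y i 0).
    by rewrite !mxE.
  apply: cvgM.
    apply: cvgV; first by rewrite gt_eqF// sqrtr_gt0 n_gt0.
    apply: (@cvg_comp _ _ _ n Num.sqrt _ (nbhs (n t))); last exact: sqrt_continuous.
    apply: cvgD.
      apply: cvg_expr; apply: cvgD; first exact: cvg_cst.
      by apply: cvgM; [exact: cvg_id | exact: cvg_cst].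
    by apply: cvgM; [apply: cvg_expr; exact: cvg_id | exact: cvg_cst].
  apply: cvgD; first exact: cvg_cst.
  by apply: cvgM; [exact: cvg_id | exact: cvg_cst].
have r_gt0 : 0 < r by case/andP: r1 => + _; apply: lt_le_trans; lra.
have f0 : f 0 <= E0.
  have n0 : n 0 = r ^+ 2 by rewrite /n; ring.
  have r_neq0 : r != 0 by rewrite gt_eqF.
  rewrite /f /path n0 sqrtr_sqr (gtr0_norm r_gt0) scale0r addr0 scalerA.
  by rewrite (mulVf r_neq0) scale1r.
have E2 : E0 < 2 * E0 by rewrite ltr_pMl ?(level_E0 lb)// ltr1n.
(* If the endpoint exceeded E0, the path would take this value in (E0, 2 E0], which [path_level]
   excludes. *)
have vb : E0 < Num.min (f 1) (2 * E0) by rewrite lt_min gt E2.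
have fv := min_between f0 gt E2.
have [t] := IVT ler01 fc fv.
rewrite in_itv => t01 ft.
have min_r (q q' : R) : Num.min q q' <= q' by rewrite ge_min lexx orbT.
have vb2 : f t <= 2 * E0 by rewrite ft; exact: min_r.
suff : f t <= E0 by rewrite ft leNgt vb.
apply: (path_level t01); first by rewrite sqrtr_gt0 n_gt0.
  by rewrite sqr_sqrtr// ltW// n_gt0.
exact: vb2.
Qed.

Let z1 := r *: u + y.

Let z1_weak w : ip w z1 + gamma * form S w z1
  = ip w u - (1 - r) * (gamma * form S w u) - gamma * ip (reaction p u) w.
Proof.
have := weak_eq w; rewrite inner_gradE_reaction// (stiffC hp u w).
rewrite /z1 [ip w (_ + _)]inner_form !formDr !formZr -!inner_form.
by move: (ip w u) (ip w y) (form S w u) (form S w y) (ip _ w) => *; lra.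
Qed.

(* Off-diagonal entries of S are nonpositive, so only the diagonal can push an
   entry down, and gamma_max makes 1 - gamma B1 - (1 - r) gamma Lam >= 0. *)
Lemma step_ge0 i : 0 <= z1 i 0.
Proof.
move: i; apply: (weak_ge0 hp g0) => w w_ge0; rewrite z1_weak.
have wu0 j : 0 <= w j 0 * u j 0 by rewrite mulr_ge0.
have wu := wsum_ge0 hp wu0; rewrite -innerE in wu.
have Sw : form S w u <= Lam * ip w u.
  rewrite formE innerE mulr_sumr; apply: ler_sum => j _.
  rewrite (bigD1 j) //= -[leRHS]addr0; apply: lerD.
    by have := ler_wpM2r (wu0 j) (level_diag lb j); move: (S j j) => *; lra.
  apply: sumr_le0 => i ij; rewrite mulrAC mulr_ge0_le0 ?mulr_ge0//.
  by apply: (stiffness_off hp); rewrite eq_sym.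
have Rw : ip (reaction p u) w <= B1 * ip w u.
  rewrite !innerE -wsumZ; apply: le_wsum => // j; rewrite mxE.
  have := ler_wpM2r (wu0 j) (level_reaction lb j u_norm energy_u).
  by move: (Vi j) beta B1 (u j 0) (w j 0) => *; lra.
case/andP: d1 => d0 _.
have dS := ler_wpM2l d0 (ler_wpM2l (ltW g0) Sw).
have gR := ler_wpM2l (ltW g0) Rw.
have dD : (1 - r) * (gamma * Lam) <= 3 * (E0 + B0) * Lam * gamma ^+ 2.
  have -> : 3 * (E0 + B0) * Lam * gamma ^+ 2
    = 3 * (gamma * E0 + gamma * B0) * (gamma * Lam) by ring.
  apply: ler_wpM2r; first by rewrite mulr_ge0 ?(level_Lam lb)// ltW.
  by case/andP: r_bd => + _; rewrite lerBlDr addrC -lerBlDr.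
have key : 0 <= (1 - (1 - r) * (gamma * Lam) - gamma * B1) * ip w u.
  apply: mulr_ge0 => //; have := level_step_B1 lb; move: dD.
  by rewrite (mulrC gamma B1); move: (3 * _ * _ * _) (_ * (gamma * Lam)) (B1 * _) => *; lra.
rewrite innerC in Rw gR; move: key dS gR; rewrite [ip w (reaction p u)]innerC.
by move: (ip (reaction p u) w) (ip w u) (form S w u) => X Y Z *; lra.
Qed.

(** Let f solve the weak equation of [z1] without the nonnegative reaction term. The maximum
    principle gives 0 <= z1 <= f entrywise, and [resolvent_contraction] gives ||f|| <= ||u|| = 1. *)
Lemma step_norm_le1 : ip z1 z1 <= 1.
Proof.
have c1r : 0 <= 1 - r <= 1 by case/andP: d1 => -> ?; apply/andP; split=> //; lra.
have [fw ff] := resolvent_contraction hp g0 u c1r.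
move: fw ff; rewrite u_norm; set f := _ - _ => fw ff; clearbody f.
have fz : forall i, 0 <= (f - z1) i 0.
  apply: (weak_ge0 hp g0) => w w0.
  rewrite [ip w _]inner_form !(formDr _ w f) !(formNr _ w z1) -!inner_form.
  rewrite mulrDr addrACA fw.
  have := z1_weak w; rewrite mulrN => zw.
  have rw : 0 <= gamma * ip (reaction p u) w.
    apply: mulr_ge0; first exact: ltW.
    rewrite innerE; apply: wsum_ge0 => // j; rewrite mxE mulr_ge0// addr_ge0//.
      by rewrite mulr_ge0 ?(potential_ge0 hp).
    by rewrite mulr_ge0 ?exprn_ge0// ltW// (interaction_gt0 hp).
  move: zw rw; move: (ip w z1) (form S w z1) (ip w u) (form S w u) => *.
  by rewrite -opprD; lra.
apply: le_trans ff; rewrite !innerE; apply: le_wsum => // i.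
have zi := step_ge0 i; have := fz i; rewrite mxE [(- z1) i 0]mxE subr_ge0 => zf.
exact: ler_pM.
Qed.

Let x_react w : ip w x + gamma * form S w x
  = (1 + (1 - r)) * ip w u - gamma * ip (reaction p u) w.
Proof.
have zw : ip w z1 = r * ip w u + ip w y by rewrite !inner_form formDr formZr.
have zs : form S w z1 = r * form S w u + form S w y by rewrite formDr formZr.
have xw : ip w x = ip w u + ip w y by rewrite !inner_form formDr.
have xs : form S w x = form S w u + form S w y by rewrite formDr.
have := z1_weak w; rewrite zw zs xw xs.
move: (ip w u) (ip w y) (form S w u) (form S w y) (ip (reaction p u) w).
by move=> X1 X2 X3 X4 X5 *; lra.
Qed.

Let xi_bd : xi <= 13 / 100 /\ a * xi + c <= 3 * (e + c).
Proof.
pose Ax := - lapM p *m x.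
apply: (@resolvent_bound _ a xi e c (1 - r) (gamma ^+ 2 * ip (reaction p u) Ax)
  (gamma ^+ 2 * ip Ax Ax) (gamma * form S u x)) => //.
- by rewrite mulr_ge0 ?sqr_ge0 ?(inner_ge0 hp).
- have := ler_wpM2l (sqr_ge0 gamma) (react_pair Ax).
  by rewrite -exprMn mulrA -expr2 mulrCA.
have e1 : ip Ax x = form S x x by rewrite innerC inner_lap.
have e2 : ip Ax u = form S u x by rewrite innerC inner_lap.
have e3 : form S Ax x = ip Ax Ax by rewrite -inner_lap.
have := congr1 (fun q => gamma * q) (x_react Ax); rewrite e1 e2 e3 xiE /=.
move: (form S x x) (form S u x) (ip Ax Ax) (ip (reaction p u) Ax) => X Y Z T.
by move=> *; lra.
Qed.

Let rho := lpnorm p 2 z1.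
Let v := rho^-1 *: z1.

Let rho_sqr : rho ^+ 2 = n 1.
Proof.
rewrite /rho l2_sqr// /z1 !inner_form !formL -!inner_form u_norm (innerC p y u).
by rewrite -/s -hE /n; ring.
Qed.

(** The radial part of [z1] is r + s = 1 - gamma lambda(u) - b by [sE]. Here gamma lambda(u) + b =
    gamma <A u, x> + gamma <reaction(u), u> is at most a xi + c, so the lower bound on the norm
    reproduces itself without accumulating. *)
Let rho_ge : 1 - 3 * (e + c) <= rho.
Proof.
have [_ xb] := xi_bd; apply: (@le_trans _ _ (r + s)); last first.
  apply: ler_of_sqr; first exact: lpnorm_ge0.
  by rewrite rho_sqr /n mul1r expr1n mul1r lerDl sqr_ge0.
have lam : gamma * lambda p u + b = gamma * form S u x
    + gamma * ip (reaction p u) u.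
  have <- : ip (gradE p u) u = lambda p u by [].
  by rewrite inner_gradE_reaction// /x formDr /b; ring.
have f1 : gamma * form S u x <= a * xi.
  by apply: le_trans (ler_norm _) _; exact: gSb.
have f2 : gamma * ip (reaction p u) u <= c.
  apply: ler_of_sqr => //; have := react_pair u; rewrite u_norm mulr1.
  exact.
have := sE; rewrite /res; move: lam xb f1 f2.
move: (gamma * lambda p u) (gamma * form S u x) (gamma * ip _ _) (a * xi).
by move: s b e c => s' b' e' c' *; lra.
Qed.

Let rho_le1 : rho <= 1.
Proof.
apply: ler_of_sqr; first exact: ler01.
by rewrite expr1n /rho l2_sqr// step_norm_le1.
Qed.

Let rho_gt0 : 0 < rho.
Proof. by apply: lt_le_trans rho_ge; move: ec; lra. Qed.

Let t01 : (0 : R) <= (1 : R) <= (1 : R). Proof. by rewrite ler01 lexx. Qed.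

Let rhoE : rho ^+ 2 = (r + 1 * s) ^+ 2 + 1 ^+ 2 * h ^+ 2.
Proof. exact: rho_sqr. Qed.

Let vE : v = rho^-1 *: (r *: u + 1 *: y). Proof. by rewrite scale1r. Qed.

Let energy_v : energy p v <= E0.
Proof.
have pv : path 1 = v.
  by rewrite /path -rho_sqr sqrtr_sqr (gtr0_norm rho_gt0) scale1r.
by have := endpoint_level; rewrite pv.
Qed.

Let v_norm : ip v v = 1.
Proof. by rewrite vE (path_norm rho_gt0 rhoE). Qed.

Let v_ge0 i : 0 <= v i 0.
Proof. by rewrite mxE mulr_ge0 ?invr_ge0 ?(ltW rho_gt0)// step_ge0. Qed.

Let tau := 1 / rho.
Let sg := (r + 1 * s) / rho - 1.
Let cc := sg - tau * s.
Let w := v - u.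

Let tau_bd : 1 <= tau <= 41 / 40.
Proof.
have tau1 : 1 <= tau by rewrite /tau (ler_pdivlMr _ _ rho_gt0) mul1r.
rewrite tau1 /tau (ler_pdivrMr _ _ rho_gt0).
by have := rho_ge; move: ec; lra.
Qed.

Let geometry : sg <= 0 /\ - 2 * sg <= 26 / 25 * (tau ^+ 2 * h ^+ 2).
Proof.
have sh : s ^+ 2 + h ^+ 2 <= 1 / 60 by have := sqr_ge0 k; move: Q; lra.
by have [_ sg0 sg1] := path_geometry r1 t01 s1 sh rho_gt0 rhoE.
Qed.

Let ww : ip w w = - 2 * sg.
Proof. by rewrite /w vE (path_norm_increment rho_gt0 rhoE). Qed.

Let drift : `|cc| <= tau * (`|s| + h / 13).
Proof. exact: (path_drift t01 rho_gt0 rhoE). Qed.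

Let nl_bound : `|gamma * ip w (reaction_sum p v u)| <= 1 / 32 * (51 / 50 * (tau * h)).
Proof.
have tau0 : 0 <= tau by case/andP: tau_bd => t1 _; exact: le_trans t1.
have th0 := mulr_ge0 tau0 h0.
apply: norm_ler_of_sqr; first by move: (tau * h) th0 => *; lra.
have := inner_CauchySchwarz hp w (reaction_sum p v u).
have := level_sum lb v_ge0 u_ge0 v_norm u_norm energy_v energy_u.
move=> sb; have w0 := inner_ge0 hp w.
move=> /le_trans /(_ (ler_wpM2l w0 sb)); rewrite ww => H.
have := ler_wpM2l (sqr_ge0 gamma) H; rewrite -exprMn => /le_trans; apply.
have -> : gamma ^+ 2 * (- 2 * sg * (4 * B0) ^+ 2) = 16 * c ^+ 2 * (- 2 * sg).
  by rewrite /c; ring.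
have c2 : 16 * c ^+ 2 <= 1 / 1024.
  by case/andP: c1 => cp cl; have := ler_pM cp cp cl cl; lra.
have [sg0 sg1] := geometry.
have sg2 : 0 <= - 2 * sg by move: sg sg0 => *; lra.
have c20 : 0 <= 16 * c ^+ 2 by have := sqr_ge0 c; lra.
apply: le_trans (ler_pM c20 sg2 c2 sg1) _.
have -> : tau ^+ 2 * h ^+ 2 = (tau * h) ^+ 2 by rewrite [in RHS]exprMn.
by move: (tau * h) => X; have := sqr_ge0 X; lra.
Qed.

Let res' := rho - 1 + gamma * lambda p v.

(** By [sE] the old residual cancels: res' = -(sg rho) - b + gamma (lambda(v) - lambda(u)), and
    [lambda_diff] expands the last difference. *)
Let res'_bound : `|res'| <= 4 / 25 * k + `|s| / 30 + h / 9.
Proof.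
have [sg0 sg1] := geometry; have [xib _] := xi_bd.
have xi1 : 0 <= xi <= 13 / 100 by rewrite xi0.
have bx : `|b + k ^+ 2| <= xi * k.
  by rewrite kE /b -mulrDr -formDl; exact: gSb.
have rho01 : 0 < rho <= 1 by rewrite rho_gt0.
have := residual_bound a1 k1 bk h1 s1 tau_bd rho01 sg0 sg1 drift xi1 bx nl_bound.
have -> : tau ^+ 2 * k ^+ 2 + 2 * (tau * cc) * b + cc ^+ 2 * a ^+ 2
    = gamma * form S w w.
  by rewrite /w vE -(path_stiff2 1 rho_gt0).
have -> : tau * b + cc * a ^+ 2 = gamma * form S u w.
  by rewrite /w vE -(path_stiff 1 rho_gt0).
have -> // : - (sg * rho) - b + 2 * (gamma * form S u w) + gamma * form S w w
    + gamma * ip w (reaction_sum p v u) = res'.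
have rho_neq0 : rho != 0 by rewrite gt_eqF.
have -> : sg * rho = r + s - rho by rewrite /sg; field.
have := lambda_diff hp u w; rewrite /w subrKC -/w /res' => ld.
have -> : lambda p v = lambda p u + (2 * form S u w + form S w w
    + ip w (reaction_sum p v u)) by rewrite -ld subrKC.
have := sE; rewrite /res; move: (lambda p u) (form S u w) (form S w w) (ip w _).
by move: s b rho r gamma => s' b' rho' r' g' *; lra.
Qed.

(** The first three conclusions restore the hypotheses on [u] and [r] for the next step; the last
    one is the quantitative drop. *)
Theorem merit_descent :
  [/\ forall i, 0 <= v i 0, ip v v = 1,
      1 - 3 * (gamma * E0 + gamma * B0) <= rho <= 1
    & energy p v + res' ^+ 2 / gamma <= energy p u + res ^+ 2 / gamma
        - (1 / 2 * res ^+ 2 + 1 / 4 * (ip y y + gamma * form S y y)) / gamma].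
Proof.
split=> //; first by rewrite rho_ge.
have E2 : energy p v <= 2 * E0.
  by apply: le_trans energy_v _; rewrite ler_peMl ?ler1n ?(ltW (level_E0 lb)).
rewrite vE in E2; have := path_energy t01 rho_gt0 rhoE E2; rewrite -vE => drop.
have := energy_drop_step res tau_bd h0 k0 res'_bound.
rewrite hE kE => step.
rewrite -(ler_pM2l g0).
have -> : gamma * (energy p v + res' ^+ 2 / gamma)
  = gamma * energy p v + res' ^+ 2 by field; rewrite gt_eqF.
have -> : gamma * (energy p u + res ^+ 2 / gamma
    - (1 / 2 * res ^+ 2 + 1 / 4 * (ip y y + gamma * form S y y)) / gamma)
  = gamma * energy p u + 1 / 2 * res ^+ 2
    - 1 / 4 * (ip y y + gamma * form S y y) by field; rewrite gt_eqF.
by rewrite mulrBr in drop; exact: ler_add_drop drop step.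
Qed.

End Step.

(** * Critical points on the sphere and uniqueness of the nonnegative one *)

Section Critical.
Context (R : realType) (N : nat) (p : gp_problem R N) (hp : admissible p).
Implicit Types (u v w e : 'cV[R]_N).

Local Notation W := (wsum p).
Local Notation S := (stiffness p).
Local Notation ip := (inner p).
Local Notation beta := (interaction p).
Local Notation Vi i := (potential p 0 i).

Definition sphere_grad u : 'cV[R]_N := gradE p u - lambda p u *: u.

Lemma inner_sphere_grad u w :
  ip (sphere_grad u) w = ip (gradE p u) w - lambda p u * ip u w.
Proof. by rewrite /sphere_grad !inner_form formDl formNl formZl. Qed.

Lemma sphere_grad_orth u : ip u u = 1 -> ip u (sphere_grad u) = 0.
Proof.
by move=> u1; rewrite innerC inner_sphere_grad u1 mulr1 /lambda subrr.
Qed.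

Definition critical u := ip u u = 1 /\ sphere_grad u = 0.

Lemma critical_grad u : critical u ->
  forall w, ip (gradE p u) w = lambda p u * ip u w.
Proof.
move=> [_ Pu] w; apply/eqP; rewrite -subr_eq0 -inner_sphere_grad Pu.
by rewrite inner_form form0l.
Qed.

Lemma critical_stiff u w : critical u -> form S w u
  = W (fun i => w i 0 * ((lambda p u - Vi i - beta * u i 0 ^+ 2) * u i 0)).
Proof.
move=> uc; have := critical_grad uc w; rewrite inner_gradE_reaction//.
rewrite (stiffC hp) => /(canRL (addrK _)) ->; rewrite !innerE -wsumZ -wsumN -wsumD.
by apply: eq_wsum => i; rewrite mxE; ring.
Qed.

(* Row i of the equation at a zero u_i reads sum_(j != i) S_ij u_j = 0 with all
   terms nonpositive, so the zero set is closed under adjacency. *)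
Lemma critical_gt0 u : critical u -> (forall i, 0 <= u i 0) ->
  forall i, 0 < u i 0.
Proof.
move=> uc u_ge0 i; rewrite lt_def u_ge0 andbT; apply/eqP => ui0.
have nbr j l : S j l != 0 -> u j 0 = 0 -> u l 0 = 0.
  move=> Sjl uj0; pose d : 'cV[R]_N := delta_mx j 0.
  have Su : \sum_m S j m * u m 0 = 0.
    have dS : form S d u = \sum_m S j m * u m 0.
      rewrite formE (bigD1 j) //= addrC big1 => [|q qj]; last first.
        by apply: big1 => m _; rewrite /d mxE (negbTE qj) !mul0r.
      by rewrite add0r; apply: eq_bigr => m _; rewrite /d mxE !eqxx mul1r.
    rewrite -dS.
    rewrite critical_stiff// /wsum big1// => m _; rewrite /d mxE eqxx andbT.
    by have [->|_] := eqVneq m j; rewrite ?uj0 ?mulr0 ?mul0r ?mulr0.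
  have neg m : S j m * u m 0 <= 0.
    have [<-|jm] := eqVneq j m; first by rewrite uj0 mulr0.
    by rewrite mulr_le0_ge0 ?(stiffness_off hp).
  have : - (\sum_m S j m * u m 0) == 0 by rewrite Su oppr0.
  rewrite -sumrN psumr_eq0 => [/allP/(_ l)|m _]; last by rewrite oppr_ge0.
  rewrite mem_index_enum => /(_ isT) /=.
  by rewrite oppr_eq0 mulf_eq0 (negbTE Sjl) => /eqP.
have symS j l : S j l = S l j by rewrite -{1}(stiffness_sym hp) mxE.
have cl : fingraph.closed (fun i' j' => S i' j' != 0) [pred j | u j 0 == 0].
  move=> j l /= Sjl; rewrite !inE; apply/eqP/eqP; first exact: nbr Sjl.
  by rewrite symS in Sjl; exact: nbr Sjl.
have [/eqP] := uc; suff -> : u = 0 by rewrite inner_form form0l eq_sym oner_eq0.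
apply/colP => j; rewrite mxE; apply/eqP.
have := closed_connect cl (stiffness_irr hp i j); rewrite !inE => <-.
exact/eqP.
Qed.

(* Picone: 2 (S w w - S (w^2/u) u) is the sum of the terms
   - S_ij (w_i u_j - w_j u_i)^2 / (u_i u_j). *)
Lemma picone u w : (forall i, 0 < u i 0) ->
  form S (\col_i (w i 0 ^+ 2 / u i 0)) u <= form S w w.
Proof.
move=> u_gt0; set q := \col_i _.
suff : 0 <= 2 * form S w w - form S q u - form S u q.
  rewrite (stiffC hp u q); lra.
rewrite !formE mulr_sumr -!sumrB; apply: sumr_ge0 => i _.
rewrite mulr_sumr -!sumrB; apply: sumr_ge0 => j _; rewrite !mxE.
have ui : u i 0 != 0 by rewrite gt_eqF.
have uj : u j 0 != 0 by rewrite gt_eqF.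
have [<-|ij] := eqVneq i j.
  suff -> : 2 * (w i 0 * S i i * w i 0) - w i 0 ^+ 2 / u i 0 * S i i * u i 0
    - u i 0 * S i i * (w i 0 ^+ 2 / u i 0) = 0 by [].
  by field.
have -> : 2 * (w i 0 * S i j * w j 0) - w i 0 ^+ 2 / u i 0 * S i j * u j 0
    - u i 0 * S i j * (w j 0 ^+ 2 / u j 0)
  = - S i j * ((w i 0 * u j 0 - w j 0 * u i 0) ^+ 2 / (u i 0 * u j 0)).
  by field; rewrite ui uj.
apply: mulr_ge0; first by rewrite oppr_ge0 (stiffness_off hp).
by rewrite divr_ge0 ?sqr_ge0// mulr_ge0 ?ltW.
Qed.

(** Quadratic form of the linear operator A + V + beta u^2 - lambda(u), with the density u^2
    frozen. *)
Definition linearized u w : R := form S w w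
  + W (fun i => (Vi i + beta * u i 0 ^+ 2) * w i 0 ^+ 2) - lambda p u * ip w w.

Lemma linearized_ge0 u w : critical u -> (forall i, 0 < u i 0) ->
  0 <= linearized u w.
Proof.
move=> uc u_gt0; have := picone w u_gt0; rewrite critical_stiff//.
rewrite /linearized innerE -wsumZ -addrA -wsumN -wsumD.
set a := W _; set b := W _; suff -> : b = - a by lra.
rewrite /a /b -wsumN; apply: eq_wsum => i; rewrite mxE.
by field; rewrite gt_eqF.
Qed.

Lemma sphere_diff u e : ip u u = 1 -> ip (u + e) (u + e) = 1 ->
  ip u e = - 2^-1 * ip e e.
Proof.
rewrite !inner_form !formL -!inner_form => ->; rewrite (innerC p e u); lra.
Qed.

(** The last sum is the squared norm of the density difference (u + e)^2 - u^2, so both terms are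
    nonnegative at a positive critical point. *)
Lemma energy_gap u e : critical u -> ip (u + e) (u + e) = 1 ->
  energy p (u + e) - energy p u = 2^-1 * linearized u e
    + beta / 4 * W (fun i => (e i 0 * (2 * u i 0 + e i 0)) ^+ 2).
Proof.
move=> uc v1; rewrite energyD// critical_grad// (sphere_diff uc.1 v1).
rewrite /linearized; set a := W _; set b := W _; set c := W _.
suff -> : a = 2^-1 * b + beta / 4 * c by ring.
by rewrite /a /b /c -!wsumZ -wsumD; apply: eq_wsum => i; field.
Qed.

(** Minimality of [v] makes the gap nonpositive, so the densities u^2 and v^2 agree; positivity
    fixes the signs. *)
Lemma critical_ground_state u v : critical u -> (forall i, 0 <= u i 0) ->
  is_ground_state p v -> u = v.
Proof.
move=> uc u_ge0 [/(sphereE hp) v1 vmin v_gt0].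
have u_gt0 := critical_gt0 uc u_ge0.
have uve : u + (v - u) = v by rewrite subrKC.
have := @energy_gap u (v - u) uc; rewrite uve => /(_ v1).
have := linearized_ge0 (v - u) uc u_gt0.
have : energy p v <= energy p u by apply: vmin; apply/(sphereE hp); exact: uc.1.
set f := linearized _ _; set g := fun i : 'I_N => _ => evu f0 gap.
have g0 i : 0 <= g i by exact: sqr_ge0.
have b0 := interaction_gt0 hp.
have Wg : W g = 0.
  apply/le_anti; rewrite (wsum_ge0 hp g0) andbT -(pmulr_rle0 _ b0).
  by move: evu f0 gap; move: (energy p v) (energy p u) (W g) => *; lra.
apply/colP => i; have /eqP := wsum_eq0 hp g0 Wg i.
rewrite /g sqrf_eq0 mulf_eq0 !mxE => /orP[|].
  by rewrite subr_eq0 => /eqP.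
have -> : 2 * u i 0 + (v i 0 - u i 0) = u i 0 + v i 0 by ring.
by rewrite gt_eqF ?addr_gt0.
Qed.

Lemma cvg_sphere_grad (T : Type) (F : set_system T) (FF : Filter F)
    (f : T -> 'cV[R]_N) (l : 'cV[R]_N) : (forall i, f x i 0 @[x --> F] --> l i 0) ->
  forall i, sphere_grad (f x) i 0 @[x --> F] --> sphere_grad l i 0.
Proof.
move=> fl i; pose A := - lapM p.
have e v : sphere_grad v i 0 = \sum_j A i j * v j 0
    + (Vi i * v i 0 + beta * v i 0 ^+ 3) - lambda p v * v i 0.
  have gE : gradE p v i 0 = (A *m v) i 0 + (Vi i * v i 0 + beta * v i 0 ^+ 3).
    rewrite /gradE mxE [(A *m v + potM p *m v) i 0]mxE potM_entry -addrA.
    by rewrite [(beta *: epow v 3) i 0]mxE epow_entry.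
  rewrite /sphere_grad mxE gE [(A *m v) i 0]mxE.
  by rewrite [(- (lambda p v *: v)) i 0]mxE [(lambda p v *: v) i 0]mxE.
under eq_fun do rewrite e; rewrite e; apply: cvgB; last first.
  by apply: cvgM; [exact: cvg_lambda | exact: fl].
apply: cvgD; first by apply: cvg_sumr => j; apply: cvgMr; exact: fl.
by apply: cvgD; apply: cvgMr; [exact: fl | exact: cvg_expr].
Qed.

Lemma cvg_sphere_grad_norm (T : Type) (F : set_system T) (FF : Filter F)
    (f : T -> 'cV[R]_N) (l : 'cV[R]_N) : (forall i, f x i 0 @[x --> F] --> l i 0) ->
  ip (sphere_grad (f x)) (sphere_grad (f x)) @[x --> F]
    --> ip (sphere_grad l) (sphere_grad l).
Proof. by move=> fl; apply: cvg_form; exact: cvg_sphere_grad. Qed.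

Lemma trmx_cvg (v : 'rV[R]_N) i : ((w^T : 'cV[R]_N) i 0) @[w --> v] --> v^T i 0.
Proof.
under eq_fun do rewrite mxE; rewrite mxE; exact: coord_continuous.
Qed.

Lemma continuous_form_trmx (B : 'M[R]_N) (g : 'cV[R]_N) :
  continuous (fun v : 'rV[R]_N => form B (v^T - g) (v^T - g)).
Proof.
move=> v; have sub i : (fun w : 'rV[R]_N => (w^T - g) i 0) @ v --> (v^T - g) i 0.
  have e : (fun w : 'rV[R]_N => (w^T - g) i 0) =1 (fun w : 'rV[R]_N => w 0 i - g i 0).
    by move=> w; rewrite !mxE.
  have ev : (v^T - g) i 0 = v 0 i - g i 0 by rewrite !mxE.
  rewrite (funext e) ev.
  apply: (@cvgB _ _ _ (nbhs v) _ (fun w : 'rV[R]_N => w 0 i) (fun=> g i 0)).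
    exact: coord_continuous.
  exact: cvg_cst.
exact: (cvg_form (nbhs_filter v) sub sub).
Qed.

Lemma continuous_sphere_grad_trmx :
  continuous (fun v : 'rV[R]_N => ip (sphere_grad v^T) (sphere_grad v^T)).
Proof.
move=> v; exact: (cvg_sphere_grad_norm (nbhs_filter v) (fun i => @trmx_cvg v i)).
Qed.

(** Minimizes the gradient norm over nonnegative unit vectors outside a ball about [g]; with
    [eps = 0] nothing is excluded. *)
Lemma nonneg_sphere_minimum (g : 'cV[R]_N) (eps : R) :
  (exists v : 'cV[R]_N, [/\ forall i, 0 <= v i 0, ip v v = 1 & eps <= ip (v - g) (v - g)]) ->
  (0 < N)%N ->
  exists c : 'cV[R]_N, [/\ forall i, 0 <= c i 0, ip c c = 1, eps <= ip (c - g) (c - g)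
    & forall v : 'cV[R]_N, (forall i, 0 <= v i 0) -> ip v v = 1 ->
        eps <= ip (v - g) (v - g) ->
        ip (sphere_grad c) (sphere_grad c) <= ip (sphere_grad v) (sphere_grad v)].
Proof.
move=> [v0 [v00 v01 v0g]] N0.
pose C := [set v : 'cV[R]_N | [/\ forall i, 0 <= v i 0, ip v v = 1
  & eps <= ip (v - g) (v - g)]].
have [||||c [c0 c1 cg] cmin] := @sphere_minimum R N p hp N0 C
  (fun v => ip (sphere_grad v) (sphere_grad v)).
- by exists v0.
- by move=> v [].
- have -> : [set v : 'rV[R]_N | C v^T]
      = (\bigcap_(i in [set: 'I_N]) ((fun v : 'rV[R]_N => v^T i 0) @^-1` [set t | 0 <= t]))
        `&` ((fun v : 'rV[R]_N => ip v^T v^T) @^-1` [set 1])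
        `&` ((fun v : 'rV[R]_N => ip (v^T - g) (v^T - g)) @^-1` [set t | eps <= t]).
    apply/seteqP; split=> v /=.
      by case=> h1 h2 h3; split; [split; [move=> i _; exact: h1 | exact: h2]|].
    case=> [[h1 h2] h3]; split; [|exact: h2|exact: h3].
    by move=> i; exact: (h1 i I).
  apply: closedI; [apply: closedI|].
  + apply: closed_bigI => i _; apply: preimage_closed; last exact: closed_ge.
    by move=> v _; exact: trmx_cvg.
  + apply: preimage_closed; last exact: closed_eq.
    have -> : (fun v : 'rV[R]_N => ip v^T v^T)
        = (fun v : 'rV[R]_N => form (massM p) (v^T - 0) (v^T - 0)).
      by apply/funext => v; rewrite subr0.
    by move=> v _; exact: continuous_form_trmx.
  + apply: preimage_closed; last exact: closed_ge.
    by move=> v _; exact: continuous_form_trmx.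
- exact: continuous_sphere_grad_trmx.
by exists c; split=> // v h1 h2 h3; exact: cmin.
Qed.

End Critical.

(** * Largest eigenvalue and the minimum of the Hessian form *)

Section Spectral.
Context (R : realType) (N : nat) (p : gp_problem R N) (hp : admissible p).
Implicit Types (u v w : 'cV[R]_N).

Local Notation W := (wsum p).
Local Notation S := (stiffness p).
Local Notation ip := (inner p).
Local Notation beta := (interaction p).
Local Notation Vi i := (potential p 0 i).

Lemma closed_sphere : closed [set v : 'rV[R]_N | ip v^T v^T = 1].
Proof.
have -> : [set v : 'rV[R]_N | ip v^T v^T = 1]
    = (fun v : 'rV[R]_N => form (massM p) (v^T - 0) (v^T - 0)) @^-1` [set x | x = 1].
  by apply/seteqP; split=> v /=; rewrite subr0.
by apply: preimage_closed; [move=> v _; exact: continuous_form_trmx | exact: closed_eq].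
Qed.

Lemma continuous_quadratic (B : 'M[R]_N) :
  continuous (fun v : 'rV[R]_N => form B v^T v^T).
Proof.
have -> : (fun v : 'rV[R]_N => form B v^T v^T)
    = (fun v : 'rV[R]_N => form B (v^T - 0) (v^T - 0)).
  by apply/funext => v; rewrite subr0.
exact: continuous_form_trmx.
Qed.

Lemma sphere_scale v : v != 0 -> exists w c, [/\ ip w w = 1, 0 < c & v = c *: w].
Proof.
move=> v0; have n0 := inner_gt0 hp v0; set c := Num.sqrt (ip v v).
have c0 : 0 < c by rewrite sqrtr_gt0.
exists (c^-1 *: v), c; split=> //; last by rewrite scalerA mulfV ?gt_eqF// scale1r.
rewrite inner_form formZl formZr -inner_form mulrA -invfM -expr2 sqr_sqrtr ?ltW//.
by rewrite mulVf ?gt_eqF.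
Qed.

Lemma massM_lapM : massM p *m (- lapM p) = S.
Proof. by rewrite /lapM opprK mulmxA mulmxV ?mul1mx ?massM_unit. Qed.

Lemma row_form_inj (a b : 'rV[R]_N) :
  (forall h : 'cV[R]_N, (a *m h) 0 0 = (b *m h) 0 0) -> a = b.
Proof.
move=> ab; apply/rowP => j; have := ab (delta_mx j 0).
by rewrite -!colE !mxE.
Qed.

Lemma largest_eigenvalue v0 : (0 < N)%N -> ip v0 v0 = 1 ->
  exists mu, [/\ is_largest_eigenvalue (- lapM p) mu, 0 <= mu
    & forall v, form S v v <= mu * ip v v].
Proof.
move=> N0 v01.
have [||c c1 cmax] := @sphere_minimum R N p hp N0 [set v | ip v v = 1]
  (fun v => form (- S) v v) _ _ closed_sphere (@continuous_quadratic (- S)).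
- by exists v0.
- by [].
have formN v w : form (- S) v w = - form S v w.
  by rewrite /form mulmxN mulNmx mxE.
set mu := form S c c; have mu0 : 0 <= mu by exact: stiffness_psd.
have ray v : form S v v <= mu * ip v v.
  have [->|/sphere_scale[w [a [w1 a0 ->]]]] := eqVneq v 0.
    by rewrite inner_form !form0l mulr0.
  have -> : form S (a *: w) (a *: w) = a ^+ 2 * form S w w by rewrite !formL; ring.
  have -> : ip (a *: w) (a *: w) = a ^+ 2.
    by rewrite inner_form !formL -inner_form w1; ring.
  have := cmax w w1; rewrite !formN lerN2 -/mu => Sw.
  by rewrite mulrC; apply: ler_wpM2r; rewrite ?sqr_ge0.
(* The form mu M - S is nonnegative and vanishes at the maximizer [c], so by Cauchy-Schwarz [c] lies
   in its kernel. *)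
have crit h : form S c h = mu * ip c h.
  have symB : (mu *: massM p - S)^T = mu *: massM p - S.
    by rewrite linearB /= linearZ /= massM_sym (stiffness_sym hp).
  have BE v w : form (mu *: massM p - S) v w = mu * ip v w - form S v w.
    by rewrite /form mulmxBr mulmxBl mxE -scalemxAr -scalemxAl mxE [in X in _ + X]mxE.
  have psdB w : 0 <= form (mu *: massM p - S) w w by rewrite BE subr_ge0.
  have := form_CauchySchwarz c h symB psdB.
  rewrite !BE c1 mulr1 subrr mul0r => H; apply/esym/eqP; rewrite -subr_eq0 -sqrf_eq0.
  by rewrite eq_le H sqr_ge0.
exists mu; split=> //; split.
  (* Eigenvectors are row vectors acting from the left, hence the transposed mass matrix times
     [c]. *)
  apply/eigenvalueP; exists (massM p *m c)^T.
    rewrite trmx_mul massM_sym -mulmxA massM_lapM; apply: row_form_inj => h.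
    by rewrite -scalemxAl [RHS]mxE; exact: crit.
  apply/eqP => /(congr1 trmx); rewrite trmxK trmx0 => Mc0.
  by have /eqP := c1; rewrite /inner -mulmxA Mc0 mulmx0 mxE eq_sym oner_eq0.
move=> a /eigenvalueP[v vA v_neq0].
have [w Mw] : exists w, massM p *m w = v^T.
  by exists (invmx (massM p) *m v^T); rewrite mulKVmx ?massM_unit.
have vw : v = w^T *m massM p by rewrite -[v]trmxK -Mw trmx_mul massM_sym.
have w0 : w != 0.
  by apply: contra_neq v_neq0 => w0; rewrite vw w0 trmx0 mul0mx.
have Sw : form S w w = a * ip w w.
  by rewrite /form -massM_lapM mulmxA -vw vA -scalemxAl [LHS]mxE /inner -vw.
by have := ray w; rewrite Sw ler_pM2r// (inner_gt0 hp).
Qed.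

(** Cauchy-Schwarz for S: ||A v||^4 = S(v, A v)^2 <= S(v, v) S(A v, A v) <= S(v, v) mu ||A v||^2. *)
Lemma lap_sqr_le mu v : 0 <= mu -> (forall v, form S v v <= mu * ip v v) ->
  ip (- lapM p *m v) (- lapM p *m v) <= mu * form S v v.
Proof.
move=> mu0 ray; set Av := - lapM p *m v; have n0 := inner_ge0 hp Av.
have [->|n_neq0] := eqVneq (ip Av Av) 0; first by rewrite mulr_ge0 ?stiffness_psd.
have n_gt0 : 0 < ip Av Av by rewrite lt_def n_neq0.
have := stiff_CauchySchwarz hp v Av.
rewrite -[form S v Av](stiffC hp) -[form S Av v]inner_lap// -/Av => cs.
have := le_trans cs (ler_wpM2l (stiffness_psd hp v) (ray Av)).
by rewrite expr2 mulrCA mulrA ler_pM2r.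
Qed.

Definition hess u w : R := linearized p u w
  + 2 * beta * W (fun i => u i 0 ^+ 2 * w i 0 ^+ 2).

Lemma hessian_form u w : ip w (hessian p u *m w) = hess u w.
Proof.
have -> : hessian p u *m w = - lapM p *m w
    + (potM p *m w + (3 * beta) *: (diag_mx (epow u 2)^T *m w)) - lambda p u *: w.
  by rewrite /hessian mulmxBl !mulmxDl mul_scalar_mx -scalemxAl addrA.
rewrite inner_form !(formDr, formNr, formZr) -!inner_form inner_lap//.
have e : ip w (potM p *m w) + 3 * beta * ip w (diag_mx (epow u 2)^T *m w)
    = W (fun i => (Vi i + beta * u i 0 ^+ 2) * w i 0 ^+ 2)
      + 2 * beta * W (fun i => u i 0 ^+ 2 * w i 0 ^+ 2).
  rewrite !innerE -!wsumZ -!wsumD; apply: eq_wsum => i.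
  by rewrite potM_entry mul_diag_mx !mxE; ring.
by rewrite e /hess /linearized; ring.
Qed.

Lemma hessian_minimum u : (2 <= N)%N -> (forall i, 0 < u i 0) ->
  exists nu, is_minimum (hessian_values p u) nu
    /\ forall w, ip u w = 0 -> nu * ip w w <= hess u w.
Proof.
move=> N2 u_gt0; have N0 : (0 < N)%N by exact: leq_trans N2.
pose i0 : 'I_N := Ordinal N0; pose i1 : 'I_N := Ordinal N2.
pose C := [set w | ip w w = 1 /\ ip u w = 0].
have Cne : C !=set0.
  have ud i : ip u (delta_mx i 0) = weight p 0 i * u i 0.
    rewrite innerE /wsum (bigD1 i) //= big1 ?addr0 => [|j ji].
      by rewrite mxE !eqxx mulr1.
    by rewrite mxE (negbTE ji) !mulr0.
  (* N >= 2 provides two coordinate vectors, whose combination gives a nonzero tangent vector. *)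
  pose w : 'cV[R]_N := ip u (delta_mx i1 0) *: delta_mx i0 0
    - ip u (delta_mx i0 0) *: delta_mx i1 0.
  have w_neq0 : w != 0.
    apply/eqP => /colP/(_ i0); rewrite !mxE !eqxx /= mulr0 subr0 mulr1 ud.
    by apply/eqP; rewrite mulf_neq0// gt_eqF ?(weight_gt0 hp).
  have uw : ip u w = 0.
    by rewrite [LHS]inner_form formDr formNr !formZr -!inner_form mulrC subrr.
  have [w' [c [w1 c0 wc]]] := sphere_scale w_neq0; exists w'; split=> //.
  apply/eqP; move/eqP: uw; rewrite wc inner_form formZr mulf_eq0 => /orP[/eqP c00|//].
  by rewrite c00 ltxx in c0.
have Ccl : closed [set v : 'rV[R]_N | C v^T].
  have -> : [set v : 'rV[R]_N | C v^T] = [set v : 'rV[R]_N | ip v^T v^T = 1]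
      `&` ((fun v : 'rV[R]_N => ip u v^T) @^-1` [set t | t = 0]) by [].
  apply: closedI; first exact: closed_sphere.
  apply: preimage_closed; last exact: closed_eq.
  move=> v _; exact: (cvg_form (nbhs_filter v) (fun i => cvg_cst (u i 0))
    (fun i => @trmx_cvg R N v i)).
have fct := @continuous_quadratic (massM p *m hessian p u).
have C1 v : C v -> ip v v = 1 by case.
have [c [c1 uc] cmin] := @sphere_minimum R N p hp N0 C
  (fun w => form (massM p *m hessian p u) w w) Cne C1 Ccl fct.
have hessE w : form (massM p *m hessian p u) w w = hess u w.
  by rewrite -hessian_form /inner /form !mulmxA.
exists (hess u c); split.
  split; first by exists c; split=> //; [apply/(sphereE hp) | rewrite hessian_form].
  move=> t [w [/(sphereE hp) w1 uw ->]]; rewrite hessian_form -!hessE.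
  exact: cmin.
move=> w uw; have [->|/sphere_scale[w' [a [w1 a0 wE]]]] := eqVneq w 0.
  by rewrite -!hessE inner_form !form0l mulr0.
have uw' : ip u w' = 0.
  apply/eqP; move/eqP: uw; rewrite wE inner_form formZr mulf_eq0 => /orP[/eqP a00|//].
  by rewrite a00 ltxx in a0.
rewrite -!hessE wE inner_form !formZl !formZr -inner_form w1.
have := ler_wpM2r (mulr_ge0 (ltW a0) (ltW a0)) (cmin w' (conj w1 uw')).
by move: (form _ c c) (form _ w' w') => *; lra.
Qed.

End Spectral.

(** * Quadratic growth and gradient domination near the ground state *)

Lemma local_rate_arith (R : realFieldType) (nu m H D pe Pn : R) : 0 < nu ->
  0 <= m -> 0 <= Pn -> `|D - 2^-1 * H| <= nu * m / 160 -> 39 / 40 * (nu * m) <= H ->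
  H - 9 / 200 * (nu * m) <= pe -> pe ^+ 2 <= Pn * m ->
  nu / 4 * m <= D /\ nu * D <= Pn.
Proof.
move=> nu0 m0 Pn0; rewrite ler_norml => /andP[d1 d2] h1 p1 pP.
have nm : 0 <= nu * m := mulr_ge0 (ltW nu0) m0.
(* To leading order D = H / 2, pe = H and H >= nu m, which gives pe^2 / m >= 2 nu D; the factor 2 is
   the room for the perturbations. *)
have D1 : 12 / 25 * (nu * m) <= D by lra.
have pD : 9 / 5 * D <= pe by lra.
split; first by lra.
have D0 : 0 <= D by lra.
have p2 : (9 / 5 * D) ^+ 2 <= Pn * m.
  by apply: le_trans pP; apply: ler_sqr_norm; rewrite ger0_norm; lra.
have [D00|Dp] := eqVneq D 0; first by rewrite D00 mulr0.
have Dpos : 0 < D by rewrite lt_def Dp.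
have q1 : nu * (9 / 5 * D) ^+ 2 <= Pn * (25 / 12 * D).
  apply: (@le_trans _ _ (Pn * (nu * m))).
    by rewrite [leRHS]mulrCA; exact: ler_wpM2l (ltW nu0) _ _ p2.
  by apply: ler_wpM2l => //; lra.
rewrite -(ler_pM2r Dpos); have nD := mulr_ge0 (ltW nu0) (sqr_ge0 D); lra.
Qed.

Section Local.
Context (R : realType) (N : nat) (p : gp_problem R N) (hp : admissible p).
Context (N_gt0 : (0 < N)%N).
Implicit Types (u v w : 'cV[R]_N).

Local Notation W := (wsum p).
Local Notation S := (stiffness p).
Local Notation ip := (inner p).
Local Notation beta := (interaction p).
Local Notation Vi i := (potential p 0 i).

Lemma wsum_norm_le (f h : 'I_N -> R) : (forall i, `|f i| <= h i) -> `|W f| <= W h.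
Proof.
move=> fh; rewrite ler_norml -wsumN; apply/andP; split; apply: le_wsum => // i.
  by have := fh i; rewrite ler_norml => /andP[].
by have := fh i; rewrite ler_norml => /andP[].
Qed.

Lemma entry_sqr_le v i : v i 0 ^+ 2 <= (w_min p)^-1 * ip v v.
Proof.
rewrite ler_pdivlMl ?(w_min_gt0 hp)//.
have := @wsum_term _ _ _ hp (fun i => v i 0 ^+ 2) i (fun j => sqr_ge0 (v j 0)).
have -> : W (fun i => v i 0 ^+ 2) = ip v v.
  by rewrite innerE; apply: eq_wsum => j; rewrite expr2.
by apply: le_trans; apply: ler_wpM2r; [exact: sqr_ge0 | exact: w_min_le].
Qed.

Context (g : 'cV[R]_N) (g_crit : critical p g).
Context (nu : R) (nu_gt0 : 0 < nu).
Context (nuP : forall w, ip g w = 0 -> nu * ip w w <= hess p g w).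

Section Perturbation.
Context (e : 'cV[R]_N) (ge1 : ip (g + e) (g + e) = 1).
Let m := ip e e.
Let sg := Num.sqrt m.
Let G := (w_min p)^-1.
Context (sg_small : sg <= 1 / 20) (kap_small : beta * G * sg <= nu / 200).
Context (lam_small : `|lambda p (g + e) - lambda p g| <= nu / 20).

Let T3 := W (fun i => g i 0 * e i 0 ^+ 3).
Let T4 := W (fun i => e i 0 ^+ 4).
Let X := W (fun i => g i 0 ^+ 3 * e i 0).
Let Y := W (fun i => g i 0 ^+ 4).
Let Z := W (fun i => g i 0 ^+ 2 * e i 0 ^+ 2).
Let H := hess p g e.

Let m0 : 0 <= m. Proof. exact: inner_ge0. Qed.
Let sg0 : 0 <= sg. Proof. exact: sqrtr_ge0. Qed.
Let sgE : sg ^+ 2 = m. Proof. by rewrite sqr_sqrtr. Qed.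
Let G0 : 0 <= G. Proof. by rewrite invr_ge0 ltW// w_min_gt0. Qed.
Let g1 : ip g g = 1. Proof. exact: g_crit.1. Qed.
Let ge : ip g e = - 2^-1 * m. Proof. exact: sphere_diff. Qed.
Let b0 : 0 <= beta. Proof. exact: ltW (interaction_gt0 hp). Qed.

Let gi i : g i 0 ^+ 2 <= G.
Proof. by have := entry_sqr_le g i; rewrite g1 mulr1. Qed.

Let ei i : e i 0 ^+ 2 <= G * m. Proof. exact: entry_sqr_le. Qed.

Let gei i : `|g i 0 * e i 0| <= G * sg.
Proof.
apply: norm_ler_of_sqr; first exact: mulr_ge0.
have -> : (G * sg) ^+ 2 = G * (G * m) by rewrite -sgE; ring.
rewrite exprMn; exact: ler_pM (sqr_ge0 _) (sqr_ge0 _) (gi i) (ei i).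
Qed.

Let sumsq w : W (fun i => w i 0 ^+ 2) = ip w w.
Proof. by rewrite innerE; apply: eq_wsum => j; rewrite expr2. Qed.

Let T3b : `|T3| <= G * sg * m.
Proof.
rewrite /m -sumsq -wsumZ; apply: wsum_norm_le => i.
have -> : g i 0 * e i 0 ^+ 3 = g i 0 * e i 0 * e i 0 ^+ 2 by ring.
by rewrite normrM (ger0_norm (sqr_ge0 (e i 0))); apply: ler_wpM2r; rewrite ?sqr_ge0.
Qed.

Let T4b : 0 <= T4 <= G * m * m.
Proof.
apply/andP; split; first by apply: wsum_ge0 => // i; rewrite (exprM _ 2 2) sqr_ge0.
rewrite {2}/m -sumsq -wsumZ; apply: le_wsum => // i.
by rewrite (exprD _ 2 2); apply: ler_wpM2r; rewrite ?sqr_ge0 ?ei.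
Qed.

Let Xb : `|X| <= G * sg.
Proof.
rewrite -[leRHS]mulr1 -g1 -sumsq -wsumZ; apply: wsum_norm_le => i.
have -> : g i 0 ^+ 3 * e i 0 = g i 0 * e i 0 * g i 0 ^+ 2 by ring.
by rewrite normrM (ger0_norm (sqr_ge0 (g i 0))); apply: ler_wpM2r; rewrite ?sqr_ge0.
Qed.

Let Yb : 0 <= Y <= G.
Proof.
apply/andP; split; first by apply: wsum_ge0 => // i; rewrite (exprM _ 2 2) sqr_ge0.
rewrite -[leRHS]mulr1 -g1 -sumsq -wsumZ; apply: le_wsum => // i.
by rewrite (exprD _ 2 2); apply: ler_wpM2r; rewrite ?sqr_ge0 ?gi.
Qed.

Let gap : energy p (g + e) - energy p g = 2^-1 * H + (beta * T3 + beta / 4 * T4).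
Proof.
rewrite energy_gap// /H /hess.
have -> : W (fun i => (e i 0 * (2 * g i 0 + e i 0)) ^+ 2) = 4 * Z + 4 * T3 + T4.
  by rewrite -!wsumZ -!wsumD; apply: eq_wsum => i; ring.
by rewrite -/Z; field.
Qed.

Let slope : ip (sphere_grad p (g + e)) e = H + (3 * (beta * T3) + beta * T4)
  - (lambda p (g + e) - lambda p g) * (2^-1 * m).
Proof.
rewrite inner_sphere_grad//.
have -> : ip (g + e) e = 2^-1 * m.
  by rewrite inner_form formDl -!inner_form ge -/m; field.
suff -> : ip (gradE p (g + e)) e = H + (3 * (beta * T3) + beta * T4)
    + lambda p g * (2^-1 * m) by ring.
have cg := critical_grad g_crit e; rewrite ge inner_gradE// in cg.
rewrite inner_gradE// formDl /H /hess /linearized -/m -/Z.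
have -> : W (fun i => (Vi i * (g + e) i 0 + beta * (g + e) i 0 ^+ 3) * e i 0)
  = W (fun i => (Vi i * g i 0 + beta * g i 0 ^+ 3) * e i 0)
    + W (fun i => (Vi i + beta * g i 0 ^+ 2) * e i 0 ^+ 2)
    + (2 * beta * Z + 3 * (beta * T3) + beta * T4).
  rewrite -!wsumZ -!wsumD; apply: eq_wsum => i; rewrite [(g + e) i 0]mxE; ring.
have -> : W (fun i => (Vi i * g i 0 + beta * g i 0 ^+ 3) * e i 0)
  = lambda p g * (- 2^-1 * m) - form S g e by rewrite -cg; ring.
by field.
Qed.

(** The difference [e] of two unit vectors is not tangent, as <g, e> = -m/2. The bound [nuP] is
    applied to its tangential part [e'], and the correction is of higher order than m. *)
Let coercive : nu * (m - (2^-1 * m) ^+ 2)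
  <= H + 2 * beta * (m * X + (2^-1 * m) ^+ 2 * Y).
Proof.
pose c := - 2^-1 * m; pose e' := e - c *: g.
have ge' : ip g e' = 0.
  by rewrite /e' inner_form formDr formNr formZr -!inner_form g1 ge /c; ring.
have := nuP ge'.
have -> : ip e' e' = m - (2^-1 * m) ^+ 2.
  rewrite /e' inner_sub_sqr [ip (c *: g) e]inner_form [ip (c *: g) _]inner_form.
  by rewrite !formZl formZr -!inner_form g1 ge -/m /c; field.
suff -> : hess p g e' = H + 2 * beta * (m * X + (2^-1 * m) ^+ 2 * Y) by [].
have ce := critical_grad g_crit e; rewrite ge inner_gradE// in ce.
have cg := critical_grad g_crit g; rewrite g1 inner_gradE// in cg.
rewrite /H /hess /linearized.
have -> : ip e' e' = m - (2^-1 * m) ^+ 2.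
  rewrite /e' inner_sub_sqr [ip (c *: g) e]inner_form [ip (c *: g) _]inner_form.
  by rewrite !formZl formZr -!inner_form g1 ge -/m /c; field.
have -> : form S e' e' = form S e e - 2 * c * form S g e + c ^+ 2 * form S g g.
  by rewrite /e' !formL (stiffC hp e g); ring.
have -> : W (fun i => g i 0 ^+ 2 * e' i 0 ^+ 2) = Z - 2 * c * X + c ^+ 2 * Y.
  rewrite -!wsumZ -wsumN -!wsumD; apply: eq_wsum => i.
  by rewrite !mxE; ring.
have -> : W (fun i => (Vi i + beta * g i 0 ^+ 2) * e' i 0 ^+ 2)
  = W (fun i => (Vi i + beta * g i 0 ^+ 2) * e i 0 ^+ 2)
    - 2 * c * W (fun i => (Vi i * g i 0 + beta * g i 0 ^+ 3) * e i 0)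
    + c ^+ 2 * W (fun i => (Vi i * g i 0 + beta * g i 0 ^+ 3) * g i 0).
  rewrite -!wsumZ -wsumN -!wsumD; apply: eq_wsum => i.
  by rewrite !mxE; ring.
have -> : W (fun i => (Vi i * g i 0 + beta * g i 0 ^+ 3) * e i 0)
  = lambda p g * (- 2^-1 * m) - form S g e by rewrite -ce; ring.
have -> : W (fun i => (Vi i * g i 0 + beta * g i 0 ^+ 3) * g i 0)
  = lambda p g * 1 - form S g g by rewrite -cg; ring.
by rewrite -/Z -/m /c; field.
Qed.

(** Each of beta |T3|, beta T4, beta m X and beta m^2 Y is at most nu m / 200, so gap and slope
    follow the Hessian form closely enough for [local_rate_arith]. *)
Lemma local_estimate :
  nu / 4 * m <= energy p (g + e) - energy p g /\
  nu * (energy p (g + e) - energy p g)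
  <= ip (sphere_grad p (g + e)) (sphere_grad p (g + e)).
Proof.
set P := sphere_grad p (g + e).
have PP := inner_ge0 hp P; have cs := inner_CauchySchwarz hp P e.
have nm : 0 <= nu * m := mulr_ge0 (ltW nu_gt0) m0.
have mm : m * m <= sg * m.
  apply: ler_wpM2r => //; rewrite -sgE expr2 ler_piMl//.
  by apply: le_trans sg_small _; lra.
have mm2 : m * m <= 1 / 400 * m.
  apply: ler_wpM2r => //; rewrite -sgE expr2.
  by have := ler_pM sg0 sg0 sg_small sg_small; lra.
have km : beta * (G * sg * m) <= nu * m / 200.
  by have := ler_wpM2r m0 kap_small; lra.
have t3 : `|beta * T3| <= nu * m / 200.
  by apply: le_trans km; rewrite normrM (ger0_norm b0); exact: ler_wpM2l.
have t4 : 0 <= beta * T4 <= nu * m / 200.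
  case/andP: T4b => t40 t41; rewrite mulr_ge0//=; apply: le_trans km.
  apply: ler_wpM2l => //; apply: le_trans t41 _; rewrite -mulrA -[leRHS]mulrA.
  exact: ler_wpM2l.
have xx : beta * (m * X) <= nu * m / 200.
  apply: le_trans km; apply: ler_wpM2l => //; rewrite mulrC.
  by apply: ler_wpM2r => //; apply: le_trans Xb; exact: ler_norm.
have yy : beta * (m * m * Y) <= nu * m / 200.
  apply: le_trans km; apply: ler_wpM2l => //; case/andP: Yb => y0 y1.
  have -> : G * sg * m = sg * m * G by ring.
  exact: ler_pM (mulr_ge0 m0 m0) y0 mm y1.
have lam : (lambda p (g + e) - lambda p g) * (2^-1 * m) <= nu * m / 40.
  have := ler_wpM2r m0 (le_trans (ler_norm _) lam_small).
  by move: (lambda p (g + e) - lambda p g) => *; lra.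
have nmm : nu * (m * m) <= nu * m / 400 by have := ler_wpM2l (ltW nu_gt0) mm2; lra.
apply: (@local_rate_arith R nu m H _ _ _ nu_gt0 m0 PP _ _ _ cs).
- rewrite gap [2^-1 * H + _]addrC addrK; apply: le_trans (ler_normD _ _) _.
  case/andP: t4 => t40 t41; have -> : beta / 4 * T4 = beta * T4 / 4 by field.
  rewrite [`|beta * T4 / 4|]ger0_norm; last by move: (beta * T4) t40 => *; lra.
  by move: `|beta * T3| (beta * T4) t3 t41 nm => *; lra.
- have := coercive; rewrite -/H.
  have -> : nu * (m - (2^-1 * m) ^+ 2) = nu * m - nu * (m * m) / 4 by field.
  have -> : 2 * beta * (m * X + (2^-1 * m) ^+ 2 * Y)
    = 2 * (beta * (m * X)) + beta * (m * m * Y) / 2 by field.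
  move: (beta * (m * X)) (beta * (m * m * Y)) (nu * (m * m)) (nu * m) H xx yy nmm nm.
  by move=> *; lra.
rewrite slope; move: t3; rewrite ler_norml => /andP[t3l _]; case/andP: t4 => t40 _.
move: ((lambda p (g + e) - lambda p g) * (2^-1 * m)) lam t3l t40.
by move=> *; lra.
Qed.

End Perturbation.

Lemma local_rate : exists eps, 0 < eps /\ forall u, ip u u = 1 ->
  ip (u - g) (u - g) <= eps -> `|lambda p u - lambda p g| <= nu / 20 ->
  nu / 4 * ip (u - g) (u - g) <= energy p u - energy p g /\
  nu * (energy p u - energy p g) <= ip (sphere_grad p u) (sphere_grad p u).
Proof.
have b_gt0 := interaction_gt0 hp.
have G_gt0 : 0 < (w_min p)^-1 by rewrite invr_gt0 w_min_gt0.
have bG : 0 < beta * (w_min p)^-1 by exact: mulr_gt0.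
(* The radius that yields [sg_small] and [kap_small]; closeness of the multipliers stays a
   hypothesis. *)
pose s := Num.min (1 / 20) (nu / 200 / (beta * (w_min p)^-1)).
have s_gt0 : 0 < s.
  rewrite lt_min; apply/andP; split; first by lra.
  by apply: divr_gt0 => //; exact: divr_gt0.
exists (s ^+ 2); split=> [|u u1 eb lb]; first by rewrite exprn_gt0.
have ue : g + (u - g) = u by rewrite subrKC.
have ss : Num.sqrt (ip (u - g) (u - g)) <= s.
  by apply: ler_of_sqr (ltW s_gt0) _; rewrite sqr_sqrtr ?(inner_ge0 hp).
move: ss; rewrite le_min => /andP[ss1 ss2].
have := @local_estimate (u - g); rewrite ue; apply=> //.
by rewrite mulrC -ler_pdivlMr.
Qed.

End Local.

(** * Convergence of the iteration and the linear rate *)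

Section Iteration.
Context (R : realType) (N : nat) (p : gp_problem R N) (hp : admissible p).
Context (gamma E0 B0 B1 L0 Vs Lam : R).
Context (lb : level_bounds p gamma E0 B0 B1 L0 Vs Lam).
Context (N_ge2 : (2 <= N)%N) (z u x : nat -> 'cV[R]_N) (g : 'cV[R]_N).

Local Notation S := (stiffness p).
Local Notation ip := (inner p).
Local Notation beta := (interaction p).
Local Notation merit_at k := (merit p gamma (z k) (u k)).
Local Notation res k := (residual p gamma (z k) (u k)).

Context (z0_ge0 : forall i, 0 <= z 0%N i 0) (z0_norm : lpnorm p 2 (z 0%N) = 1).
Context (merit0 : merit_at 0%N <= E0).
Context (uE : forall k, u k = (lpnorm p 2 (z k))^-1 *: z k).
Context (xE : forall k, x k = invmx (1%:M - gamma *: lapM p)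
  *m (2 *: u k - z k - gamma *: (potM p *m u k + beta *: epow (u k) 3))).
Context (zE : forall k, z k.+1 = z k + x k - u k).
Context (gs : is_ground_state p g).

Let g0 : 0 < gamma := level_gamma lb.
Let N_gt0 : (0 < N)%N. Proof. exact: leq_trans N_ge2. Qed.

Definition iterate_inv k := [/\ forall i, 0 <= u k i 0, ip (u k) (u k) = 1,
  1 - 3 * (gamma * E0 + gamma * B0) <= lpnorm p 2 (z k) <= 1,
  z k = lpnorm p 2 (z k) *: u k & merit_at k <= E0].

Definition step_size k := ip (x k - u k) (x k - u k)
  + gamma * form S (x k - u k) (x k - u k).

Lemma step_size_ge0 k : 0 <= step_size k.
Proof.
by rewrite addr_ge0 ?(inner_ge0 hp)// mulr_ge0 ?(stiffness_psd hp)// ltW.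
Qed.

Lemma iterate_weak k : z k = lpnorm p 2 (z k) *: u k -> forall w,
  ip w (x k - u k) + gamma * form S w (x k - u k)
  = (1 - lpnorm p 2 (z k)) * ip w (u k) - gamma * ip (gradE p (u k)) w.
Proof.
set r := lpnorm p 2 (z k) => zr w; have := resolvent_weak hp g0 (xE k) w.
have -> : potM p *m u k + beta *: epow (u k) 3 = reaction p (u k).
  apply/colP => i; rewrite [RHS]mxE [LHS]mxE potM_entry.
  by rewrite [(beta *: epow (u k) 3) i 0]mxE epow_entry.
rewrite {1}zr inner_gradE_reaction// (stiffC hp (u k) w) (innerC p _ w).
rewrite !inner_form !(formDr, formNr, formZr) -!inner_form.
move: (ip w (x k)) (form S w (x k)) (ip w (u k)) (form S w (u k)).
by move: (ip w (reaction p (u k))) => X1 X2 X3 X4 X5 *; lra.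
Qed.

Lemma iterate_step k : iterate_inv k -> iterate_inv k.+1 /\
  merit_at k.+1 <= merit_at k - (1 / 2 * res k ^+ 2 + 1 / 4 * step_size k) / gamma.
Proof.
move=> [uk_ge0 uk1 rk zk mk].
have zk1 : lpnorm p 2 (z k) *: u k + (x k - u k) = z k.+1.
  by rewrite -zk zE addrA.
have := merit_descent hp lb uk_ge0 uk1 rk mk (iterate_weak zk).
rewrite zk1 -uE => -[v_ge0 v1 rho dec].
have dec' : merit_at k.+1
    <= merit_at k - (1 / 2 * res k ^+ 2 + 1 / 4 * step_size k) / gamma by exact: dec.
split=> //; split=> //.
  rewrite [in RHS]uE scalerA mulfV ?scale1r//; apply/eqP => l0.
  by move: v1 => /eqP; rewrite uE l0 invr0 scale0r inner_form form0l eq_sym oner_eq0.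
apply: le_trans dec' _; apply: le_trans mk; rewrite gerBl divr_ge0 ?(ltW g0)//.
exact: half_quarter_ge0 (sqr_ge0 _) (step_size_ge0 k).
Qed.

Lemma iterate_inv_all k : iterate_inv k.
Proof.
elim: k => [|k /iterate_step[]//].
have u00 : u 0%N = z 0%N by rewrite uE z0_norm invr1 scale1r.
split=> //; rewrite ?u00 ?z0_norm ?scale1r//.
- by rewrite -l2_sqr// z0_norm expr1n.
- rewrite lexx andbT gerBl mulr_ge0//.
  by rewrite addr_ge0// mulr_ge0 ?(ltW g0) ?(ltW (level_E0 lb)) ?(level_B0 lb).
Qed.

Lemma iterate_descent k :
  merit_at k.+1 <= merit_at k - (1 / 2 * res k ^+ 2 + 1 / 4 * step_size k) / gamma.
Proof. by have [] := iterate_step (iterate_inv_all k). Qed.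

Lemma merit_gap k : merit_at k - energy p g
  = energy p (u k) - energy p g + res k ^+ 2 / gamma.
Proof. by rewrite /merit addrAC. Qed.

Section Gradient.
Context (mu : R) (mu_ge0 : 0 <= mu) (ray : forall v, form S v v <= mu * ip v v).

(** Since u and P are orthogonal, the left side is ||R u + gamma P||^2 = ||y + gamma A y||^2; its
    expansion is bounded through the Rayleigh bound [ray] and [lap_sqr_le]. *)
Lemma step_size_grad k : res k ^+ 2
    + gamma ^+ 2 * ip (sphere_grad p (u k)) (sphere_grad p (u k))
  <= (1 + gamma * mu) * step_size k.
Proof.
have [_ uk1 _ zk _] := iterate_inv_all k.
have [P PE] : exists P, P = sphere_grad p (u k) by exists (sphere_grad p (u k)).
have [y yk] : exists y, y = x k - u k by exists (x k - u k).
have [Ay AyE] : exists Ay, Ay = - lapM p *m y by exists (- lapM p *m y).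
have lapw w : ip w Ay = form S w y by rewrite AyE inner_lap.
have yE : y + gamma *: Ay = - (res k *: u k + gamma *: P).
  apply: (inner_inj hp) => w.
  have := iterate_weak zk w; rewrite -yk => wk.
  have Pw := inner_sphere_grad p (u k) w; rewrite -PE innerC in Pw.
  rewrite !inner_form formDr formNr !formDr !formZr -!inner_form Pw.
  by rewrite lapw wk /residual (innerC p (u k) w); ring.
have uP : ip (u k) P = 0 by rewrite PE sphere_grad_orth.
have e1 : ip (y + gamma *: Ay) (y + gamma *: Ay)
    = ip y y + 2 * gamma * form S y y + gamma ^+ 2 * ip Ay Ay.
  rewrite !inner_form !(formDl, formDr, formZl, formZr) -!inner_form.
  by rewrite (innerC p Ay y) lapw; ring.
have e2 : ip (y + gamma *: Ay) (y + gamma *: Ay) = res k ^+ 2 + gamma ^+ 2 * ip P P.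
  rewrite yE !inner_form formNl formNr opprK !(formDl, formDr, formZl, formZr).
  by rewrite -!inner_form (innerC p P (u k)) uP uk1; ring.
rewrite -PE -e2 e1 /step_size -yk.
have l1 := ler_wpM2l (ltW g0) (ray y).
have l2 := ler_wpM2l (sqr_ge0 gamma) (lap_sqr_le hp y mu_ge0 ray).
move: l1 l2; rewrite -AyE.
by move: (ip y y) (form S y y) (ip Ay Ay) => *; lra.
Qed.

Lemma merit_ge0 k : 0 <= merit_at k.
Proof.
by rewrite addr_ge0 ?(energy_ge0 hp)// divr_ge0 ?sqr_ge0 ?(ltW g0).
Qed.

Lemma merit_nonincreasing k : merit_at k.+1 <= merit_at k.
Proof.
apply: le_trans (iterate_descent k) _; rewrite gerBl divr_ge0 ?(ltW g0)//.
exact: half_quarter_ge0 (sqr_ge0 _) (step_size_ge0 k).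
Qed.

Lemma merit_increment_small eps : 0 < eps ->
  exists K, forall k, (K <= k)%N -> merit_at k - merit_at k.+1 < eps.
Proof.
move=> e0; pose a k := merit_at k.
have : cvgn a.
  apply: nonincreasing_is_cvgn.
    by apply/nonincreasing_seqP => k; exact: merit_nonincreasing.
  by exists 0 => _ [k _ <-]; exact: merit_ge0.
have e2 : 0 < eps / 2 by rewrite divr_gt0.
move=> /cvgrPdist_lt /(_ _ e2) [K _ aK]; exists K => k Kk.
exact: ltr_sub_dist (aK k Kk) (aK k.+1 (leqW Kk)).
Qed.

Lemma grad_small eps : 0 < eps -> exists K, forall k, (K <= k)%N ->
  ip (sphere_grad p (u k)) (sphere_grad p (u k)) < eps.
Proof.
move=> e0; pose C := (1 + gamma * mu) * (4 * gamma).
have C0 : 0 < C.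
  by rewrite !mulr_gt0// ltr_pwDl// mulr_ge0// ltW.
have eC : 0 < eps * gamma ^+ 2 / C by rewrite divr_gt0// mulr_gt0// exprn_gt0.
have [K aK] := merit_increment_small eC; exists K => k /aK.
rewrite ltr_pdivlMr// => H.
rewrite -(ltr_pM2l (exprn_gt0 2 g0)) [ltRHS]mulrC; apply: le_lt_trans H.
have gm : 0 <= 1 + gamma * mu by rewrite addr_ge0// mulr_ge0// ltW.
exact: grad_decrease g0 gm (sqr_ge0 _) (step_size_grad k) (iterate_descent k).
Qed.

(** Obtained from the iteration instead of a multiplier rule: the iterates have arbitrarily small
    gradients, so by compactness some nonnegative unit vector is critical, and it must be [g]. *)
Lemma ground_state_critical : critical p g.
Proof.
have [u0_ge0 u01 _ _ _] := iterate_inv_all 0%N.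
have [|c [c_ge0 c1 _ cmin]] := nonneg_sphere_minimum hp (g := g) (eps := 0) _ N_gt0.
  by exists (u 0%N); split=> //; exact: inner_ge0.
have Pc : ip (sphere_grad p c) (sphere_grad p c) = 0.
  apply/le_anti; rewrite (inner_ge0 hp) andbT leNgt; apply/negP => /grad_small[K].
  move=> /(_ K (leqnn K)); apply/negP; rewrite -leNgt.
  by have [uk_ge0 uk1 _ _ _] := iterate_inv_all K; apply: cmin => //; exact: inner_ge0.
have cc : critical p c by split=> //; exact: (inner_eq0 hp).
by rewrite -(critical_ground_state hp cc c_ge0 gs).
Qed.

(** Away from [g] the gradient norm on nonnegative unit vectors has a positive minimum, since a zero
    would be a second nonnegative critical point; the gradients of the iterates fall below it. *)
Lemma iterate_close eps : 0 < eps -> exists K, forall k, (K <= k)%N ->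
  ip (u k - g) (u k - g) < eps.
Proof.
move=> e0; have [far|near] := pselect (exists v : 'cV[R]_N,
  [/\ forall i, 0 <= v i 0, ip v v = 1 & eps <= ip (v - g) (v - g)]); last first.
  exists 0%N => k _; rewrite ltNge; apply/negP => ek; apply: near; exists (u k).
  by have [uk_ge0 uk1 _ _ _] := iterate_inv_all k.
have [c [c_ge0 c1 cg cmin]] := nonneg_sphere_minimum hp far N_gt0.
have Pc : 0 < ip (sphere_grad p c) (sphere_grad p c).
  rewrite (inner_gt0 hp)//; apply/eqP => Pc0.
  have cE := critical_ground_state hp (conj c1 Pc0) c_ge0 gs.
  by move: cg; rewrite cE subrr inner_form form0l leNgt e0.
have [K uK] := grad_small Pc; exists K => k /uK; apply: contraTT.
rewrite -!leNgt => ek; have [uk_ge0 uk1 _ _ _] := iterate_inv_all k.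
exact: cmin.
Qed.

Lemma lambda_close eps : 0 < eps -> exists K, forall k, (K <= k)%N ->
  `|lambda p (u k) - lambda p g| < eps.
Proof.
move=> e0; have w0 := w_min_gt0 hp N_gt0.
have ug i : u k i 0 @[k --> \oo] --> g i 0.
  apply/cvgrPdist_lt => d d0.
  have [K uK] := iterate_close (mulr_gt0 w0 (exprn_gt0 2 d0)).
  exists K => // k /= /uK uk; have := entry_sqr_le hp N_gt0 (u k - g) i.
  rewrite [(u k - g) i 0]mxE [(- g) i 0]mxE => ei.
  have : (u k i 0 - g i 0) ^+ 2 < d ^+ 2.
    by apply: le_lt_trans ei _; rewrite ltr_pdivrMl.
  rewrite distrC -[X in X < _](real_normK (num_real _)).
  by rewrite ltr_pXn2r ?nnegrE ?(ltW d0).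
have : lambda p (u k) @[k --> \oo] --> lambda p g by exact: cvg_lambda.
move=> /cvgrPdist_lt /(_ _ e0) [K _ lK].
by exists K => k Kk; rewrite distrC; exact: lK.
Qed.

End Gradient.

(* With eta <= 1/2 the residual part and with eta <= gamma nu / (4 (1 + gamma mu))
   the energy part of the merit function is contracted. *)
Lemma contraction_arith (D D' r2 Q Pn nu mu eta : R) : 0 <= mu -> 0 <= D ->
  0 <= r2 -> nu * D <= Pn -> r2 + gamma ^+ 2 * Pn <= (1 + gamma * mu) * Q ->
  eta <= gamma * nu / (4 * (1 + gamma * mu)) -> eta <= 1 / 2 ->
  D' <= D + r2 / gamma - (1 / 2 * r2 + 1 / 4 * Q) / gamma ->
  D' <= (1 - eta) * (D + r2 / gamma).
Proof.
move=> mu0 D0 r0 nD rQ eta1 eta2 dec; apply: le_trans dec _.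
have gm : 0 < 1 + gamma * mu by rewrite ltr_pwDl// mulr_ge0// ltW.
have Q1 : gamma ^+ 2 * (nu * D) / (1 + gamma * mu) <= Q.
  rewrite ler_pdivrMr// mulrC [leRHS]mulrC; have := ler_wpM2l (sqr_ge0 gamma) nD; lra.
have e1 : eta * D <= 1 / 4 * Q / gamma.
  have := ler_wpM2r D0 eta1; move=> /le_trans; apply.
  have -> : gamma * nu / (4 * (1 + gamma * mu)) * D
    = 1 / 4 * (gamma ^+ 2 * (nu * D) / (1 + gamma * mu)) / gamma.
    by field; rewrite !gt_eqF.
  by rewrite ler_pM2r ?invr_gt0//; apply: ler_wpM2l Q1; lra.
have e2 : eta * (r2 / gamma) <= 1 / 2 * (r2 / gamma).
  by apply: ler_wpM2r => //; rewrite divr_ge0 ?(ltW g0).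
have -> : (1 / 2 * r2 + 1 / 4 * Q) / gamma
  = 1 / 2 * (r2 / gamma) + 1 / 4 * Q / gamma by ring.
by move: e1 e2; move: (r2 / gamma) (1 / 4 * Q / gamma) => *; lra.
Qed.

Theorem local_linear_convergence : exists nu mu : R,
  let eta := Num.min (gamma * nu / (4 * (1 + gamma * mu))) (1 / 2) in
  [/\ is_minimum (hessian_values p g) nu, is_largest_eigenvalue (- lapM p) mu,
      2 * beta * vmin (fun i => g i 0) ^+ 2 <= nu
        /\ 0 < 2 * beta * vmin (fun i => g i 0) ^+ 2,
      0 < eta < 1
    & exists K : nat, forall k, (K <= k)%N ->
        merit_at k.+1 - energy p g <= (1 - eta) * (merit_at k - energy p g) /\
        energy p (u k) - energy p g + res k ^+ 2 / gamma
          + nu / 4 * lpnorm p 2 (u k - g) ^+ 2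
        <= 2 * (1 - eta) ^+ (k - K) * (merit_at K - energy p g)].
Proof.
have [u0_ge0 u01 _ _ _] := iterate_inv_all 0%N.
have [mu [mu_eig mu0 ray]] := largest_eigenvalue hp N_gt0 u01.
have g_crit := ground_state_critical mu0 ray.
have [gsph gmin g_gt0] := gs.
have b_gt0 := interaction_gt0 hp.
have [nu [nu_min nuP]] := hessian_minimum hp N_ge2 g_gt0.
have m_gt0 := vmin_gt0 N_gt0 g_gt0.
set mG := vmin _ in m_gt0 *.
have m2 : 0 < 2 * beta * mG ^+ 2 by rewrite !mulr_gt0 ?exprn_gt0.
have nu_ge : 2 * beta * mG ^+ 2 <= nu.
  have [[w [/(sphereE hp) w1 gw ->]] _] := nu_min.
  rewrite (hessian_form hp) /hess.
  have lin := linearized_ge0 hp w g_crit g_gt0.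
  have quad : 2 * beta * mG ^+ 2 <= 2 * beta * wsum p (fun i => g i 0 ^+ 2 * w i 0 ^+ 2).
    apply: ler_wpM2l; first by rewrite mulr_ge0 ?ltW.
    rewrite -[mG ^+ 2]mulr1 -w1 innerE -wsumZ; apply: le_wsum => // i.
    rewrite -expr2; apply: ler_wpM2r; first exact: sqr_ge0.
    by apply: ler_sqr_norm; rewrite ger0_norm ?(ltW m_gt0)// vmin_le.
  by have := lerD lin quad; rewrite add0r.
have nu_gt0 : 0 < nu by exact: lt_le_trans nu_ge.
exists nu, mu => eta; split=> //.
  rewrite lt_min gt_min; apply/andP; split.
    apply/andP; split; last by lra.
    rewrite divr_gt0 ?mulr_gt0// ltr_pwDl// mulr_ge0// ltW//.
  by apply/orP; right; lra.
have eta1 : eta <= gamma * nu / (4 * (1 + gamma * mu)) by rewrite ge_min lexx.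
have eta2 : eta <= 1 / 2 by rewrite ge_min lexx orbT.
have [eps [eps0 loc]] := local_rate hp N_gt0 g_crit nu_gt0 nuP.
have [K1 close] := iterate_close mu0 ray eps0.
have nu20 : 0 < nu / 20 by rewrite divr_gt0.
have [K2 lam] := lambda_close mu0 ray nu20.
pose K := maxn K1 K2; exists K.
have locK k : (K <= k)%N ->
    nu / 4 * ip (u k - g) (u k - g) <= energy p (u k) - energy p g /\
    nu * (energy p (u k) - energy p g) <= ip (sphere_grad p (u k)) (sphere_grad p (u k)).
  rewrite geq_max => /andP[k1 k2]; have [_ uk1 _ _ _] := iterate_inv_all k.
  by apply: loc => //; apply: ltW; [exact: close | exact: lam].
have D0 k : 0 <= energy p (u k) - energy p g.
  rewrite subr_ge0; apply: gmin; apply/(sphereE hp).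
  by have [] := iterate_inv_all k.
have contr k : (K <= k)%N ->
    merit_at k.+1 - energy p g <= (1 - eta) * (merit_at k - energy p g).
  move=> Kk; have [_ nD] := locK k Kk.
  rewrite (merit_gap k); apply: (contraction_arith mu0 (D0 k) (sqr_ge0 (res k)) nD
    (step_size_grad mu0 ray k) eta1 eta2).
  exact: ler_sub_shift (iterate_descent k).
have rate k : (K <= k)%N -> merit_at k - energy p g
    <= (1 - eta) ^+ (k - K) * (merit_at K - energy p g).
  move=> Kk; rewrite -(subnKC Kk) addKn; elim: (k - K)%N => [|n IH].
    by rewrite addn0 expr0 mul1r.
  rewrite addnS exprS -mulrA; apply: le_trans (contr _ (leq_addr _ _)) _.
  exact: ler_wpM2l (subr_half_ge0 eta2) _ _ IH.
move=> k Kk; split; first exact: contr.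
have [growth _] := locK k Kk; rewrite l2_sqr//.
have r0 : 0 <= res k ^+ 2 / gamma by rewrite divr_ge0 ?sqr_ge0 ?(ltW g0).
(* By quadratic growth the distance term is at most the energy gap, hence at most the merit gap;
   this is the factor 2. *)
rewrite -[X in _ <= X]mulrA; apply: rate_total growth r0 _.
by rewrite -merit_gap; exact: rate.
Qed.

End Iteration.

(** * Finite element matrices with vertex quadrature *)

Section Grad.
Context (R : realType) (d : nat).

Lemma derive1_affine (f : R -> R) (a b x : R) : (forall t, f t = a + b * t) ->
  derive1 f x = b.
Proof.
move=> fE; have -> : f = cst a + b *: id by apply/funext => t; rewrite fE.
have D : is_derive x 1 (cst a + b *: id) (0 + b *: 1).
  by apply: is_deriveD; apply: is_deriveZ.
by rewrite derive1E (@derive_val _ _ _ _ _ _ _ D) add0r /GRing.scale /= mulr1.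
Qed.

Lemma dotC (x y : 'rV[R]_d) : dot x y = dot y x.
Proof. by apply: eq_bigr => k _; rewrite mulrC. Qed.

End Grad.

Section Galerkin.
Context (R : realType) (d N : nat) (F : fe_space R d) (x_ : 'I_N -> node F).

Lemma node_stiffness_sym v v' : node_stiffness v v' = @node_stiffness R d F v' v.
Proof.
apply: eq_bigr => e _; congr (_ * _); apply: eq_bigr => a _; exact: dotC.
Qed.

(** The quadrature weights are nonnegative, so the form is a sum of weighted squares of the
    components of the gradient of sum_i w_i phi_i. *)
Lemma node_stiffness_psd (w : 'cV[R]_N) : (forall e, 0 <= volume F e) ->
  0 <= form (\matrix_(i, j) node_stiffness (x_ i) (x_ j)) w w.
Proof.
move=> vol; rewrite formE.
pose G i e a : 'rV[R]_d := grad (Defs.basis (x_ i) e) (pos F (vert F e a)).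
pose c e := volume F e / #|local F|%:R.
have -> : \sum_i \sum_j w i 0 * (\matrix_(i, j) node_stiffness (x_ i) (x_ j)) i j
      * w j 0 = \sum_e \sum_a \sum_k c e * (\sum_i w i 0 * G i e a 0 k) ^+ 2.
  transitivity (\sum_i \sum_j \sum_e \sum_a \sum_k
      c e * (w i 0 * G i e a 0 k) * (w j 0 * G j e a 0 k)).
    apply: eq_bigr => i _; apply: eq_bigr => j _; rewrite mxE mulrAC mulr_sumr.
    apply: eq_bigr => e _; rewrite mulrCA !mulr_sumr; apply: eq_bigr => a _.
    rewrite !mulr_sumr; apply: eq_bigr => k _; rewrite /c /G; ring.
  transitivity (\sum_e \sum_a \sum_k \sum_i \sum_j
      c e * (w i 0 * G i e a 0 k) * (w j 0 * G j e a 0 k)).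
    under eq_bigr do rewrite exchange_big /=.
    rewrite exchange_big /=; apply: eq_bigr => e _.
    under eq_bigr do rewrite exchange_big /=.
    rewrite exchange_big /=; apply: eq_bigr => a _.
    under eq_bigr do rewrite exchange_big /=.
    by rewrite exchange_big.
  apply: eq_bigr => e _; apply: eq_bigr => a _; apply: eq_bigr => k _.
  rewrite expr2 mulr_suml mulr_sumr; apply: eq_bigr => i _.
  by rewrite !mulr_sumr; apply: eq_bigr => j _; ring.
apply: sumr_ge0 => e _; apply: sumr_ge0 => a _; apply: sumr_ge0 => k _.
by rewrite mulr_ge0 ?sqr_ge0// divr_ge0.
Qed.

Lemma node_weight_gt0 v : (forall e, 0 < volume F e) ->
  (exists e a, vert F e a = v) -> 0 < node_weight v.
Proof.
move=> vol [e [a va]]; have L0 : (0 : R) < #|local F|%:R.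
  by rewrite ltr0n; apply/card_gt0P; exists a.
have c0 e' : 0 < volume F e' / #|local F|%:R by rewrite divr_gt0.
have s0 e' : 0 <= \sum_(a : local F | vert F e' a == v) volume F e' / #|local F|%:R.
  by apply: sumr_ge0 => b _; exact: ltW.
rewrite /node_weight (bigD1 e) //=; apply: ltr_wpDr.
  by apply: sumr_ge0 => e' _; exact: s0.
rewrite (bigD1 a) ?va//=; apply: ltr_wpDr => //.
by apply: sumr_ge0 => b _; exact: ltW.
Qed.

(* The hypotheses on x_ that the two schemes have to establish. *)
Lemma fe_admissible (V : 'rV[R]_d -> R) (beta : R)
    (p := fe_problem x_ V beta) :
  (forall e, 0 < volume F e) -> (forall i, exists e a, vert F e a = x_ i) ->
  (forall i j, i != j -> node_stiffness (x_ i) (x_ j) <= 0) ->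
  irreducible_mx (stiffness p) -> 0 < beta ->
  (forall i, 0 <= V (pos F (x_ i))) -> admissible p.
Proof.
move=> vol used off irr b0 V0; split=> //.
- by move=> i; rewrite mxE node_weight_gt0.
- by apply/matrixP => i j; rewrite !mxE node_stiffness_sym.
- by move=> v; apply: node_stiffness_psd => e; exact: ltW.
- by move=> i j ij; rewrite mxE off.
- by move=> i; rewrite mxE.
Qed.

Lemma interior_mem v : domain F (pos F v) -> exists e, region F e (pos F v).
Proof. by move=> /interior_subset[e _ ev]; exists e. Qed.

End Galerkin.

(** * Q1 elements: signs of the stiffness entries *)

Section Q1.
Context (R : realType) (d : nat) (M : rect_mesh R d).
Local Notation F := (q1_space M).
Local Notation o := (rm_origin M).
Local Notation h := (rm_step M).

Lemma q1_volume_gt0 (e : cell F) : 0 < volume F e.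
Proof. by apply: prodr_gt0 => k _; exact: rm_step_gt0. Qed.

Lemma q1_vertex (c : cell F) (b : local F) k :
  (vert F c b : {ffun 'I_d -> 'I_(rm_size M).+1}) k = (val c k + b k)%N :> nat.
Proof.
rewrite /= ffunE inordK// ltnS; have := ltn_ord (val c k).
by case: (b k); rewrite ?addn1 ?addn0 => // /ltnW.
Qed.

Lemma q1_used v : domain F (pos F v) -> exists e a, vert F e a = v.
Proof.
(* Membership in the cell gives c_k <= v_k <= c_k + 1 for the integer indices, so [b] is their
   difference. *)
move=> /interior_mem[c cv]; pose b : local F := [ffun k => val c k != v k :> nat].
exists c, b; apply/ffunP => k; apply: ord_inj; rewrite q1_vertex /b ffunE.
have /andP[] := cv k; rewrite mxE !lerD2l !ler_pM2r ?rm_step_gt0// !ler_nat.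
by move: (val c k) (v k : nat) => i j; case: ltngtP => //= [ij _ ji|-> _ _];
  rewrite ?addn0// addn1; apply/eqP; rewrite eqn_leq ij ji.
Qed.

(* Only the one-dimensional factor in direction k depends on t; the other
   factors are 0 or 1 at a vertex. *)
Definition q1_slope (a b : {ffun 'I_d -> bool}) (k : 'I_d) : R :=
  (\prod_(l < d | l != k) (a l == b l)%:R) * (if a k then (h k)^-1 else - (h k)^-1).

Lemma q1_grad (v : node F) (c : cell F) (b : local F) k :
  grad (Defs.basis v c) (pos F (vert F c b)) 0 k
  = \sum_(a : local F | vert F c a == v) q1_slope a b k.
Proof.
have h_neq0 l : h l != 0 by rewrite gt_eqF ?rm_step_gt0.
rewrite mxE; apply: (@derive1_affine R _
  (\sum_(a : local F | vert F c a == v) \prod_(l < d) (a l == b l)%:R)).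
move=> t; rewrite /Defs.basis mulr_suml -big_split /=; apply: eq_bigr => a _.
rewrite /q1_slope; set P := \prod_(l < d | l != k) (a l == b l)%:R.
pose y := pos F (vert F c b) + t *: delta_mx 0 k.
have yl l : (y 0 l - (o l + (val c l)%:R * h l)) / h l
    = (b l)%:R + t * (l == k)%:R / h l.
  rewrite /y !mxE q1_vertex eqxx natrD /=; by field.
have shapeE : Defs.shape F c a y
    = \prod_l (if a l then (b l)%:R + t * (l == k)%:R / h l
               else 1 - ((b l)%:R + t * (l == k)%:R / h l)).
  by apply: eq_bigr => l _; rewrite yl.
rewrite -[LHS]/(Defs.shape F c a y) shapeE (bigD1 k) //= [\prod_(l < d) (a l == b l)%:R](bigD1 k) //= -/P.
have -> : \prod_(l < d | l != k) (if a l then (b l)%:R + t * (l == k)%:R / h l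
    else 1 - ((b l)%:R + t * (l == k)%:R / h l)) = P.
  apply: eq_bigr => l lk; rewrite (negbTE lk) mulr0 mul0r addr0.
  by case: (a l); case: (b l); rewrite ?subrr ?subr0.
rewrite eqxx mulr1; case: (a k); case: (b k) => /=; ring.
Qed.

(* Nonzero slopes of two distinct shape functions at the same vertex belong to
   the two endpoints of an edge, where they have opposite signs. *)
Lemma q1_slope_le0 (a a' b : {ffun 'I_d -> bool}) k : a != a' ->
  q1_slope a b k * q1_slope a' b k <= 0.
Proof.
move=> aa'; have hk : 0 < (h k)^-1 by rewrite invr_gt0 rm_step_gt0.
have P01 (a1 : {ffun 'I_d -> bool}) :
    \prod_(l < d | l != k) (a1 l == b l)%:R = [forall (l | l != k), a1 l == b l]%:R :> R.
  case: (boolP [forall (l | l != k), a1 l == b l]) => [/forall_inP ab|].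
    by apply: big1 => l lk; rewrite ab.
  rewrite negb_forall_in => /exists_inP[l lk ab].
  by rewrite (bigD1 l) //= (negbTE ab) mul0r.
rewrite /q1_slope !P01.
case: (boolP [forall (l | l != k), a l == b l]) => [/forall_inP ab|_]; last first.
  by rewrite !mul0r.
case: (boolP [forall (l | l != k), a' l == b l]) => [/forall_inP ab'|_]; last first.
  by rewrite !mul0r mulr0.
have ak : a k != a' k.
  apply: contra_neq aa' => akk; apply/ffunP => l; have [->//|lk] := eqVneq l k.
  by rewrite (eqP (ab _ lk)) (eqP (ab' _ lk)).
have hh : 0 <= (h k)^-1 * (h k)^-1 by rewrite mulr_ge0 ?ltW.
by case: (a k) (a' k) ak => -[] //= _; rewrite !mul1r ?mulrN ?mulNr oppr_le0.
Qed.

Lemma q1_off (v v' : node F) : v != v' -> node_stiffness v v' <= 0.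
Proof.
move=> vv'; apply: sumr_le0 => c _; apply: mulr_ge0_le0.
  by rewrite divr_ge0// ltW// q1_volume_gt0.
apply: sumr_le0 => b _; apply: sumr_le0 => k _; rewrite !q1_grad.
rewrite mulr_suml; apply: sumr_le0 => a /eqP av.
rewrite mulr_sumr; apply: sumr_le0 => a' /eqP av'.
by apply: q1_slope_le0; apply: contra_neq vv' => aa; rewrite -av -av' aa.
Qed.

End Q1.

(** * Angles, barycentric gradients and the cotangent formula *)

Section Cotangent.
Context (R : realType).

Lemma dot_sqr_le d (x y : 'rV[R]_d) : dot x y ^+ 2 <= dot x x * dot y y.
Proof.
have E (v w : 'rV[R]_d) : dot v w = form 1%:M v^T w^T.
  by rewrite /form trmxK mulmx1 mxE; apply: eq_bigr => k _; rewrite mxE.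
rewrite !E; apply: form_CauchySchwarz; first exact: trmx1.
move=> w; rewrite /form mulmx1 mxE; apply: sumr_ge0 => k _.
by rewrite mxE -expr2 sqr_ge0.
Qed.

Lemma dot_ge0 d (x : 'rV[R]_d) : 0 <= dot x x.
Proof. by apply: sumr_ge0 => k _; rewrite -expr2 sqr_ge0. Qed.

(** The positive Gram determinant puts the cosine strictly between -1 and 1, and the sine is the
    root of that determinant over the product of the norms. *)
Lemma cot_angle d (x y : 'rV[R]_d) : 0 < dot x x * dot y y - dot x y ^+ 2 ->
  cot (angle x y) = dot x y / Num.sqrt (dot x x * dot y y - dot x y ^+ 2).
Proof.
move=> G0; have xy0 : 0 < dot x x * dot y y.
  by apply: lt_le_trans G0 _; rewrite lerBlDr lerDl sqr_ge0.
set c := dot x y / (enorm x * enorm y).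
have nn : (enorm x * enorm y) ^+ 2 = dot x x * dot y y.
  by rewrite exprMn !sqr_sqrtr ?dot_ge0.
have n0 : 0 < enorm x * enorm y.
  by rewrite /enorm -sqrtrM ?dot_ge0// sqrtr_gt0.
have /andP[ex ey] : (enorm x != 0) && (enorm y != 0).
  by rewrite -negb_or -mulf_eq0 lt0r_neq0.
have c2 : 1 - c ^+ 2 = (dot x x * dot y y - dot x y ^+ 2) / (enorm x * enorm y) ^+ 2.
  rewrite /c -nn; by field; rewrite ?ex ?ey.
have c1 : -1 <= c <= 1.
  rewrite -ler_norml -(@ler_pXn2r _ 2) ?nnegrE// expr1n real_normK ?num_real//.
  by rewrite -subr_ge0 c2 divr_ge0 ?sqr_ge0 ?ltW.
rewrite /cot /angle -/c acosK// sin_acos// c2 sqrtrM ?(ltW G0)// sqrtrV ?sqr_ge0//.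
rewrite sqrtr_sqr gtr0_norm// /c; have s0 : Num.sqrt (dot x x * dot y y - dot x y ^+ 2) != 0.
  by rewrite lt0r_neq0// sqrtr_gt0.
by field; rewrite ?s0 ?ex ?ey.
Qed.

End Cotangent.

Section Simplex.
Context (R : realType) (d : nat).

Lemma det_vertex_perm (q : 'I_d.+1 -> 'rV[R]_d) (f : 'I_d.+1 -> 'I_d.+1) :
  injective f ->
  (\det (vertex_mx (q \o f) : 'M[R]_d.+1)) ^+ 2 = (\det (vertex_mx q : 'M[R]_d.+1)) ^+ 2.
Proof.
move=> injf; have -> : (vertex_mx (q \o f) : 'M[R]_d.+1)
    = row_perm (perm injf) (vertex_mx q : 'M[R]_d.+1).
  by apply/matrixP => i j; rewrite !mxE permE.
by rewrite row_permE det_mulmx det_perm exprMn sqrr_sign mul1r.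
Qed.

Definition edges_from (q : 'I_d.+1 -> 'rV[R]_d) : 'M[R]_d :=
  \matrix_(i < d) (q (lift ord0 i) - q ord0).

Lemma det_vertex_mx (q : 'I_d.+1 -> 'rV[R]_d) :
  \det (vertex_mx q : 'M[R]_d.+1) = \det (edges_from q).
Proof.
pose P : 'M[R]_d := \matrix_(i < d) q (lift ord0 i).
have VE : (vertex_mx q : 'M[R]_(1 + d)) = block_mx 1%:M (q ord0) (const_mx 1) P.
  apply/matrixP => i j; rewrite [LHS]mxE.
  case: (split_ordP i) => i' ->; case: (split_ordP j) => j' ->.
  - by rewrite block_mxEul row_mxEl !mxE !ord1.
  - by rewrite block_mxEur row_mxEr; congr (q _ _ _); apply/val_inj; rewrite /= ?ord1.
  - by rewrite block_mxEdl row_mxEl !mxE !ord1.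
  - by rewrite block_mxEdr row_mxEr mxE; congr (q _ _ _); exact: val_inj.
have LV : block_mx 1%:M 0 (- const_mx 1) 1%:M *m (vertex_mx q : 'M[R]_(1 + d))
    = block_mx 1%:M (q ord0) 0 (edges_from q).
  rewrite VE mulmx_block !mul1mx !mul0mx !addr0 mulmx1 addNr; congr block_mx.
  apply/matrixP => i j; rewrite !mxE big_ord1 !mxE mulN1r addrC.
  by [].
have := congr1 determinant LV.
by rewrite det_mulmx det_lblock !det1 !mul1r det_ublock det1 mul1r.
Qed.

Context (q : 'I_d.+1 -> 'rV[R]_d).
Local Notation VM := (vertex_mx q : 'M[R]_d.+1).
Context (VMu : VM \in unitmx).

(** Column [a] of the inverse vertex matrix holds the affine coefficients of the a-th barycentric
    coordinate; dropping the constant term leaves its gradient. *)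
Definition bary_grad (a : 'I_d.+1) : 'rV[R]_d :=
  \row_k (invmx VM : 'M[R]_(1 + d)) (rshift 1 k) a.

Lemma bary_affine (x : 'rV[R]_d) a :
  ((row_mx 1%:M x : 'rV[R]_(1 + d)) *m invmx VM) 0 a
  = (invmx VM : 'M[R]_(1 + d)) (lshift d 0) a + dot (bary_grad a) x.
Proof.
rewrite mxE big_split_ord /= big_ord1 row_mxEl mxE eqxx mul1r.
congr (_ + _); apply: eq_bigr => k _.
by rewrite row_mxEr mxE mulrC.
Qed.

Lemma bary_vertex a b :
  (invmx VM : 'M[R]_(1 + d)) (lshift d 0) a + dot (bary_grad a) (q b) = (b == a)%:R.
Proof.
rewrite -bary_affine.
have <- : row b VM = row_mx 1%:M (q b) by rewrite /vertex_mx rowK.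
by rewrite -row_mul mulmxV// mxE mxE.
Qed.

Lemma bary_edge a b c : dot (bary_grad a) (q b - q c) = (b == a)%:R - (c == a)%:R.
Proof.
rewrite -!bary_vertex; have -> : dot (bary_grad a) (q b - q c)
    = dot (bary_grad a) (q b) - dot (bary_grad a) (q c).
  by rewrite -sumrB; apply: eq_bigr => k _; rewrite [(q b - q c) 0 k]mxE
    [(- q c) 0 k]mxE mulrBr.
by rewrite opprD addrACA subrr add0r.
Qed.

(* B B^T and Gamma Gamma^T are inverse to each other, where the rows of B are the
   edges from the vertex f 0 and those of Gamma the barycentric gradients. *)
Lemma gram_inverse (f : 'I_d.+1 -> 'I_d.+1) : injective f ->
  let B := edges_from (q \o f) in
  (B *m B^T) *m (\matrix_(i, j) dot (bary_grad (f (lift ord0 i)))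
                                  (bary_grad (f (lift ord0 j)))) = 1%:M.
Proof.
move=> injf B; pose G : 'M[R]_d := \matrix_(i < d) bary_grad (f (lift ord0 i)).
have GB : G *m B^T = 1%:M.
  apply/matrixP => i j; rewrite mxE [RHS]mxE.
  transitivity (dot (bary_grad (f (lift ord0 i))) (q (f (lift ord0 j)) - q (f ord0))).
    by apply: eq_bigr => k _; rewrite !mxE.
  rewrite bary_edge !(inj_eq injf) (inj_eq lift_inj) eq_sym (negbTE (neq_lift _ _)).
  by rewrite subr0 eq_sym eq_sym.
have -> : \matrix_(i, j) dot (bary_grad (f (lift ord0 i))) (bary_grad (f (lift ord0 j)))
    = G *m G^T.
  by apply/matrixP => i j; rewrite !mxE; apply: eq_bigr => k _; rewrite !mxE.
rewrite -mulmxA (mulmxA B^T) (mulmx1C GB) mul1mx.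
by rewrite -[RHS]trmx1 -GB trmx_mul trmxK.
Qed.

End Simplex.

Section CotangentFormula.
Context (R : realType).

Lemma dot_gram d (q : 'I_d.+1 -> 'rV[R]_d) i j :
  (edges_from q *m (edges_from q)^T) i j
  = dot (q (lift ord0 i) - q ord0) (q (lift ord0 j) - q ord0).
Proof. by rewrite mxE; apply: eq_bigr => k _; rewrite !mxE. Qed.

(* In terms of the Gram matrix (aa, ab, bb) of the components of two edges
   orthogonal to the opposite face, whose squared volume is kk up to a factor. *)
Lemma cot_arith (kk aa ab bb gab gbb v : R) : 0 <= kk ->
  v ^+ 2 = kk * (aa * bb - ab ^+ 2) -> 0 < v -> 0 < aa * bb - ab ^+ 2 ->
  aa * gab + ab * gbb = 0 -> ab * gab + bb * gbb = 1 ->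
  v * gab = - (Num.sqrt kk * (ab / Num.sqrt (aa * bb - ab ^+ 2))).
Proof.
move=> kk0 vE v0 G0 r1 r2; set G := aa * bb - ab ^+ 2 in vE G0 *.
have gE : gab * G = - ab.
  have : bb * (aa * gab + ab * gbb) = 0 by rewrite r1 mulr0.
  have : ab * (ab * gab + bb * gbb) = ab by rewrite r2 mulr1.
  rewrite /G; lra.
have s0 : 0 < Num.sqrt G by rewrite sqrtr_gt0.
have vv : v = Num.sqrt kk * Num.sqrt G.
  by rewrite -sqrtrM// -vE sqrtr_sqr gtr0_norm.
have GG : Num.sqrt G * Num.sqrt G = G by rewrite -expr2 sqr_sqrtr// ltW.
apply: (mulIf (lt0r_neq0 s0)); rewrite mulNr -[RHS]mulNr.
have -> : v * gab * Num.sqrt G = Num.sqrt kk * (gab * (Num.sqrt G * Num.sqrt G)).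
  by rewrite vv; ring.
rewrite GG gE; field; exact: lt0r_neq0.
Qed.

Lemma simplex_det_gt0 d (q : 'I_d.+1 -> 'rV[R]_d) :
  (vertex_mx q : 'M[R]_d.+1) \in unitmx -> 0 < `|\det (vertex_mx q : 'M[R]_d.+1)|.
Proof. by move=> qu; rewrite normr_gt0 -unitfE -unitmxE. Qed.

Lemma simplex_det_sqr d (q : 'I_d.+1 -> 'rV[R]_d) (f : 'I_d.+1 -> 'I_d.+1) :
  injective f -> `|\det (vertex_mx q : 'M[R]_d.+1)| ^+ 2
  = \det (edges_from (q \o f) *m (edges_from (q \o f))^T).
Proof.
move=> injf; rewrite real_normK ?num_real// -(det_vertex_perm q injf).
by rewrite (det_vertex_mx (q \o f)) det_mulmx det_tr expr2.
Qed.

Lemma seq_inj (T : eqType) n (x0 : T) (s : seq T) : uniq s -> size s = n ->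
  injective (fun i : 'I_n => nth x0 s i).
Proof.
move=> us sn i j /eqP; rewrite nth_uniq ?sn// => /eqP ij; exact: val_inj.
Qed.

Lemma det_mx22 (A : 'M[R]_2) :
  \det A = A ord0 ord0 * A (lift ord0 ord0) (lift ord0 ord0)
          - A ord0 (lift ord0 ord0) * A (lift ord0 ord0) ord0.
Proof.
rewrite (expand_det_row _ ord0) !big_ord_recl big_ord0 addr0 /cofactor.
rewrite !det_mx11 !mxE /= expr0 expr1 mul1r mulN1r mulrN.
by congr (_ * A _ _ - _ * A _ _); apply/val_inj.
Qed.

(** With edges issued from the opposite vertex [c], the inverse Gram matrix contains the products of
    gradients; its second column gives the two relations that [cot_arith] solves. *)
Lemma cotangent_formula2 (q : 'I_3 -> 'rV[R]_2) (a b c : 'I_3) :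
  (vertex_mx q : 'M[R]_3) \in unitmx -> uniq [:: c; a; b] ->
  `|\det (vertex_mx q : 'M[R]_3)| * dot (bary_grad q a) (bary_grad q b)
  = - (simplex_volume [:: q c] * cot (dihedral_angle [:: q c] (q a) (q b))).
Proof.
move=> qu us; pose f (i : 'I_3) := nth c [:: c; a; b] i.
have injf : injective f by exact: seq_inj.
have op x : orth_part [:: q c] x = x - q c.
  by rewrite /orth_part /= [edge_mx _]flatmx0 mulmx0 subr0.
have sv : simplex_volume [:: q c] = 1.
  by rewrite /simplex_volume /= det_mx00 sqrtr1 divr1.
have /matrixP gi := gram_inverse qu injf.
have r0 := gi ord0 (lift ord0 ord0); have r1 := gi (lift ord0 ord0) (lift ord0 ord0).
rewrite ![(_ *m _) _ (lift _ _)]mxE !big_ord_recl !big_ord0 !addr0 in r0 r1.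
set x := q a - q c; set y := q b - q c.
have r0' : dot x x * dot (bary_grad q a) (bary_grad q b)
    + dot x y * dot (bary_grad q b) (bary_grad q b) = 0.
  by move: r0; rewrite !dot_gram !mxE.
have r1' : dot x y * dot (bary_grad q a) (bary_grad q b)
    + dot y y * dot (bary_grad q b) (bary_grad q b) = 1.
  by move: r1; rewrite !dot_gram !mxE [dot x y]dotC.
have vE := simplex_det_sqr q injf; rewrite det_mx22 !dot_gram in vE.
have vE' : `|\det (vertex_mx q : 'M[R]_3)| ^+ 2
    = 1 * (dot x x * dot y y - dot x y ^+ 2).
  by rewrite vE mul1r expr2 [in RHS](dotC x y) [X in _ - X]mulrC (dotC x y).
have v0 := simplex_det_gt0 qu.
have G0 : 0 < dot x x * dot y y - dot x y ^+ 2.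
  by rewrite -[X in 0 < X]mul1r -vE' exprn_gt0.
rewrite (cot_arith ler01 vE' v0 G0 r0' r1') sv sqrtr1 !mul1r.
by rewrite /dihedral_angle !op cot_angle.
Qed.

Lemma det_mx33 (A : 'M[R]_3) (i0 := ord0) (i1 := lift ord0 ord0)
    (i2 := lift ord0 (lift ord0 ord0)) :
  \det A = A i0 i0 * (A i1 i1 * A i2 i2 - A i1 i2 * A i2 i1)
    - A i0 i1 * (A i1 i0 * A i2 i2 - A i1 i2 * A i2 i0)
    + A i0 i2 * (A i1 i0 * A i2 i1 - A i1 i1 * A i2 i0).
Proof.
rewrite (expand_det_row _ ord0) !big_ord_recl big_ord0 addr0 /cofactor !det_mx22 !mxE.
have e1 : lift i1 (ord0 : 'I_2) = i0 by exact: val_inj.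
have e2 : lift i1 (lift ord0 ord0 : 'I_2) = i2 by exact: val_inj.
have e3 : lift i2 (ord0 : 'I_2) = i0 by exact: val_inj.
have e4 : lift i2 (lift ord0 ord0 : 'I_2) = i1 by exact: val_inj.
rewrite -/i1 -/i2 e1 e2 e3 e4 /= -/i0 -/i1 -/i2 expr0 expr1 sqrrN expr1n; ring.
Qed.

Lemma dot_sub_scale d (x y e : 'rV[R]_d) (s t : R) :
  dot (x - s *: e) (y - t *: e)
  = dot x y - t * dot e x - s * dot e y + s * t * dot e e.
Proof.
rewrite /dot !mulr_sumr -!sumrB -big_split; apply: eq_bigr => k _.
by rewrite !mxE /=; ring.
Qed.

(** As in the plane, after eliminating the opposite edge [e] from the Gram system: its Schur
    complement is the Gram matrix of the components orthogonal to [e], whose angle is the dihedral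
    angle. *)
Lemma cotangent_formula3 (q : 'I_4 -> 'rV[R]_3) (a b c c' : 'I_4) :
  (vertex_mx q : 'M[R]_4) \in unitmx -> uniq [:: c; c'; a; b] ->
  `|\det (vertex_mx q : 'M[R]_4)| * dot (bary_grad q a) (bary_grad q b)
  = - (simplex_volume [:: q c; q c']
       * cot (dihedral_angle [:: q c; q c'] (q a) (q b))).
Proof.
move=> qu us; pose f (i : 'I_4) := nth c [:: c; c'; a; b] i.
have injf : injective f by exact: seq_inj.
set e := q c' - q c; set x := q a - q c; set y := q b - q c.
pose i2 : 'I_3 := lift ord0 (lift ord0 ord0).
have /matrixP gi := gram_inverse qu injf.
have r0 := gi ord0 i2; have r1 := gi (lift ord0 ord0) i2; have r2 := gi i2 i2.
rewrite ![(_ *m _) _ i2]mxE !big_ord_recl !big_ord0 !addr0 in r0 r1 r2.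
pose g0 := bary_grad q c'; pose ga := bary_grad q a; pose gb := bary_grad q b.
have r0' : dot e e * dot g0 gb + (dot e x * dot ga gb + dot e y * dot gb gb) = 0.
  by move: r0; rewrite !dot_gram !mxE.
have r1' : dot e x * dot g0 gb + (dot x x * dot ga gb + dot x y * dot gb gb) = 0.
  by move: r1; rewrite !dot_gram !mxE [dot e x]dotC.
have r2' : dot e y * dot g0 gb + (dot x y * dot ga gb + dot y y * dot gb gb) = 1.
  by move: r2; rewrite !dot_gram !mxE [dot e y]dotC [dot x y]dotC.
have v0 := simplex_det_gt0 qu.
have vE : `|\det (vertex_mx q : 'M[R]_4)| ^+ 2
    = dot e e * (dot x x * dot y y - dot x y ^+ 2)
      - dot e x * (dot e x * dot y y - dot x y * dot e y)
      + dot e y * (dot e x * dot x y - dot x x * dot e y).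
  have := simplex_det_sqr q injf; rewrite det_mx33 !dot_gram => ->.
  transitivity (dot e e * (dot x x * dot y y - dot x y * dot y x)
    - dot e x * (dot x e * dot y y - dot x y * dot y e)
    + dot e y * (dot x e * dot y x - dot x x * dot y e)); first by [].
  by rewrite (dotC x e) (dotC y e) (dotC y x); ring.
have ee_neq0 : dot e e != 0.
  apply/eqP => ee0; have := dot_sqr_le e x; have := dot_sqr_le e y.
  rewrite ee0 !mul0r => ey ex; have ex0 : dot e x = 0.
    by apply/eqP; rewrite -sqrf_eq0 eq_le ex sqr_ge0.
  have ey0 : dot e y = 0 by apply/eqP; rewrite -sqrf_eq0 eq_le ey sqr_ge0.
  by move: (exprn_gt0 2 v0); rewrite vE ee0 ex0 ey0 !mul0r subrr addr0 ltxx.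
have ee0 : 0 < dot e e by rewrite lt_def ee_neq0 dot_ge0.
have op z : orth_part [:: q c; q c'] z
    = (z - q c) - (dot e (z - q c) / dot e e) *: e.
  have AE : edge_mx [:: q c; q c'] = e :> 'M[R]_(1, 3).
    by apply/rowP => k; rewrite mxE.
  have tr (v w : 'rV[R]_3) : v *m w^T = (dot w v)%:M.
    rewrite [LHS]mx11_scalar mxE; congr (_%:M); apply: eq_bigr => k _.
    by rewrite mxE mulrC.
  rewrite /orth_part /= AE !tr invmx_scalar -scalar_mxM mul_scalar_mx.
  by [].
have sv : simplex_volume [:: q c; q c'] = Num.sqrt (dot e e).
  rewrite /simplex_volume /= divr1; congr Num.sqrt.
  by rewrite det_mx11 mxE; apply: eq_bigr => k _; rewrite !mxE.
rewrite sv /dihedral_angle !op -/x -/y.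
set nx := x - _; set ny := y - _.
have xx : dot nx nx = dot x x - dot e x ^+ 2 / dot e e.
  by rewrite dot_sub_scale; field.
have yy : dot ny ny = dot y y - dot e y ^+ 2 / dot e e.
  by rewrite dot_sub_scale; field.
have xy : dot nx ny = dot x y - dot e x * dot e y / dot e e.
  by rewrite dot_sub_scale; field.
have vG : `|\det (vertex_mx q : 'M[R]_4)| ^+ 2
    = dot e e * (dot nx nx * dot ny ny - dot nx ny ^+ 2).
  by rewrite vE xx yy xy; field.
have G0 : 0 < dot nx nx * dot ny ny - dot nx ny ^+ 2.
  by rewrite -(pmulr_rgt0 _ ee0) -vG exprn_gt0.
have geb : dot g0 gb = - (dot e x * dot ga gb + dot e y * dot gb gb) / dot e e.
  apply: (mulfI ee_neq0); rewrite mulrCA mulfV// mulr1; apply/eqP.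
  by rewrite -addr_eq0 r0'.
have c0 : dot nx nx * dot ga gb + dot nx ny * dot gb gb = 0.
  by rewrite -r1' xx xy geb; field.
have c1 : dot nx ny * dot ga gb + dot ny ny * dot gb gb = 1.
  by rewrite -r2' yy xy geb; field.
by rewrite (cot_arith (ltW ee0) vG v0 G0 c0 c1) cot_angle.
Qed.

End CotangentFormula.

(** * P1 elements: signs of the stiffness entries *)

Section P1.
Context (R : realType) (d : nat) (T : simplicial_mesh R d).
Local Notation F := (p1_space T).
Local Notation q e := (fun a => sm_pos T (sm_vert T e a)).

Lemma p1_volume_gt0 (e : cell F) : 0 < volume F e.
Proof.
apply: divr_gt0; last by rewrite ltr0n fact_gt0.
exact: simplex_det_gt0 (sm_nondegenerate e).
Qed.

Lemma p1_grad (v : node F) (e : cell F) x k : grad (Defs.basis v e) x 0 k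
  = \sum_(a : local F | vert F e a == v) bary_grad (q e) a 0 k.
Proof.
rewrite mxE; apply: (@derive1_affine R _ (Defs.basis v e x)) => t.
rewrite /Defs.basis mulr_suml -big_split /=; apply: eq_bigr => a _.
rewrite !bary_affine -addrA; congr (_ + _).
have -> : dot (bary_grad (q e) a) (x + t *: delta_mx 0 k)
    = dot (bary_grad (q e) a) x + \sum_j bary_grad (q e) a 0 j * (t * (j == k)%:R).
  rewrite -big_split; apply: eq_bigr => j _.
  have -> : (x + t *: delta_mx 0 k) 0 j = x 0 j + t * (j == k)%:R.
    by rewrite !mxE eqxx.
  by rewrite mulrDr.
congr (_ + _); rewrite (bigD1 k) //= big1 ?addr0 => [|j jk].
  by rewrite eqxx mulr1.
by rewrite (negbTE jk) !mulr0.
Qed.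

(** Gradients are constant on a cell, so the vertex rule integrates their products exactly and the
    factor d + 1 cancels. *)
Lemma p1_stiffness (v v' : node F) : node_stiffness v v'
  = \sum_(e : sm_cell T) \sum_(a | sm_vert T e a == v) \sum_(b | sm_vert T e b == v')
      (d`!%:R)^-1 * (`|\det (vertex_mx (q e) : 'M[R]_d.+1)|
                     * dot (bary_grad (q e) a) (bary_grad (q e) b)).
Proof.
apply: eq_bigr => e _; set X := \sum_(a | _) _.
have cst c : dot (grad (Defs.basis v e) (pos F (vert F e c)))
      (grad (Defs.basis v' e) (pos F (vert F e c)))
    = \sum_(a | sm_vert T e a == v) \sum_(b | sm_vert T e b == v')
        dot (bary_grad (q e) a) (bary_grad (q e) b).
  transitivity (\sum_k \sum_(a | sm_vert T e a == v) \sum_(b | sm_vert T e b == v')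
      bary_grad (q e) a 0 k * bary_grad (q e) b 0 k).
    apply: eq_bigr => k _; rewrite !p1_grad mulr_suml; apply: eq_bigr => a _.
    by rewrite mulr_sumr.
  rewrite exchange_big; apply: eq_bigr => a _; rewrite exchange_big.
  by apply: eq_bigr => b _.
have d0 : (d.+1)%:R != 0 :> R by rewrite pnatr_eq0.
under eq_bigr do rewrite cst.
set Y := \sum_(a | _) _; rewrite sumr_const -[Y *+ _]mulr_natr.
have -> : #|local F| = d.+1 by rewrite card_ord.
rewrite [Y * _]mulrC mulrA mulfVK// /Y /X mulr_sumr; apply: eq_bigr => a _.
rewrite mulr_sumr; apply: eq_bigr => b _.
by rewrite mulrA [_^-1 * _]mulrC.
Qed.

(** Puts the opposite vertices first and a, b last, the order expected by the cotangent formulas;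
    the size determines how many opposite vertices there are. *)
Lemma opposite_indices n (a b : 'I_n) : a != b ->
  let l := [seq c <- enum 'I_n | (c != a) && (c != b)] in
  uniq (l ++ [:: a; b]) /\ size (l ++ [:: a; b]) = n.
Proof.
move=> ab l; have us : uniq (l ++ [:: a; b]).
  rewrite cat_uniq filter_uniq ?enum_uniq//= !mem_filter !eqxx /= andbF /=.
  by rewrite inE ab.
split=> //; rewrite -[RHS](size_enum_ord n); apply: perm_size.
apply: uniq_perm => //; first exact: enum_uniq.
move=> c; rewrite mem_cat mem_filter !inE mem_enum /= andbT.
by case: (c == a); case: (c == b).
Qed.

End P1.

(** The two normalizations agree because d! = d (d - 1) for d = 2 and d = 3. *)
Lemma p1_term (R : realType) (d : nat) (T : simplicial_mesh R d) e a b :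
  (2 <= d <= 3)%N -> a != b ->
  (d`!%:R)^-1 * (`|\det (vertex_mx (fun i => sm_pos T (sm_vert T e i)) : 'M[R]_d.+1)|
    * dot (bary_grad (fun i => sm_pos T (sm_vert T e i)) a)
          (bary_grad (fun i => sm_pos T (sm_vert T e i)) b))
  = - (1 / (d * d.-1)%N%:R * simplex_volume (opposite e a b)
       * cot (dihedral_angle (opposite e a b) (sm_pos T (sm_vert T e a))
                (sm_pos T (sm_vert T e b)))).
Proof.
case: d T e a b => [|[|[|[|d]]]] // T e a b _ ab.
  have [us] := opposite_indices ab; rewrite size_cat addn2 => -[sz]; move: us sz.
  rewrite /opposite.
  move: [seq c <- _ | _] => [|c [|c' l]] //= us _.
  rewrite (cotangent_formula2 (sm_nondegenerate e) us) mulrN; congr (- _).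
  by rewrite mulrA mul1r.
have [us] := opposite_indices ab; rewrite size_cat addn2 => -[sz]; move: us sz.
rewrite /opposite.
move: [seq c <- _ | _] => [|c [|c' [|c'' l]]] //= us _.
rewrite (cotangent_formula3 (sm_nondegenerate e) us) mulrN; congr (- _).
by rewrite mulrA mul1r.
Qed.

(* For d = 1 the two gradients are opposite; for d = 2, 3 the entry is minus the
   sum in the edge condition. Only t = 0 is used for the interior edge. *)
Lemma p1_off (R : realType) (d : nat) (T : simplicial_mesh R d)
    (v v' : node (p1_space T)) :
  (1 <= d <= 3)%N -> ((2 <= d)%N -> edge_condition T) ->
  domain (p1_space T) (pos (p1_space T) v) -> v != v' ->
  node_stiffness v v' <= 0.
Proof.
move=> d13 ec vint vv'; rewrite p1_stiffness.
have ab_neq e a b : sm_vert T e a == v -> sm_vert T e b == v' -> a != b.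
  move=> /eqP av /eqP bv; apply: contra_neq vv' => ab; by rewrite -av -bv ab.
have [d1|d2] := leqP d 1.
  have {d13 d1} d1 : d = 1%N by apply/eqP; rewrite eqn_leq d1; case/andP: d13.
  subst d; apply: sumr_le0 => e _; apply: sumr_le0 => a av; apply: sumr_le0 => b bv.
  have ab := ab_neq _ _ _ av bv.
  rewrite mulr_ge0_le0 ?invr_ge0// mulr_ge0_le0//.
  set g := bary_grad _; pose w := sm_pos T (sm_vert T e a) - sm_pos T (sm_vert T e b).
  have ga : g a 0 0 * w 0 0 = 1.
    have := bary_edge (sm_nondegenerate e) a a b.
    by rewrite /dot big_ord1 eqxx [b == a]eq_sym (negbTE ab) subr0.
  have gb : g b 0 0 * w 0 0 = - 1.
    have := bary_edge (sm_nondegenerate e) b a b.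
    by rewrite /dot big_ord1 eqxx (negbTE ab) sub0r.
  rewrite /dot big_ord1 -/g.
  have w0 : w 0 0 != 0.
    by apply/eqP => w0; move: ga => /eqP; rewrite w0 mulr0 eq_sym oner_eq0.
  have -> : g b 0 0 = - g a 0 0.
    by apply: (mulIf w0); rewrite gb mulNr ga.
  by rewrite mulrN oppr_le0 -expr2 sqr_ge0.
(* Nodes without a common cell have a zero entry; otherwise they span an edge, interior because [v]
   lies in the open domain. *)
have [[e0 /andP[ve ve']]|nocell] := pselect (exists e,
    (v \in sm_verts T e) && (v' \in sm_verts T e)); last first.
  rewrite big1// => e _; rewrite big1// => a av; rewrite big1// => b bv.
  exfalso; apply: nocell; exists e; rewrite -(eqP av) -(eqP bv).
  by rewrite !imset_f.
have edge : interior_edge v v'.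
  split=> //; first by exists e0; rewrite ve ve'.
  exists 0; first by rewrite lexx ler01.
  by rewrite subr0 scale1r scale0r addr0.
have sumE := ec d2 _ _ edge; rewrite -oppr_ge0 -sumrN.
suff -> : \sum_e - (\sum_(a | sm_vert T e a == v) \sum_(b | sm_vert T e b == v')
      (d`!%:R)^-1 * (`|\det (vertex_mx (fun i => sm_pos T (sm_vert T e i)) : 'M[R]_d.+1)|
        * dot (bary_grad (fun i => sm_pos T (sm_vert T e i)) a)
              (bary_grad (fun i => sm_pos T (sm_vert T e i)) b)))
  = \sum_e \sum_(a | sm_vert T e a == v) \sum_(b | sm_vert T e b == v')
      1 / (d * d.-1)%N%:R * simplex_volume (opposite e a b)
        * cot (dihedral_angle (opposite e a b) (sm_pos T v) (sm_pos T v')) by [].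
apply: eq_bigr => e _; rewrite -sumrN; apply: eq_bigr => a av.
rewrite -sumrN; apply: eq_bigr => b bv.
have d23 : (2 <= d <= 3)%N by rewrite d2; case/andP: d13.
by rewrite (p1_term e d23 (ab_neq _ _ _ av bv)) opprK (eqP av) (eqP bv).
Qed.

(** * Assembly: the schemes, the constants and the initial merit *)

Lemma monotone_scheme_admissible (R : realType) (d N : nat) (F : fe_space R d)
    (x_ : 'I_N -> node F) (V : 'rV[R]_d -> R) (beta : R)
    (p := fe_problem x_ V beta) :
  (1 <= d <= 3)%N -> monotone_scheme F -> interior_numbering x_ ->
  irreducible_mx (stiffness p) -> 0 < beta ->
  (forall i, 0 <= V (pos F (x_ i))) -> admissible p.
Proof.
move=> d13 scheme; case: scheme x_ @p => [M|T ec] x_ p [x_inj x_int] irr b0 V0.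
  apply: fe_admissible => //.
  - exact: q1_volume_gt0.
  - by move=> i; apply: q1_used; apply/x_int; exists i.
  - by move=> i j ij; apply: q1_off; apply: contra_neq ij; exact: x_inj.
apply: fe_admissible => //.
- exact: p1_volume_gt0.
- by move=> i; exact: sm_node_used.
move=> i j ij; apply: p1_off => //; first by apply/x_int; exists i.
by apply: contra_neq ij; exact: x_inj.
Qed.

Lemma gp_level_bounds (R : realType) (N : nat) (p : gp_problem R N)
    (CS gamma : R) (u0 : 'cV[R]_N) : admissible p -> (0 < N)%N ->
  sobolev_constant p CS -> lpnorm p 2 u0 = 1 -> 0 < gamma <= gamma_max p CS u0 ->
  level_bounds p gamma (E0 p u0) (B0 p CS u0) (B1 p CS u0) (L0 p CS u0)
    (V_sup p) (Lambda_d p).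
Proof.
move=> hp N0 sob u01 gb; split.
- exact: gamma_gt0 gb.
- exact: (E0_gt0 hp u01).
- exact: (le_trans (V_sup_ge0 p) (V_sup_le_B0 hp N0 sob u01)).
- exact: V_sup_ge0.
- exact: vmax_ge0.
- by rewrite -mulrDr; exact: (gamma_D0 hp N0 sob u01 gb).
- exact: gamma_L0 gb.
- exact: (gamma_Lambda hp N0 sob u01 gb).
- by move=> i; exact: potential_le.
- move=> i; have := vmax_ge (fun i => stiffness p i i / weight p 0 i) i.
  by rewrite ler_pdivrMr ?(weight_gt0 hp)// mulrC.
- by move=> k v w k1 v1 vE; exact: (curvature_level hp N0 sob u01 k1 v1 vE w).
- by move=> v w v1 vE; exact: (reaction_pair hp N0 sob u01 w v1 vE).
- move=> u v up vp u1 v1 uE vE; exact: (reaction_sum_norm hp N0 sob u01 up vp u1 v1 uE vE).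
- move=> v i v1 vE; exact: (reaction_level hp N0 sob u01 v1 vE i).
Qed.

(** Here ||z^0|| = 1, so the residual is gamma lambda(u^0) and contributes gamma lambda(u^0)^2. The
    second term of E0 dominates it, as gamma <= 1 and 128 gamma E_h(u^0) <= 128 gamma D <= 1. *)
Lemma initial_merit (R : realType) (N : nat) (p : gp_problem R N)
    (CS gamma : R) (u0 : 'cV[R]_N) : admissible p -> (0 < N)%N ->
  sobolev_constant p CS -> lpnorm p 2 u0 = 1 -> 0 < gamma <= gamma_max p CS u0 ->
  merit p gamma u0 u0 <= E0 p u0.
Proof.
move=> hp N0 sob u01 gb; have g0 := gamma_gt0 gb.
rewrite /merit /residual u01 subrr add0r /E0 lerD2l.
have -> : (gamma * lambda p u0) ^+ 2 / gamma = lambda p u0 ^+ 2 * gamma.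
  by field; rewrite gt_eqF.
apply: ler_wpM2l; first exact: sqr_ge0.
have m0 : 0 < Num.max 1 (128 * energy p u0) by rewrite lt_max ltr01.
rewrite -[X in _ <= X]mul1r ler_pdivlMr// maxr_pMr ?(ltW g0)// ge_max mulr1.
case/andP: (gb) => _; rewrite le_min => /andP[-> _] /=.
have gD := gamma_D0 hp N0 sob u01 gb.
have ED : energy p u0 <= D0 p CS u0.
  apply: le_trans (energy_le_E0 p u0) _; rewrite /D0 lerDl.
  exact: le_trans (V_sup_ge0 p) (V_sup_le_B0 hp N0 sob u01).
have := ler_wpM2l (ltW g0) ED; move: gD.
by move: (gamma * D0 p CS u0) => X; rewrite mulrCA; move: (gamma * energy p u0) => *; lra.
Qed.

Theorem theorem5p1 (R : realType) (d N : nat) (F : fe_space R d)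
    (x_ : 'I_N -> node F) (V : 'rV[R]_d -> R) (beta CS gamma : R)
    (u0 uGS : 'cV[R]_N) (z u x : nat -> 'cV[R]_N)
    (p := fe_problem x_ V beta) :
  (1 <= d <= 3)%N -> (2 <= N)%N ->
  monotone_scheme F -> interior_numbering x_ ->
  irreducible_mx (stiffness p) ->
  0 < beta -> (forall i, 0 <= V (pos F (x_ i))) ->
  sobolev_constant p CS ->
  (forall i, 0 < u0 i 0) -> lpnorm p 2 u0 = 1 ->
  0 < gamma <= gamma_max p CS u0 ->
  z 0%N = u0 ->
  (forall k, u k = (lpnorm p 2 (z k))^-1 *: z k) ->
  (forall k, x k = invmx (1%:M - gamma *: lapM p)
     *m (2 *: u k - z k
         - gamma *: (potM p *m u k + beta *: epow (u k) 3))) ->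
  (forall k, z k.+1 = z k + x k - u k) ->
  is_ground_state p uGS ->
  let EGS := energy p uGS in
  let mGS := vmin (fun i => uGS i 0) in
  let L := fun k => merit p gamma (z k) (u k) in
  exists nu mu_max : R,
    let eta := Num.min (gamma * nu / (4 * (1 + gamma * mu_max))) (1 / 2) in
    [/\ is_minimum (hessian_values p uGS) nu,
        is_largest_eigenvalue (- lapM p) mu_max,
        2 * beta * mGS ^+ 2 <= nu /\ 0 < 2 * beta * mGS ^+ 2,
        0 < eta < 1
      & exists K : nat, forall k : nat, (K <= k)%N ->
          L k.+1 - EGS <= (1 - eta) * (L k - EGS) /\
          energy p (u k) - EGS + residual p gamma (z k) (u k) ^+ 2 / gamma
            + nu / 4 * lpnorm p 2 (u k - uGS) ^+ 2
          <= 2 * (1 - eta) ^+ (k - K) * (L K - EGS)].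
Proof.
move=> d13 N2 scheme numb irr b0 V0 sob u0_gt0 u01 gb z0 uE xE zE gs EGS mGS L.
have hp : admissible p by exact: monotone_scheme_admissible.
have N0 : (0 < N)%N by exact: leq_trans N2.
have lb := gp_level_bounds hp N0 sob u01 gb.
have u00 : u 0%N = u0 by rewrite uE z0 u01 invr1 scale1r.
have z0_ge0 i : 0 <= z 0%N i 0 by rewrite z0 ltW.
have z01 : lpnorm p 2 (z 0%N) = 1 by rewrite z0.
have m0 : merit p gamma (z 0%N) (u 0%N) <= E0 p u0.
  by rewrite z0 u00; exact: initial_merit gb.
exact: (local_linear_convergence hp lb N2 z0_ge0 z01 m0 uE xE zE gs).
Qed.
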